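(* \textsc{Short Choice} is PEPP-hard: \textsc{Empty} polynomial-time reduces to \textsc{Short Choice}.
   Context: All circuits are Boolean circuits of size polynomial in $n$. A search problem $A$ polynomial-time reduces to a search problem $B$ if there are polynomial-time computable maps $f,g$ such that for every instance $I$ of $A$, $f(I)$ is an instance of $B$, and for every solution $s$ of $f(I)$, $g(I,s)$ is a solution of $I$. For a positive integer $m$, $[m]$ denotes a set of $m$ consecutive integers (encoded by $n$-bit strings). \textsc{Empty}: given a poly($n$)-size circuit $C:[2^n-2]\to[2^n-1]$, find an element $e\in[2^n-1]$ such that $C(i)\neq e$ for all $i\in[2^n-2]$. PEPP is the class of search problems polynomial-time reducible to \textsc{Empty}; a problem is PEPP-hard if \textsc{Empty} reduces to it. \textsc{Short Choice}: The universe $U$ is a set of $2^n-2$ objects, each represented by a distinct $n$-bit string. The input is a sequence of predicates $P_0,\dots,P_{n-2}$ given by poly($n$)-size circuits, with $P_i:U^{i+2}\to\{0,1\}$. A Long Choice subcertificate is a sequence of distinct elements $a_0,\dots,a_k\in U$ such that for every $i$ with $0\le i<k$ and every $j$ with $i<j\le k$, $P_i(a_0,\dots,a_i,a_j)=P_i(a_0,\dots,a_i,a_{i+1})$. An element $x\in U\setminus\{a_0,\dots,a_k\}$ extends the subcertificate if $a_0,\dots,a_k,x$ is again a Long Choice subcertificate. A solution of \textsc{Short Choice} consists of an integer $k$ with $0\le k\le n-2$, a Long Choice subcertificate $a_0,\dots,a_k$, and a bit $c\in\{0,1\}$ such that there is no $x$ extending $a_0,\dots,a_k$ with $P_k(a_0,\dots,a_k,x)=c$.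 *)

(* Defs.v *)
From mathcomp Require Import all_boot.
Set Implicit Arguments. Unset Strict Implicit. Unset Printing Implicit Defensive.

Definition bits := seq bool.

Definition nbits (n v : nat) : bits :=
  mkseq (fun i => odd (v %/ 2 ^ (n - 1 - i))) n.

Definition val_of_bits (s : bits) : nat :=
  foldl (fun acc (b : bool) => acc.*2 + b) 0 s.

Fixpoint binr (fuel n : nat) : bits :=
  match fuel with
  | 0 => [::]
  | f.+1 => if n == 0 then [::] else odd n :: binr f n./2
  end.

Definition dbl (s : bits) : bits := flatten [seq [:: b; b] | b <- s].

(* self-delimiting code of a nat: doubled bits, then the separator 01 *)
Definition enc_nat (n : nat) : bits := dbl (binr n n) ++ [:: false; true].

Definition enc_nats (s : seq nat) : bits := flatten (map enc_nat s).

Definition enc_pair (x y : bits) : bits := dbl x ++ [:: false; true] ++ y.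

(* Wires 0..c_in-1 are the inputs, wire c_in+j is the output of gate j. *)
Inductive gate := GAnd of nat & nat | GOr of nat & nat | GNot of nat.

Record circuit := Circuit { c_in : nat; c_gates : seq gate; c_out : seq nat }.

Definition gate_val (w : bits) (g : gate) : bool :=
  match g with
  | GAnd a b => nth false w a && nth false w b
  | GOr a b => nth false w a || nth false w b
  | GNot a => ~~ nth false w a
  end.

Definition circ_eval (C : circuit) (inp : bits) : bits :=
  let w := foldl (fun w g => rcons w (gate_val w g)) inp (c_gates C) in
  map (nth false w) (c_out C).

Definition gate_wf (bound : nat) (g : gate) : bool :=
  match g with
  | GAnd a b | GOr a b => (a < bound) && (b < bound)
  | GNot a => a < bound
  end.

Definition circ_wf (C : circuit) : bool :=
  all (fun j => gate_wf (c_in C + j) (nth (GNot 0) (c_gates C) j))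
      (iota 0 (size (c_gates C)))
  && all (fun o => o < c_in C + size (c_gates C)) (c_out C).

Definition circ_type (m p : nat) (C : circuit) : bool :=
  [&& circ_wf C, c_in C == m & size (c_out C) == p].

Definition gate_code (g : gate) : seq nat :=
  match g with
  | GAnd a b => [:: 0; a; b]
  | GOr a b => [:: 1; a; b]
  | GNot a => [:: 2; a; 0]
  end.

(* self-delimiting code of a circuit as a sequence of naturals *)
Definition circ_code (C : circuit) : seq nat :=
  [:: c_in C, size (c_gates C) & flatten (map gate_code (c_gates C))]
  ++ size (c_out C) :: c_out C.

Record search_problem := SearchProblem {
  sp_inst : bits -> Prop;
  sp_sol : bits -> bits -> Prop }.

(* Single-tape deterministic Turing machines over {0,1,blank}
   (blank = None); the tape is infinite in both directions. *)
Inductive move := MLeft | MRight | MStay.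

Record TM := MkTM {
  tm_Q : nat;                                  (* states 'I_(tm_Q.+1), start = ord0 *)
  tm_delta : 'I_tm_Q.+1 -> option bool -> 'I_tm_Q.+1 * option bool * move;
  tm_halt : 'I_tm_Q.+1 -> bool }.

(* state, reversed left part of tape, scanned cell, right part of tape *)
Definition config (M : TM) :=
  ('I_(tm_Q M).+1 * seq (option bool) * option bool * seq (option bool))%type.

Definition tm_step (M : TM) (c : config M) : config M :=
  let: (q, L, a, R) := c in
  if tm_halt q then c else
  let: (q', w, m) := tm_delta q a in
  match m with
  | MStay => (q', L, w, R)
  | MLeft => match L with
             | [::] => (q', [::], None, w :: R)
             | b :: L' => (q', L', b, w :: R)
             end
  | MRight => match R with
              | [::] => (q', w :: L, None, [::])
              | b :: R' => (q', w :: L, b, R')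
              end
  end.

Definition tm_init (M : TM) (x : bits) : config M :=
  match x with
  | [::] => (ord0, [::], None, [::])
  | b :: r => (ord0, [::], Some b, map Some r)
  end.

Fixpoint read_bits (s : seq (option bool)) : bits :=
  match s with
  | Some b :: s' => b :: read_bits s'
  | _ => [::]
  end.

Definition tm_runs_in (M : TM) (x : bits) (t : nat) (y : bits) : bool :=
  let: (q, L, a, R) := iter t (@tm_step M) (tm_init M x) in
  tm_halt q && (read_bits (a :: R) == y).

Definition poly_time (F : bits -> bits) : Prop :=
  exists (M : TM) (c k : nat), forall x : bits,
    exists t, t <= c * (size x).+1 ^ k /\ tm_runs_in M x t (F x).

Definition poly_reduces (A B : search_problem) : Prop :=
  exists f g : bits -> bits, poly_time f /\ poly_time g /\
    forall x, sp_inst A x ->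
      sp_inst B (f x) /\
      forall s, sp_sol B (f x) s -> sp_sol A x (g (enc_pair x s)).

(* [m] = {0,...,m-1}, encoded by n-bit strings *)
Definition empty_valid (n : nat) (C : circuit) : Prop :=
  0 < n /\ circ_type n n C.

Definition empty_sol (n : nat) (C : circuit) (e : nat) : Prop :=
  e < 2 ^ n - 1 /\
  forall i, i < 2 ^ n - 2 -> val_of_bits (circ_eval C (nbits n i)) <> e.

Definition Empty : search_problem :=
  SearchProblem
    (fun x => exists n C, empty_valid n C /\ x = enc_nats (n :: circ_code C))
    (fun x s => exists n C e, empty_valid n C /\
        x = enc_nats (n :: circ_code C) /\ s = enc_nats [:: e] /\
        empty_sol n C e).

(* Universe U = {0,...,2^n-3}, elements encoded by n-bit strings.
   P = [:: P_0; ...; P_(n-2)], P_i has (i+2)*n inputs and one output. *)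
Definition sc_valid (n : nat) (P : seq circuit) : Prop :=
  1 < n /\ size P = n.-1 /\
  forall i, i < n.-1 -> circ_type (i.+2 * n) 1 (nth (Circuit 0 [::] [::]) P i).

Definition sc_pred (n : nat) (P : seq circuit) (i : nat) (a : seq nat) (y : nat)
  : bool :=
  head false (circ_eval (nth (Circuit 0 [::] [::]) P i)
                        (flatten (map (nbits n) (rcons (take i.+1 a) y)))).

Definition in_U (n x : nat) : bool := x < 2 ^ n - 2.

Definition subcert (n : nat) (P : seq circuit) (a : seq nat) : Prop :=
  0 < size a /\ all (in_U n) a /\ uniq a /\
  forall i j, i < j -> j < size a -> i < (size a).-1 ->
    sc_pred n P i a (nth 0 a j) = sc_pred n P i a (nth 0 a i.+1).

Definition extends (n : nat) (P : seq circuit) (a : seq nat) (x : nat) : Prop :=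
  in_U n x /\ x \notin a /\ subcert n P (rcons a x).

Definition sc_sol (n : nat) (P : seq circuit) (k : nat) (a : seq nat) (c : bool)
  : Prop :=
  k <= n - 2 /\ size a = k.+1 /\ subcert n P a /\
  ~ (exists x, extends n P a x /\ sc_pred n P k a x = c).

Definition ShortChoice : search_problem :=
  SearchProblem
    (fun x => exists n P, sc_valid n P /\
        x = enc_nats (n :: flatten (map circ_code P)))
    (fun x s => exists n P k a (c : bool), sc_valid n P /\
        x = enc_nats (n :: flatten (map circ_code P)) /\
        s = enc_nats [:: k, nat_of_bool c & a] /\
        sc_sol n P k a c).

(* Main.v *)
(* The given circuit C sends the universe to the cube {0,1}^n, from which the
   point 1...1 is removed.  A subcertificate a_0, ..., a_k determines a chain of
   subcubes, the l-th with l coordinates fixed, such that the l-th one contains at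
   most one point z_l among 1...1, C(a_0), ..., C(a_(l-1)).  Let P_l read C(x) at
   the first free coordinate where C(a_l) and z_l differ (at the first free
   coordinate if there is none).  Each half of the subcube then contains at most
   one of the points 1...1, C(a_0), ..., C(a_l), and every later element of a
   subcertificate is mapped to the half chosen by a_(l+1).  If no x extends
   a_0, ..., a_k with P_k = c, the corresponding half contains no value of C
   except possibly that one point; as k <= n - 2 the half still has a free
   coordinate, and its point opposite to the exceptional one is not a value.

   Both maps are shown to be computable in polynomial time by expressing them
   with bounded loops over lists, which are compiled to programs on finitely many
   registers, and these to a single-tape machine. *)

From Stdlib Require Import ZArith Lia FunctionalExtensionality.
Require Import Defs.
From mathcomp Require Import all_boot.
From mathcomp Require Import zify.
Set Implicit Arguments. Unset Strict Implicit. Unset Printing Implicit Defensive.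

(** * Structured tape programs *)

(** The universe of Short Choice and the domain of [C] both have [2 ^ n - 2] elements, so elements
    serve as arguments of [C] without recoding; 1...1 is removed because a solution of Empty must be
    below [2 ^ n - 1]. A coordinate where C(a_l) and z_l differ puts them into different halves; if
    they agree on all free coordinates they are one point of the subcube and any split will do. So a
    mask and one exceptional point are all the state there is, and a circuit can recompute it level
    by level from a_0, ..., a_l. An argument x that [C] sends to the opposite point would itself
    extend the subcertificate: the point lies in every chosen subcube, it has the bit c at the
    selected coordinate, and it differs from the images of all a_j, so x is new.

    The obstacle is [poly_time]: it asks for one machine whose time bound holds on every string,
    malformed ones included. Loops run over lists, which makes loop counters and indices unary;
    binary tokens are therefore either cut off or handled bit by bit. *)

Notation sym := (option bool).

(** A function on all cells identifies tapes that differ only by explicit blanks at the ends, which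
    the lists in [config] distinguish. *)
Definition tape := Z -> sym.

Definition put (T : tape) (p : Z) (a : sym) : tape :=
  fun q => if Z.eqb q p then a else T q.

Lemma put_id T p : put T p (T p) = T.
Proof.
apply: functional_extensionality => q; rewrite /put.
by case: Z.eqb_spec => [->|].
Qed.

Definition dz (d : bool) : Z := if d then 1%Z else (-1)%Z.

Inductive tprog :=
| TSkip
| TWrite of sym
| TMove of bool
| TSeq of tprog & tprog
| TIf of (sym -> bool) & tprog & tprog
| TLoop of tprog & (sym -> bool) & tprog.

(* [TLoop c1 b c2] runs [c1], stops if [b] fails on the scanned symbol, and
   otherwise runs [c2] and starts again. *)
Inductive trun : tprog -> Z -> tape -> nat -> Z -> tape -> Prop :=
| RSkip p T : trun TSkip p T 0 p T
| RWrite a p T : trun (TWrite a) p T 1 p (put T p a)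
| RMove d p T : trun (TMove d) p T 1 (p + dz d)%Z T
| RSeq c1 c2 p T t1 p1 T1 t2 p2 T2 :
    trun c1 p T t1 p1 T1 -> trun c2 p1 T1 t2 p2 T2 ->
    trun (TSeq c1 c2) p T (t1 + t2) p2 T2
| RIfT (b : sym -> bool) c1 c2 p T t p1 T1 :
    b (T p) -> trun c1 p T t p1 T1 -> trun (TIf b c1 c2) p T t.+2 p1 T1
| RIfF (b : sym -> bool) c1 c2 p T t p1 T1 :
    ~~ b (T p) -> trun c2 p T t p1 T1 -> trun (TIf b c1 c2) p T t.+1 p1 T1
| RLoopF c1 (b : sym -> bool) c2 p T t p1 T1 :
    trun c1 p T t p1 T1 -> ~~ b (T1 p1) ->
    trun (TLoop c1 b c2) p T t.+1 p1 T1
| RLoopT c1 (b : sym -> bool) c2 p T t1 p1 T1 t2 p2 T2 t3 p3 T3 :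
    trun c1 p T t1 p1 T1 -> b (T1 p1) -> trun c2 p1 T1 t2 p2 T2 ->
    trun (TLoop c1 b c2) p2 T2 t3 p3 T3 ->
    trun (TLoop c1 b c2) p T (t1 + t2 + t3).+2 p3 T3.

(** * Compilation of tape programs to transition tables *)

Definition row := sym -> nat * sym * move.
Definition row0 : row := fun a => (0, a, MStay).

Fixpoint tlen (c : tprog) : nat :=
  match c with
  | TSkip => 0
  | TWrite _ | TMove _ => 1
  | TSeq c1 c2 => tlen c1 + tlen c2
  | TIf _ c1 c2 => (tlen c1 + tlen c2).+2
  | TLoop c1 _ c2 => (tlen c1 + tlen c2).+2
  end.

(** [o] is the absolute address of the first row, and control leaves at [o + tlen c]. The first
    branch of [TIf] ends in a row that jumps over the second, hence [t.+2] in [RIfT] against [t.+1]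
    in [RIfF]; likewise a loop round costs the test and the jump back. *)
Fixpoint tcomp (c : tprog) (o : nat) : seq row :=
  match c with
  | TSkip => [::]
  | TWrite a => [:: fun _ => (o.+1, a, MStay)]
  | TMove d => [:: fun a => (o.+1, a, if d then MRight else MLeft)]
  | TSeq c1 c2 => tcomp c1 o ++ tcomp c2 (o + tlen c1)
  | TIf b c1 c2 =>
      (fun a => (if b a then o.+1 else o + (tlen c1).+2, a, MStay))
      :: tcomp c1 o.+1
      ++ (fun a => (o + (tlen c1 + tlen c2).+2, a, MStay))
      :: tcomp c2 (o + (tlen c1).+2)
  | TLoop c1 b c2 =>
      tcomp c1 o
      ++ (fun a => (if b a then (o + tlen c1).+1
                    else o + (tlen c1 + tlen c2).+2, a, MStay))
      :: tcomp c2 (o + tlen c1).+1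
      ++ [:: fun a => (o, a, MStay)]
  end.

Lemma size_tcomp c o : size (tcomp c o) = tlen c.
Proof.
elim: c o => //= [c1 I1 c2 I2|b c1 I1 c2 I2|c1 I1 b c2 I2] o;
  by rewrite ?size_cat /= ?I1 ?I2 ?size_cat /= ?I1 ?I2; lia.
Qed.

Definition mvz (m : move) (p : Z) : Z :=
  match m with MLeft => (p - 1)%Z | MRight => (p + 1)%Z | MStay => p end.

Section Table.
Variable tbl : seq row.

(** Address [size tbl] is the halting state; [minn] maps larger targets to it, so that every target
    is a state of the machine. *)
Definition mstep (s : nat * Z * tape) : nat * Z * tape :=
  let: (pc, p, T) := s in
  if pc < size tbl then
    let: (pc', a, m) := nth row0 tbl pc (T p) in
    (minn pc' (size tbl), mvz m p, put T p a)
  else s.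

Lemma mstepE pc p T :
  pc < size tbl ->
  mstep (pc, p, T) =
    (minn (nth row0 tbl pc (T p)).1.1 (size tbl),
     mvz (nth row0 tbl pc (T p)).2 p, put T p (nth row0 tbl pc (T p)).1.2).
Proof. by move=> /= ->; case: (nth _ _ _ _) => [[]]. Qed.

(** Arbitrary [pre] and [post] let the induction treat a subprogram in place, within the table of
    the whole program. *)
Lemma tcomp_correct c p T t p' T' :
  trun c p T t p' T' -> forall pre post,
  tbl = pre ++ tcomp c (size pre) ++ post ->
  iter t mstep (size pre, p, T) = (size pre + tlen c, p', T').
Proof.
have nthm pre x post : nth row0 (pre ++ x :: post) (size pre) = x.
  by rewrite nth_cat ltnn subnn.
elim=> {c p T t p' T'}.
- by move=> p T pre post _; rewrite addn0.
- move=> a p T pre post E /=.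
  have l : size pre < size tbl by rewrite E size_cat /=; lia.
  have m : minn (size pre).+1 (size tbl) = size pre + 1 by lia.
  rewrite [LHS](mstepE _ _ l) {1 3 4}E nthm /= m //.
- move=> d p T pre post E /=.
  have l : size pre < size tbl by rewrite E size_cat /=; lia.
  have m : minn (size pre).+1 (size tbl) = size pre + 1 by lia.
  by rewrite [LHS](mstepE _ _ l) {1 3 4}E nthm /= m put_id; case: d {E}.
- move=> c1 c2 p T t1 p1 T1 t2 p2 T2 _ I1 _ I2 pre post E; rewrite /= in E.
  rewrite addnC iterD (I1 pre (tcomp c2 (size pre + tlen c1) ++ post)).
    rewrite -(size_tcomp c1 (size pre)) -size_cat.
    rewrite (I2 _ post) ?size_cat ?size_tcomp ?addnA //.
    by rewrite E -!catA.
  by rewrite E -!catA.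
- move=> b c1 c2 p T t p1 T1 bT _ I1 pre post E; rewrite /= in E.
  have st : size tbl = size pre + (tlen c1 + tlen c2).+2 + size post.
    by rewrite E !size_cat /= !size_cat /= !size_tcomp; lia.
  have l : size pre < size tbl by lia.
  have -> : t.+2 = 1 + (t + 1) by lia.
  rewrite !iterD [iter 1 _ (size pre, _, _)](mstepE _ _ l).
  set x := (fun a : sym => _) in E.
  set y := (fun a : sym => (size pre + (tlen c1 + tlen c2).+2, _, _)) in E.
  have -> : nth row0 tbl (size pre) = x by rewrite E nthm.
  rewrite /x /= bT put_id.
  have -> : minn (size pre).+1 (size tbl) = (size pre).+1 by lia.
  have E2 : tbl = rcons pre x ++ tcomp c1 (size pre).+1 ++
       (y :: tcomp c2 (size pre + (tlen c1).+2)) ++ post.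
    by rewrite E -cats1 -!catA.
  have sr : size (rcons pre x) = (size pre).+1 by rewrite size_rcons.
  rewrite -sr (I1 _ (y :: tcomp c2 (size pre + (tlen c1).+2) ++ post)); last first.
    by rewrite sr E2.
  rewrite sr.
  have l2 : (size pre).+1 + tlen c1 < size tbl by lia.
  rewrite [LHS](mstepE _ _ l2).
  have -> : nth row0 tbl ((size pre).+1 + tlen c1) = y.
    rewrite E2 catA -(size_tcomp c1 (size pre).+1) -sr -size_cat.
    by rewrite cat_cons nthm.
  by rewrite /= put_id; congr (_, _, _); lia.
- move=> b c1 c2 p T t p1 T1 bT _ I1 pre post E; rewrite /= in E.
  have st : size tbl = size pre + (tlen c1 + tlen c2).+2 + size post.
    by rewrite E !size_cat /= !size_cat /= !size_tcomp; lia.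
  have l : size pre < size tbl by lia.
  have -> : t.+1 = t + 1 by lia.
  rewrite !iterD [iter 1 _ (size pre, _, _)](mstepE _ _ l).
  set x := (fun a : sym => _) in E.
  set y := (fun a : sym => (size pre + (tlen c1 + tlen c2).+2, _, _)) in E.
  have -> : nth row0 tbl (size pre) = x by rewrite E nthm.
  rewrite /x /= (negbTE bT) put_id.
  have -> : minn (size pre + (tlen c1).+2) (size tbl)
     = size pre + (tlen c1).+2 by lia.
  have E2 : tbl = (pre ++ x :: tcomp c1 (size pre).+1 ++ [:: y]) ++
       tcomp c2 (size pre + (tlen c1).+2) ++ post.
    by rewrite E -!catA /= -!catA.
  have sr : size (pre ++ x :: tcomp c1 (size pre).+1 ++ [:: y])
    = size pre + (tlen c1).+2.
    by rewrite size_cat /= size_cat /= size_tcomp; lia.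
  rewrite -sr (I1 _ post) sr; first by congr (_, _, _); lia.
  exact: E2.
- move=> c1 b c2 p T t p1 T1 _ I1 bT pre post E; rewrite /= in E.
  have st : size tbl = size pre + (tlen c1 + tlen c2).+2 + size post.
    by rewrite E !size_cat /= !size_cat /= !size_tcomp; lia.
  have e1 : tbl = pre ++ tcomp c1 (size pre) ++
     drop (tlen c1) (tcomp (TLoop c1 b c2) (size pre)) ++ post.
    by rewrite E /= drop_size_cat ?size_tcomp // -catA.
  have -> : t.+1 = 1 + t by lia.
  rewrite iterD (I1 _ _ e1).
  have l : size pre + tlen c1 < size tbl by lia.
  rewrite [LHS](mstepE _ _ l).
  set x := (fun a : sym => (if b a then _ else _, _, _)) in E.
  have -> : nth row0 tbl (size pre + tlen c1) = x.
    rewrite E -catA catA -{2}(size_tcomp c1 (size pre)) -size_cat.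
    by rewrite nthm.
  by rewrite /x /= (negbTE bT) put_id; congr (_, _, _); lia.
- move=> c1 b c2 p T t1 p1 T1 t2 p2 T2 t3 p3 T3 _ I1 bT _ I2 _ I3 pre post E.
  have E0 := E; rewrite /= in E.
  have st : size tbl = size pre + (tlen c1 + tlen c2).+2 + size post.
    by rewrite E !size_cat /= !size_cat /= !size_tcomp; lia.
  have -> : (t1 + t2 + t3).+2 = t3 + (1 + (t2 + (1 + t1))) by lia.
  have e1 : tbl = pre ++ tcomp c1 (size pre) ++
     drop (tlen c1) (tcomp (TLoop c1 b c2) (size pre)) ++ post.
    by rewrite E /= drop_size_cat ?size_tcomp // -catA.
  rewrite !iterD (I1 _ _ e1).
  have l : size pre + tlen c1 < size tbl by lia.
  rewrite [iter 1 _ (_ + tlen c1, _, _)](mstepE _ _ l).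
  set x := (fun a : sym => (if b a then _ else _, _, _)) in E.
  have -> : nth row0 tbl (size pre + tlen c1) = x.
    rewrite E -catA catA -{2}(size_tcomp c1 (size pre)) -size_cat.
    by rewrite nthm.
  rewrite /x /= bT put_id.
  have -> : minn (size pre + tlen c1).+1 (size tbl) = (size pre + tlen c1).+1
    by lia.
  have sr : size (pre ++ tcomp c1 (size pre) ++ [:: x])
     = (size pre + tlen c1).+1.
    by rewrite !size_cat /= !size_tcomp; lia.
  rewrite -sr (I2 _ ((fun a => (size pre, a, MStay)) :: post)); last first.
    by rewrite sr E -!catA /= -!catA.
  rewrite sr.
  have l2 : (size pre + tlen c1).+1 + tlen c2 < size tbl by lia.
  rewrite -[mstep _]/(iter 1 mstep _) /= -/(mstep (_, _, _)).
  have := @mstepE _ p2 T2 l2; rewrite /= => ->.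
  have -> : nth row0 tbl ((size pre + tlen c1).+1 + tlen c2)
    = fun a => (size pre, a, MStay).
    have E3 : tbl = (pre ++ tcomp c1 (size pre) ++ x ::
        tcomp c2 (size pre + tlen c1).+1) ++ (fun a => (size pre, a, MStay)) :: post.
      by rewrite E -!catA /= -!catA.
    have <- : size (pre ++ tcomp c1 (size pre) ++ x ::
        tcomp c2 (size pre + tlen c1).+1) = (size pre + tlen c1).+1 + tlen c2.
      by rewrite !size_cat /= !size_tcomp; lia.
    by rewrite {1}E3 nthm.
  rewrite /= put_id.
  have -> : minn (size pre) (size tbl) = size pre by lia.
  by rewrite (I3 pre post).
Qed.

Definition tm_of : TM :=
  @MkTM (size tbl)
    (fun q a => let: (pc, w, m) := nth row0 tbl q a in
                (inord (minn pc (size tbl)), w, m))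
    (fun q => q == size tbl :> nat).

(** The default [None] of [nth] makes cells beyond the ends of the two lists blank. *)
Definition zrel (c : config tm_of) (s : nat * Z * tape) : Prop :=
  let: (q, L, a, R) := c in let: (pc, p, T) := s in
  [/\ q = pc :> nat,
      forall j, nth None (a :: R) j = T (p + Z.of_nat j)%Z
    & forall j, nth None L j = T (p - 1 - Z.of_nat j)%Z].

Lemma zrel_step c s : zrel c s -> zrel (tm_step c) (mstep s).
Proof.
case: c => [[[q L] a] R]; case: s => [[pc p] T] [qpc HR HL].
rewrite /tm_step /mstep /=.
have := ltn_ord q; rewrite ltnS leq_eqVlt => /orP[/eqP e|lt].
  by rewrite e eqxx -qpc e ltnn; split.
rewrite -qpc lt (ltn_eqF lt).
have -> : T p = a by have := HR 0; rewrite /= Z.add_0_r.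
case: (nth row0 tbl q a) => [[pc' w] m].
have qq : @inord (size tbl) (minn pc' (size tbl)) = minn pc' (size tbl) :> nat.
  by rewrite inordK //; lia.
have HR' j : nth None R j = T (p + 1 + Z.of_nat j)%Z.
  by have := HR j.+1; rewrite /= => ->; congr T; lia.
have pe x y : put T x w y = if Z.eqb y x then w else T y by [].
case: m => /=.
- case: L HL => [|b L] HL /=; split => // j.
  + case: j => [|[|j]] /=; rewrite pe; case: Z.eqb_spec => //= h; try lia.
    * by have := HL 0; rewrite /= => ->; congr T; lia.
    * by rewrite HR'; congr T; lia.
  + rewrite nth_nil pe; case: Z.eqb_spec => //= h; try lia.
    by have := HL j.+1; rewrite nth_nil => ->; congr T; lia.
  + case: j => [|[|j]] /=; rewrite pe; case: Z.eqb_spec => //= h; try lia.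
    * by have := HL 0; rewrite /= => ->; congr T; lia.
    * by rewrite HR'; congr T; lia.
  + rewrite pe; case: Z.eqb_spec => //= h; try lia.
    by have := HL j.+1; rewrite /= => ->; congr T; lia.
- case: R HR HR' => [|b R] HR HR' /=; split => // j.
  + rewrite pe; case: Z.eqb_spec => //= h; try lia.
    have := HR' j; rewrite nth_nil => ->.
    by case: j h => [|j] h /=; rewrite ?nth_nil.
  + case: j => [|j] /=; rewrite pe; case: Z.eqb_spec => //= h; try lia.
    by rewrite HL; congr T; lia.
  + by rewrite pe; case: Z.eqb_spec => //= h; lia.
  + case: j => [|j] /=; rewrite pe; case: Z.eqb_spec => //= h; try lia.
    by rewrite HL; congr T; lia.
- split=> // j.
  + case: j => [|j] /=; rewrite pe; case: Z.eqb_spec => //= h; try lia.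
    by rewrite HR'; congr T; lia.
  + rewrite pe; case: Z.eqb_spec => //= h; lia.
Qed.

Lemma zrel_iter t c s : zrel c s -> zrel (iter t (@tm_step tm_of) c) (iter t mstep s).
Proof. by move=> h; elim: t => //= t; exact: zrel_step. Qed.

End Table.

Lemma read_bitsP s y :
  (forall j, nth None s j = nth None (map Some y) j) -> read_bits s = y.
Proof.
elim: y s => [|b y IH] [|a s] //= h.
- by have := h 0 => /= ->.
- by have := h 0.
- have /= -> := h 0; congr cons; apply: IH => j.
  exact: (h j.+1).
Qed.

Definition tape_of (x : bits) (p0 : Z) : tape :=
  fun p => if Z.ltb p p0 then None else nth None (map Some x) (Z.to_nat (p - p0)).

(** The position [p0] of the input is free since the machine's tape has no origin; it will be 2, the
    first content cell of register 0. *)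
Lemma tprog_tm (c : tprog) : exists M : TM, forall x t y p0 p T,
  trun c p0 (tape_of x p0) t p T ->
  (forall j, T (p + Z.of_nat j)%Z = nth None (map Some y) j) ->
  tm_runs_in M x t y.
Proof.
exists (tm_of (tcomp c 0)) => x t y p0 p T run out.
have h : zrel (tm_init (tm_of (tcomp c 0)) x) (0, p0, tape_of x p0).
  have H j : nth None (map Some x) j = tape_of x p0 (p0 + Z.of_nat j)%Z.
    rewrite /tape_of; have -> : Z.ltb (p0 + Z.of_nat j) p0 = false by lia.
    by congr nth; lia.
  have N j : None = tape_of x p0 (p0 - 1 - Z.of_nat j)%Z.
    by rewrite /tape_of; have -> : Z.ltb (p0 - 1 - Z.of_nat j) p0 = true by lia.
  rewrite /tm_init; case: x H N {run} => [|b x] H N; split=> //= j; rewrite ?nth_nil //.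
  by rewrite -H; case: j => // j; rewrite /= nth_nil.
have := zrel_iter t h.
have := tcomp_correct (tbl := tcomp c 0) run (pre := [::]) (post := [::]).
rewrite cats0 => /(_ erefl) -> /=.
rewrite /tm_runs_in; case: (iter _ _ _) => [[[q L] a] R] [e1 e2 _].
rewrite /= e1 add0n size_tcomp eqxx /=; apply/eqP.
rewrite -/(read_bits (a :: R)).
by apply: read_bitsP => j; rewrite e2 out.
Qed.

(** * Register programs on a tape *)

Definition store := nat -> bits.
Definition upd (s : store) r v : store := fun q => if q == r then v else s q.

Inductive sp :=
| Skip
| Push of nat & bool
| Pop of nat
| Seq of sp & sp
| IfTop of nat & (sym -> bool) & sp & sp
| While of nat & sp.

Inductive exec : sp -> store -> nat -> store -> Prop :=
| ESkip s : exec Skip s 1 s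
| EPush r b s : exec (Push r b) s 1 (upd s r (b :: s r))
| EPop r s : exec (Pop r) s 1 (upd s r (behead (s r)))
| ESeq c1 c2 s t1 s1 t2 s2 :
    exec c1 s t1 s1 -> exec c2 s1 t2 s2 -> exec (Seq c1 c2) s (t1 + t2) s2
| EIf r (b : sym -> bool) c1 c2 s t s1 :
    exec (if b (ohead (s r)) then c1 else c2) s t s1 ->
    exec (IfTop r b c1 c2) s t.+1 s1
| EWhile0 r c s : s r = [::] -> exec (While r c) s 1 s
| EWhileS r c s t1 s1 t2 s2 :
    s r <> [::] -> exec c s t1 s1 -> exec (While r c) s1 t2 s2 ->
    exec (While r c) s (t1 + t2).+1 s2.

Fixpoint regs (c : sp) : nat :=
  match c with
  | Skip => 0
  | Push r _ | Pop r => r.+1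
  | Seq c1 c2 => maxn (regs c1) (regs c2)
  | IfTop r _ c1 c2 => maxn r.+1 (maxn (regs c1) (regs c2))
  | While r c => maxn r.+1 (regs c)
  end.

(** A unit of time pushes at most one symbol. Time thus bounds the distances the head walks and, in
    [pt_bound], the size of results. *)
Lemma exec_size c s t s' r : exec c s t s' -> size (s' r) <= size (s r) + t.
Proof.
elim=> {c s t s'} //=; rewrite /upd; intros; try lia.
- by case: eqP => [->|] /=; lia.
- by case: eqP => [->|] /=; rewrite ?size_behead; lia.
Qed.

(* Register 0 occupies the cells to the right of the origin; registers
   1, ..., K-1 are interleaved, with stride K, on the left.  Cell j.+1 of a
   register holds its j-th element from the bottom; cell 0 stays blank. *)
Section Layout.
Variable K : nat.

Definition dir (r : nat) : bool := r == 0.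
Definition off (r : nat) : nat := if r == 0 then 1 else r.
Definition stride (r : nat) : nat := if r == 0 then 1 else K.
Definition addr (r j : nat) : Z := (dz (dir r) * Z.of_nat (off r + stride r * j))%Z.

(** The sign separates register 0 from the others, and among these the residue modulo [K] determines
    the register. *)
Lemma addr_inj r j r' j' : r < K -> r' < K ->
  addr r j = addr r' j' -> r = r' /\ j = j'.
Proof.
rewrite /addr /dir /off /stride /dz.
case: eqP => [->|h]; case: eqP => [->|h'] h1 h2 e; try lia.
have {}e : r + K * j = r' + K * j' by lia.
have er : r = r'.
  have : (r + K * j) %% K = (r' + K * j') %% K by rewrite e.
  by rewrite ![_ + K * _]addnC ![K * _]mulnC !modnMDl !modn_small.
by split=> //; subst r'; move/addnI: e => /eqP; rewrite eqn_pmul2l; [move/eqP|lia].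
Qed.

(** Cell 0 lies in no register: the head rests there between commands, and loop tests use it as
    scratch. *)
Lemma addr_neq0 r j : addr r j <> 0%Z.
Proof. by rewrite /addr /dir /off /stride /dz; case: eqP => h; lia. Qed.

(** With the bottom of the stack next to the origin, a push or pop changes one cell only. The blank
    cell 0 of the register is the sentinel at which [bck] stops. *)
Definition rep (s : store) (T : tape) : Prop := forall r, r < K ->
  T (addr r 0) = None /\
  forall j, T (addr r j.+1) = nth None (map Some (rev (s r))) j.

Fixpoint mvn (d : bool) (m : nat) : tprog :=
  if m is m'.+1 then TSeq (TMove d) (mvn d m') else TSkip.

Lemma run_mvn d m p T : trun (mvn d m) p T m (p + dz d * Z.of_nat m)%Z T.
Proof.
elim: m p => [|m IH] p.
  have -> : (p + dz d * Z.of_nat 0 = p)%Z by lia.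
  exact: RSkip.
apply: (@RSeq _ _ _ _ 1 (p + dz d)%Z T m); first by constructor.
by have -> : (p + dz d * Z.of_nat m.+1 = p + dz d + dz d * Z.of_nat m)%Z by lia.
Qed.

Lemma run_mvn' d m p T q : (q = p + dz d * Z.of_nat m)%Z ->
  trun (mvn d m) p T m q T.
Proof. by move=> ->; exact: run_mvn. Qed.

Definition isS (a : sym) : bool := a != None.
Definition fwd r := TSeq (mvn (dir r) (off r + stride r))
                         (TLoop TSkip isS (mvn (dir r) (stride r))).
Definition bck r := TSeq (TLoop TSkip isS (mvn (~~ dir r) (stride r)))
                         (mvn (~~ dir r) (off r)).

Lemma off_lt r : r < K -> off r <= K.
Proof. by rewrite /off; case: eqP; lia. Qed.
Lemma stride_le r : r < K -> stride r <= K.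
Proof. by rewrite /stride; case: eqP; lia. Qed.
Lemma dzN d : (dz (~~ d) = - dz d)%Z. Proof. by case: d. Qed.

Lemma addrS r j : (addr r j.+1 = addr r j + dz (dir r) * Z.of_nat (stride r))%Z.
Proof. rewrite /addr mulnS; move: (stride r * j) (stride r) (off r) => x y z; case: (dir r); rewrite /dz; lia. Qed.
Lemma addr0 r : (addr r 0 = dz (dir r) * Z.of_nat (off r))%Z.
Proof. by rewrite /addr muln0 addn0. Qed.

Lemma cell_lt (s : bits) j : j < size s -> nth None (map Some (rev s)) j != None.
Proof. by move=> h; rewrite (nth_map false) ?size_rev. Qed.
Lemma cell_ge (s : bits) j : size s <= j -> nth None (map Some (rev s)) j = None.
Proof. by move=> h; rewrite nth_default // size_map size_rev. Qed.

Lemma run_walk d m n p T :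
  (forall i, i < n -> isS (T (p + dz d * Z.of_nat (m * i))%Z)) ->
  ~~ isS (T (p + dz d * Z.of_nat (m * n))%Z) ->
  trun (TLoop TSkip isS (mvn d m)) p T (n * (m + 2)).+1
       (p + dz d * Z.of_nat (m * n))%Z T.
Proof.
elim: n p => [|n IH] p H1 H2.
  have e : (p + dz d * Z.of_nat (m * 0))%Z = p by lia.
  by rewrite e in H2 *; apply: RLoopF => //; constructor.
have e x : (p + dz d * Z.of_nat (m * x.+1) =
  p + dz d * Z.of_nat m + dz d * Z.of_nat (m * x))%Z.
  by rewrite mulnS; lia.
have -> : (n.+1 * (m + 2)).+1 = (0 + m + (n * (m + 2)).+1).+2 by lia.
apply: RLoopT.
- exact: RSkip.
- have := H1 0 isT; by have -> : (p + dz d * Z.of_nat (m * 0))%Z = p by lia.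
- exact: run_mvn.
- rewrite e; apply: IH => [i li|]; rewrite -e //.
  exact: H1.
Qed.

Lemma run_fwd s T r : r < K -> rep s T ->
  trun (fwd r) 0 T (off r + stride r + (size (s r) * (stride r + 2)).+1)
       (addr r (size (s r)).+1) T.
Proof.
move=> rK /(_ r rK) [_ H]; apply: RSeq; first exact: run_mvn.
have e i : (0 + dz (dir r) * Z.of_nat (off r + stride r) +
   dz (dir r) * Z.of_nat (stride r * i))%Z = addr r i.+1.
  by rewrite /addr mulnS; lia.
rewrite -e; apply: run_walk => [i li|]; rewrite e H.
  exact: cell_lt.
by rewrite cell_ge.
Qed.

Lemma run_bck T r j : 
  (forall i, i < j -> isS (T (addr r i.+1))) -> T (addr r 0) = None ->
  trun (bck r) (addr r j) T ((j * (stride r + 2)).+1 + off r) 0%Z T.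
Proof.
move=> H1 H2.
have e i : i <= j -> (addr r j + dz (~~ dir r) * Z.of_nat (stride r * i))%Z
    = addr r (j - i).
  move=> li; rewrite /addr dzN -{1}(subnK li) mulnDr; lia.
apply: (RSeq (p1 := addr r 0) (T1 := T)); last first.
  by apply: run_mvn'; rewrite addr0 dzN; lia.
have ej := e j (leqnn j); rewrite subnn in ej; rewrite -ej.
apply: run_walk => [i li|]; rewrite e ?(ltnW li) ?subnn ?H2 //.
have -> : j - i = (j - i).-1.+1 by lia.
by apply: H1; lia.
Qed.

Definition top r := TSeq (fwd r) (mvn (~~ dir r) (stride r)).

Lemma run_top s T r : r < K -> rep s T ->
  trun (top r) 0 T (off r + stride r + (size (s r) * (stride r + 2)).+1 + stride r)
       (addr r (size (s r))) T.
Proof.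
move=> rK H; apply: RSeq; first exact: run_fwd H.
by apply: run_mvn'; rewrite addrS dzN; lia.
Qed.

Lemma rep_top s T r : r < K -> rep s T -> T (addr r (size (s r))) = ohead (s r).
Proof.
move=> rK /(_ r rK) [H0 H].
case: (s r) H => [|b l] H //=; rewrite H /= rev_cons map_rcons nth_rcons.
by rewrite size_map size_rev ltnn eqxx.
Qed.

Lemma rep_nb s T r i : r < K -> rep s T -> i < size (s r) -> isS (T (addr r i.+1)).
Proof. by move=> rK /(_ r rK) [H0 H] li; rewrite H; exact: cell_lt. Qed.

Lemma rep_origin s T a : rep s T -> rep s (put T 0 a).
Proof.
have n0 r j : Z.eqb (addr r j) 0 = false.
  by case: Z.eqb_spec => // h; case: (addr_neq0 h).
by move=> H r rK; have [H0 H1] := H r rK; split=> [|j]; rewrite /put n0.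
Qed.

Lemma rep_upd s T r j a v : r < K -> rep s T ->
  (forall i, (if i == j then a else nth None (map Some (rev (s r))) i)
     = nth None (map Some (rev v)) i) ->
  rep (upd s r v) (put T (addr r j.+1) a).
Proof.
move=> rK H E q qK; have [H0 H1] := H q qK; split=> [|i]; rewrite /put.
  by case: Z.eqb_spec => // /addr_inj -/(_ qK rK) [].
rewrite /upd; case: eqP => [eqr|nqr].
  subst q; rewrite -E -H1; case: Z.eqb_spec => [/addr_inj|].
    by case/(_ qK rK) => _ [->]; rewrite eqxx.
  by case: eqP => // ->.
by case: Z.eqb_spec => // /addr_inj -/(_ qK rK) [].
Qed.

(** A loop test reads the scanned cell, but a loop has to be entered and left with the head at the
    origin; so nonemptiness of the register is first recorded in cell 0. *)
Definition mark r :=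
  TSeq (top r) (TIf isS (TSeq (bck r) (TWrite (Some true)))
                        (TSeq (bck r) (TWrite None))).

Fixpoint spcomp (c : sp) : tprog :=
  match c with
  | Skip => TSkip
  | Push r b => TSeq (fwd r) (TSeq (TWrite (Some b))
                  (TSeq (mvn (~~ dir r) (stride r)) (bck r)))
  | Pop r => TSeq (top r) (TSeq (TIf isS
                (TSeq (TWrite None) (mvn (~~ dir r) (stride r))) TSkip) (bck r))
  | Seq c1 c2 => TSeq (spcomp c1) (spcomp c2)
  | IfTop r b c1 c2 =>
      TSeq (top r) (TIf b (TSeq (bck r) (spcomp c1)) (TSeq (bck r) (spcomp c2)))
  | While r c => TLoop (mark r) isS (spcomp c)
  end.

Lemma run_bck_top s T r : r < K -> rep s T ->
  trun (bck r) (addr r (size (s r))) T ((size (s r) * (stride r + 2)).+1 + off r) 0%Z T.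
Proof.
move=> rK H; apply: run_bck; last by case: (H r rK).
by move=> i; exact: rep_nb H.
Qed.

Lemma run_mark s T r M : r < K -> rep s T -> size (s r) <= M ->
  exists2 t, t <= 7 * (K + 2) * M.+1 &
  trun (mark r) 0 T t 0%Z (put T 0 (if nilp (s r) then None else Some true)).
Proof.
move=> rK H sM; have ol := off_lt rK; have sl := stride_le rK.
have h1 : size (s r) * (stride r + 2) <= (K + 2) * M.
  by rewrite mulnC leq_mul // leq_add2r.
have : isS (T (addr r (size (s r)))) = ~~ nilp (s r).
  by rewrite (rep_top rK H); case: (s r).
have rt := run_top rK H; have rb := run_bck_top rK H.
case: (nilp (s r)) => b.
- eexists; last first.
    apply: RSeq; first exact: rt.
    apply: RIfF; first by rewrite b.
    apply: RSeq; [exact: rb|exact: RWrite].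
  lia.
- eexists; last first.
    apply: RSeq; first exact: rt.
    apply: RIfT; first by rewrite b.
    apply: RSeq; [exact: rb|exact: RWrite].
  lia.
Qed.

Lemma rep_push s T r b : r < K -> rep s T ->
  rep (upd s r (b :: s r)) (put T (addr r (size (s r)).+1) (Some b)).
Proof.
move=> rK H; apply: rep_upd => // i.
rewrite rev_cons map_rcons nth_rcons size_map size_rev.
by case: ltngtP => // li; rewrite nth_default // size_map size_rev ltnW.
Qed.

Lemma rep_pop s T r n : r < K -> rep s T -> size (s r) = n.+1 ->
  rep (upd s r (behead (s r))) (put T (addr r n.+1) None).
Proof.
move=> rK H sn; apply: rep_upd => // i.
case: (s r) sn => //= b l [<-]; rewrite rev_cons map_rcons nth_rcons size_map size_rev.
by case: ltngtP => // li; rewrite nth_default // size_map size_rev ?li // ltnW.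
Qed.

(** Registers never exceed [M + t] symbols, and one command walks a bounded number of times along
    one register with steps of at most [K] cells; this gives the factor [(K + 2) * (M + t).+1] per
    unit of time. *)
Theorem spcomp_correct c s t s' : exec c s t s' -> regs c <= K ->
  forall T M, rep s T -> (forall r, r < K -> size (s r) <= M) ->
  exists t' T', [/\ trun (spcomp c) 0 T t' 0 T', rep s' T' &
                    t' <= 9 * (K + 2) * t * (M + t).+1].
Proof.
have L r M (s0 : store) : r < K -> size (s0 r) <= M ->
    size (s0 r) * (stride r + 2) <= (K + 2) * M.
  by move=> rK sM; rewrite mulnC leq_mul // leq_add2r stride_le.
elim=> {c s t s'} /=.
- move=> s _ T M H _; exists 0, T; split => //; exact: RSkip.
- move=> r b s rK T M H sM; have := L _ _ s rK (sM r rK).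
  have ol := off_lt rK; have sl := stride_le rK => h.
  eexists; exists (put T (addr r (size (s r)).+1) (Some b)); split.
  + apply: RSeq; first exact: run_fwd H.
    apply: RSeq; first exact: RWrite.
    apply: RSeq.
      by apply: (@run_mvn' _ _ _ _ (addr r (size (s r)))); rewrite addrS dzN; lia.
    apply: run_bck.
      move=> i li; rewrite /put; case: Z.eqb_spec => // _; exact: rep_nb H _.
    have [H0 _] := H r rK.
    by rewrite /put; case: Z.eqb_spec => // /addr_inj -/(_ rK rK) [].
  + exact: rep_push.
  + lia.
- move=> r s rK T M H sM; have := L _ _ s rK (sM r rK).
  have ol := off_lt rK; have sl := stride_le rK => h.
  have : isS (T (addr r (size (s r)))) = ~~ nilp (s r).
    by rewrite (rep_top rK H); case: (s r).
  have rt := run_top rK H; have rb := run_bck_top rK H.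
  rewrite /nilp; case E: (size (s r)) => [|n] b.
  + eexists; exists T; split.
    * apply: RSeq; first exact: rt.
      apply: RSeq; last exact: rb.
      by rewrite E; apply: RIfF; [rewrite b|exact: RSkip].
    * have -> : upd s r (behead (s r)) = s => //.
      apply: functional_extensionality => q; rewrite /upd; case: eqP => // ->.
      by case: (s r) E.
    * lia.
  + eexists; exists (put T (addr r n.+1) None); split.
    * apply: RSeq; first exact: rt.
      apply: (RSeq (p1 := addr r n)).
        rewrite E; apply: RIfT; first by rewrite b.
        apply: RSeq; first exact: RWrite.
        by apply: run_mvn'; rewrite addrS dzN; lia.
      apply: run_bck.
        move=> i li; rewrite /put; case: Z.eqb_spec => [/addr_inj|_].
          by case/(_ rK rK); lia.
        by apply: rep_nb H _ => //; lia.
      have [H0 _] := H r rK.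
      by rewrite /put; case: Z.eqb_spec => // /addr_inj -/(_ rK rK) [].
    * exact: rep_pop.
    * lia.
- move=> c1 c2 s t1 s1 t2 s2 e1 I1 _ I2; rewrite geq_max => /andP[l1 l2] T M H sM.
  have [t1' [T1 [r1 H1 b1]]] := I1 l1 T M H sM.
  have sM1 r : r < K -> size (s1 r) <= M + t1.
    by move=> rK; have := exec_size r e1; have := sM r rK; lia.
  have [t2' [T2 [r2 H2 b2]]] := I2 l2 T1 (M + t1) H1 sM1.
  exists (t1' + t2'), T2; split=> //; first exact: RSeq r1 r2.
  rewrite mulnDr mulnDl leq_add //.
    by apply: leq_trans b1 _; rewrite leq_mul //; lia.
  by apply: leq_trans b2 _; rewrite leq_mul //; lia.
- move=> r b c1 c2 s t s1 e I; rewrite !geq_max => /and3P[rK l1 l2] T M H sM.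
  have lc : regs (if b (ohead (s r)) then c1 else c2) <= K by case: (b _).
  have [t' [T' [r' H' b']]] := I lc T M H sM.
  have := L _ _ s rK (sM r rK) => h; have ol := off_lt rK; have sl := stride_le rK.
  have rt := run_top rK H; have rb := run_bck_top rK H.
  have bnd : t' + 7 * (K + 2) * M.+1 <= 9 * (K + 2) * t.+1 * (M + t.+1).+1.
    apply: (@leq_trans (9 * (K + 2) * t * (M + t).+1 + 9 * (K + 2) * M.+1)).
      by rewrite leq_add //; nia.
    rewrite -!mulnA -!mulnDr !leq_mul2l; apply/orP; right; apply/orP; right; lia.
  have tp := rep_top rK H.
  case bb: (b (ohead (s r))) r' => r'.
  + eexists; exists T'; split; last 1 first.
    * instantiate (1 := off r + stride r + (size (s r) * (stride r + 2)).+1 +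
        stride r + (((size (s r) * (stride r + 2)).+1 + off r) + t').+2); lia.
    * apply: RSeq; first exact: rt.
      apply: RIfT; first by rewrite tp.
      by apply: RSeq; [exact: rb|exact: r'].
    * exact: H'.
  + eexists; exists T'; split; last 1 first.
    * instantiate (1 := off r + stride r + (size (s r) * (stride r + 2)).+1 +
        stride r + (((size (s r) * (stride r + 2)).+1 + off r) + t').+1); lia.
    * apply: RSeq; first exact: rt.
      apply: RIfF; first by rewrite tp bb.
      by apply: RSeq; [exact: rb|exact: r'].
    * exact: H'.
- move=> r c s s0; rewrite geq_max => /andP[rK lc] T M H sM.
  have [t1 b1 r1] := run_mark rK H (sM r rK).
  exists t1.+1, (put T 0 None); split.
  + by apply: RLoopF; [move: r1; rewrite s0 | rewrite /put Z.eqb_refl].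
  + exact: rep_origin.
  + lia.
- move=> r c s t1 s1 t2 s2 ne e1 I1 _ I2 lK T M H sM.
  move: (lK); rewrite geq_max => /andP[rK lc].
  have [t0 b0 r0] := run_mark rK H (sM r rK).
  have n0 : nilp (s r) = false by case: (s r) ne.
  rewrite n0 in r0.
  have [t1' [T1 [r1 H1 b1]]] := I1 lc _ M (@rep_origin _ _ (Some true) H) sM.
  have sM1 q : q < K -> size (s1 q) <= M + t1.
    by move=> qK; have := exec_size q e1; have := sM q qK; lia.
  have [t2' [T2 [r2 H2 b2]]] := I2 lK T1 (M + t1) H1 sM1.
  exists (t0 + t1' + t2').+2, T2; split=> //.
    by apply: (RLoopT r0) r1 r2; rewrite /put Z.eqb_refl.
  apply: (@leq_trans (9 * (K + 2) * M.+1 + 9 * (K + 2) * t1 * (M + t1).+1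
      + 9 * (K + 2) * t2 * (M + t1 + t2).+1)); first by lia.
  rewrite -!mulnA -!mulnDr !leq_mul2l; apply/orP; right; apply/orP; right.
  by nia.
Qed.
End Layout.

(** * Elementary register programs *)

(** Monotonicity is included because bounds are evaluated at upper estimates of sizes. *)
Definition poly (p : nat -> nat) : Prop :=
  {homo p : m n / m <= n} /\ exists a k, forall n, p n <= a * n.+1 ^ k.

Lemma poly_const a : poly (fun=> a).
Proof. by split=> //; exists a, 0 => n; rewrite muln1. Qed.

Lemma poly_id : poly (fun n => n).
Proof. by split=> //; exists 1, 1 => n; rewrite mul1n expn1. Qed.

Lemma poly_add p q : poly p -> poly q -> poly (fun n => p n + q n).
Proof.
move=> [hp [a [k P]]] [hq [b [l Q]]]; split=> [m n mn|].
  by rewrite leq_add ?hp ?hq.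
exists (a + b), (k + l) => n; rewrite mulnDl leq_add //.
  by apply: leq_trans (P n) _; rewrite leq_mul // leq_pexp2l //; lia.
by apply: leq_trans (Q n) _; rewrite leq_mul // leq_pexp2l //; lia.
Qed.

Lemma poly_mul p q : poly p -> poly q -> poly (fun n => p n * q n).
Proof.
move=> [hp [a [k P]]] [hq [b [l Q]]]; split=> [m n mn|].
  by rewrite leq_mul ?hp ?hq.
by exists (a * b), (k + l) => n; rewrite expnD mulnACA leq_mul.
Qed.

Lemma poly_comp p q : poly p -> poly q -> poly (fun n => p (q n)).
Proof.
move=> [hp [a [k P]]] [hq [b [l Q]]]; split=> [m n mn|].
  by rewrite hp ?hq.
exists (a * b.+1 ^ k), (l * k) => n.
apply: leq_trans (P _) _; rewrite -mulnA leq_mul // expnM -expnMn.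
have h : (q n).+1 <= b.+1 * n.+1 ^ l.
  have := Q n; have : 0 < n.+1 ^ l by rewrite expn_gt0.
  by rewrite mulSn; lia.
by case: k {P} => // k; rewrite leq_exp2r.
Qed.

Definition runs (c : sp) s t s' : Prop := exists2 t0, t0 <= t & exec c s t0 s'.

Lemma runs_le c s t t' s' : runs c s t s' -> t <= t' -> runs c s t' s'.
Proof. by move=> [u ut e] h; exists u => //; exact: leq_trans h. Qed.

Lemma runs_eq c s t t' s' s'' : runs c s t s' -> t <= t' -> s' = s'' ->
  runs c s t' s''.
Proof. by move=> h l <-; exact: runs_le h l. Qed.

Lemma runs_seq c1 c2 s t1 s1 t2 s2 :
  runs c1 s t1 s1 -> runs c2 s1 t2 s2 -> runs (Seq c1 c2) s (t1 + t2) s2.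
Proof.
by move=> [a al ea] [b bl eb]; exists (a + b); [exact: leq_add|exact: ESeq ea eb].
Qed.

Lemma runs_if r (b : sym -> bool) c1 c2 s t s1 :
  runs (if b (ohead (s r)) then c1 else c2) s t s1 ->
  runs (IfTop r b c1 c2) s t.+1 s1.
Proof. by move=> [a al ea]; exists a.+1 => //; exact: EIf. Qed.

Lemma runs_push r b s : runs (Push r b) s 1 (upd s r (b :: s r)).
Proof. by exists 1 => //; constructor. Qed.
Lemma runs_pop r s : runs (Pop r) s 1 (upd s r (behead (s r))).
Proof. by exists 1 => //; constructor. Qed.
Lemma runs_while0 r c s : s r = [::] -> runs (While r c) s 1 s.
Proof. by exists 1 => //; constructor. Qed.
Lemma runs_while r c s t1 s1 t2 s2 : s r <> [::] ->
  runs c s t1 s1 -> runs (While r c) s1 t2 s2 ->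
  runs (While r c) s (t1 + t2).+1 s2.
Proof.
by move=> n [a al ea] [b bl eb]; exists (a + b).+1; [lia|exact: EWhileS ea eb].
Qed.

Lemma updE s r v q : upd s r v q = if q == r then v else s q.
Proof. by []. Qed.

Lemma upd_id s r v : s r = v -> upd s r v = s.
Proof.
by move=> <-; apply: functional_extensionality => q; rewrite updE; case: eqP => [->|].
Qed.

(* Reduces an equality of stores to one case for each position of a register
   relative to the registers that are written. *)
Ltac stores :=
  apply: functional_extensionality => ?; rewrite ?updE;
  repeat (case: eqP => ? //=); try congruence; try (exfalso; lia).

Fixpoint pushw (q : nat) (w : bits) : sp :=
  if w is b :: w' then Seq (pushw q w') (Push q b) else Skip.

Lemma runs_pushw q w s : runs (pushw q w) s (size w).+1 (upd s q (w ++ s q)).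
Proof.
elim: w => [|b w IH] /=.
  by rewrite upd_id //; exists 1 => //; constructor.
rewrite -[_.+2]addn1; apply: runs_seq IH _.
have := runs_push q b (upd s q (w ++ s q)); rewrite updE eqxx.
suff -> : upd (upd s q (w ++ s q)) q (b :: w ++ s q) = upd s q (b :: w ++ s q) by [].
by stores.
Qed.

(** Popping one stack onto another reverses it, whence [rev] in the specification and the double
    transfer in [mv]. Filling two targets in one pass is what makes [copy] possible. *)
Definition drain2 a q (w : bool -> bits) r (v : bool -> bits) : sp :=
  let body b := Seq (Pop a) (Seq (pushw q (w b)) (pushw r (v b))) in
  While a (IfTop a (pred1 (Some true)) (body true) (body false)).

Lemma runs_drain2 a q w r v s k :
  a <> q -> a <> r -> q <> r -> (forall b, size (w b) + size (v b) <= k) ->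
  runs (drain2 a q w r v) s (size (s a) * (k + 5)).+1
    (upd (upd (upd s a [::]) q (flatten (map w (rev (s a))) ++ s q))
       r (flatten (map v (rev (s a))) ++ s r)).
Proof.
move=> aq ar qr hk; move E: (s a) => l; elim: l s E => [|b l IH] s E.
  rewrite /= (@upd_id s a) // (@upd_id s q) // (@upd_id s r) //.
  exact: runs_while0.
set s1 := upd (upd (upd s a l) q (w b ++ s q)) r (v b ++ s r).
have sa : s1 a = l by rewrite /s1 !updE eqxx; do 2 case: eqP => //.
have body : runs (Seq (Pop a) (Seq (pushw q (w b)) (pushw r (v b)))) s (k + 3) s1.
  apply: (@runs_le _ _ (1 + ((size (w b)).+1 + (size (v b)).+1))); last first.
    by have := hk b; lia.
  apply: runs_seq (runs_pop _ _) _.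
  apply: runs_seq; first exact: runs_pushw.
  suff -> : s1 = upd (upd (upd s a (behead (s a))) q
       (w b ++ upd s a (behead (s a)) q)) r
       (v b ++ (upd (upd s a (behead (s a))) q
           (w b ++ upd s a (behead (s a)) q)) r) by exact: runs_pushw.
  by rewrite /s1 E !updE; do ![case: eqP => //= ?; try congruence].
have step := IH s1 sa.
have ne : s a <> [::] by rewrite E.
have it := runs_if (r := a) (b := pred1 (Some true)) (c1 := Seq (Pop a) (Seq (pushw q (w true)) (pushw r (v true)))) (c2 := Seq (Pop a) (Seq (pushw q (w false)) (pushw r (v false)))) (s := s) (t := k + 3) (s1 := s1).
have := runs_while ne (it _) step.
rewrite E /= => H.
have {H} := H ltac:(by case: (b) body).
suff -> : upd (upd (upd s1 a [::]) q (flatten (map w (rev l)) ++ s1 q)) r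
    (flatten (map v (rev l)) ++ s1 r) =
  upd (upd (upd s a [::]) q (flatten (map w (rev (b :: l))) ++ s q)) r
    (flatten (map v (rev (b :: l))) ++ s r).
  by move=> H; apply: runs_le H _; lia.
rewrite rev_cons !map_rcons !flatten_rcons -!catA /s1 !updE !eqxx.
have -> : (q == r) = false by apply/eqP.
by stores.
Qed.

(** [(a + q).+1] is merely a register other than [a] and [q]; pushing empty words leaves it as it
    is. *)
Definition drain a q (w : bool -> bits) : sp := drain2 a q w (a + q).+1 (fun=> [::]).

Lemma runs_drain a q w s k : a <> q -> (forall b, size (w b) <= k) ->
  runs (drain a q w) s (size (s a) * (k + 5)).+1
    (upd (upd s a [::]) q (flatten (map w (rev (s a))) ++ s q)).
Proof.
move=> aq hk; have hk' b : size (w b) + size ([::] : bits) <= k by rewrite addn0.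
have := @runs_drain2 a q w (a + q).+1 (fun=> [::]) s k aq _ _ hk'.
rewrite [upd (upd (upd _ _ _) _ _) _ _]upd_id; first by apply; lia.
have -> : flatten [seq [::] | _ <- rev (s a)] = [::] :> bits.
  by elim: (rev _).
by rewrite !updE; do ![case: eqP => //= ?; try lia].
Qed.

Lemma flatten_seq1 (l : bits) : flatten [seq [:: b] | b <- l] = l.
Proof. by elim: l => //= b l ->. Qed.

Definition mvr a b := drain a b (fun x => [:: x]).

Lemma runs_mvr a b s : a <> b ->
  runs (mvr a b) s (size (s a) * 6).+1 (upd (upd s a [::]) b (rev (s a) ++ s b)).
Proof.
by move=> ab; have := @runs_drain a b (fun x => [:: x]) s 1 ab (fun=> isT); rewrite flatten_seq1.
Qed.

Definition mv a b t := Seq (mvr a t) (mvr t b).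

Lemma runs_mv a b t s : a <> b -> a <> t -> b <> t -> s t = [::] ->
  runs (mv a b t) s (size (s a) * 12 + 2) (upd (upd s a [::]) b (s a ++ s b)).
Proof.
move=> ab at' bt st; have r1 := runs_mvr s at'; rewrite st cats0 in r1.
have r2 := @runs_mvr t b (upd (upd s a [::]) t (rev (s a))) (fun e => bt (esym e)).
rewrite !updE eqxx size_rev revK in r2.
apply: (@runs_le _ _ (_ + _)); first apply: runs_seq r1 _.
  suff -> : upd (upd s a [::]) b (s a ++ s b) =
    upd (upd (upd (upd s a [::]) t (rev (s a))) t [::]) b
      (s a ++ (if b == t then rev (s a) else if b == a then [::] else s b))
    by exact: r2.
  by stores.
by lia.
Qed.

Definition clear a := drain a a.+1 (fun=> [::]).

Lemma runs_clear a s : runs (clear a) s (size (s a) * 5).+1 (upd s a [::]).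
Proof.
have := @runs_drain a a.+1 (fun=> [::]) s 0 _ (fun=> isT).
have -> : flatten [seq [::] | _ <- rev (s a)] = [::] :> bits by elim: (rev _).
by rewrite [X in runs _ _ _ X]upd_id ?updE; [apply; lia|case: eqP => //; lia].
Qed.

Definition copy a b t := Seq (mvr a t)
  (drain2 t a (fun x => [:: x]) b (fun x => [:: x])).

Lemma runs_copy a b t s : a <> b -> a <> t -> b <> t -> s t = [::] ->
  runs (copy a b t) s (size (s a) * 13 + 2) (upd s b (s a ++ s b)).
Proof.
move=> ab at' bt st; have r1 := runs_mvr s at'; rewrite st cats0 in r1.
have r2 := @runs_drain2 t a (fun x => [:: x]) b (fun x => [:: x])
  (upd (upd s a [::]) t (rev (s a))) 2 (fun e => at' (esym e)) (fun e => bt (esym e)) ab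
  (fun=> isT).
rewrite !flatten_seq1 !updE !eqxx size_rev revK in r2.
apply: runs_eq (runs_seq r1 r2) _ _; first lia.
have {}at' : (a == t) = false by apply/eqP.
have {}bt' : (b == t) = false by apply/eqP.
have ba : (b == a) = false by apply/eqP => e; rewrite e in ab.
rewrite ?at' ?bt' ?ba ?eqxx ?cats0.
by stores; congruence.
Qed.

(** * Functions computable in polynomial time *)

(** [bits] and [seq bool] are the same type; the wrapper separates a string stored verbatim from a
    list of bits coded item by item. *)
Inductive raw := Raw of bits.
Definition unraw (x : raw) : bits := let: Raw s := x in s.

Class enc (T : Type) := Enc { code : T -> bits }.

(** The framing of [enc_nat] and [enc_pair]: a list of strings [Raw (bin m)] then has exactly the
    code [enc_nats], so outputs need no final translation. *)
Definition item (x : bits) : bits := dbl x ++ [:: false; true].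

#[export] Instance enc_unit : enc unit := Enc (fun=> [::]).
#[export] Instance enc_raw : enc raw := Enc unraw.
#[export] Instance enc_bool : enc bool := Enc (fun b => [:: b]).
#[export] Instance enc_seq T (e : enc T) : enc (seq T) :=
  Enc (fun s => flatten [seq item (code x) | x <- s]).
(* A natural number is coded as a list of that many empty items, so that
   loops over a number are loops over a list. *)
#[export] Instance enc_natural : enc nat := Enc (fun n => flatten (nseq n (item [::]))).

(** Contexts are nested products, and a variable is addressed by its distance from the last
    component, as with de Bruijn indices. *)
Class ctx (G : Type) := Ctx { env : G -> seq bits; arity : nat;
                              size_env : forall c, size (env c) = arity }.

#[export] Instance ctx_unit : ctx unit := @Ctx unit (fun=> [::]) 0 (fun=> erefl).
#[export] Program Instance ctx_prod G A (g : ctx G) (a : enc A) : ctx (G * A) :=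
  @Ctx (G * A) (fun c => code c.2 :: env c.1) (@arity G g).+1 _.
Next Obligation. by rewrite size_env. Qed.

Definition sz {G} {g : ctx G} (c : G) : nat := sumn (map size (env c)).

Definition clean (s : store) d := forall r, d <= r -> s r = [::].

(* A program for [f] is parameterized by the registers [loc] that hold the
   context and by a register [d] above them; all registers from [d] on are empty
   before the run, and afterwards only [d], which holds the result, is not.
   Results of subexpressions are thus stacked in consecutive registers. *)
Definition computes {G} {g : ctx G} {U} {u : enc U}
    (prog : seq nat -> nat -> sp) (p : nat -> nat) (f : G -> U) : Prop :=
  forall loc d s c, all (fun r => r < d) loc -> map s loc = env c -> clean s d ->
    runs (prog loc d) s (p (sz c)) (upd s d (code (f c))).

Definition PT {G} {g : ctx G} {U} {u : enc U} (f : G -> U) : Prop :=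
  exists prog p, poly p /\ computes prog p f.

Section Basics.
Context {G : Type} {g : ctx G}.

Lemma pt_ext U (u : enc U) (f h : G -> U) : PT f -> f =1 h -> PT h.
Proof.
by move=> [P [p [pp H]]] e; exists P, p; split=> // loc d s c *; rewrite -e; exact: H.
Qed.

Lemma upd_loc (s : store) d v loc : all (fun r => r < d) loc ->
  map (upd s d v) loc = map s loc.
Proof.
move=> /allP h; apply/eq_in_map => r /h; rewrite updE.
by case: eqP => [->|]; rewrite ?ltnn.
Qed.

Lemma all_locS loc d : all (fun r => r < d) loc -> all (fun r => r < d.+1) loc.
Proof. by apply: sub_all => r /ltnW. Qed.

Lemma clean_upd s d v : clean s d -> clean (upd s d v) d.+1.
Proof. by move=> h r lr; rewrite updE; case: eqP => [e|_]; [lia|apply: h; lia]. Qed.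

(** The result register is empty at the start and gains at most one symbol per unit of time. *)
Lemma pt_bound U (u : enc U) (f : G -> U) : PT f ->
  exists2 p, poly p & forall c, size (code (f c)) <= p (sz c).
Proof.
move=> [P [p [pp H]]]; exists p => // c.
pose s : store := fun r => nth [::] (@env G g c) r.
have [|||t tl e] := H (iota 0 (@arity G g)) (@arity G g) s c _ _ _.
- by apply/allP => r; rewrite mem_iota.
- by rewrite -(size_env c) /s map_nth_iota0 ?take_size.
- by move=> r lr; rewrite /s nth_default // size_env.
have := exec_size (@arity G g) e; rewrite updE eqxx /s nth_default ?size_env //= => h.
exact: leq_trans h tl.
Qed.

Lemma pt_const U (u : enc U) (a : U) : PT (fun _ : G => a).
Proof.
exists (fun _ d => pushw d (code a)), (fun=> (size (code a)).+1).
split=> [|loc d s c _ _ cl]; first exact: poly_const.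
by have := runs_pushw d (@code U u a) s; rewrite (cl d) // cats0.
Qed.

Lemma pt_var A (a : enc A) : PT (fun c : G * A => c.2).
Proof.
exists (fun loc d => copy (head 0 loc) d d.+1), (fun n => n * 13 + 2).
split=> [|[|r loc] d s c] //=.
  by apply: poly_add (poly_const _); apply: poly_mul (poly_const _); exact: poly_id.
move=> /andP[rd _] [e _] cl.
have := @runs_copy r d d.+1 s _ _ _ (cl d.+1 _); rewrite (cl d) // cats0 e.
move=> H; apply: runs_le (H _ _ _ _) _; try lia.
by rewrite /sz /=; lia.
Qed.

Lemma pt_weak A (a : enc A) U (u : enc U) (f : G -> U) :
  PT f -> PT (fun c : G * A => f c.1).
Proof.
move=> [P [p [pp H]]]; exists (fun loc => P (behead loc)), p; split=> //.
move=> [|r loc] d s c //= /andP[_ al] [_ e] cl.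
apply: runs_le (H _ _ _ _ al e cl) _.
by case: pp => mp _; apply: mp; rewrite /sz /= leq_addl.
Qed.

End Basics.
Arguments pt_weak {G g A a U u f}.
Arguments pt_var {G g A a}.

Ltac polys := repeat first
  [ assumption | exact: poly_const | exact: poly_id
  | apply: poly_add | apply: poly_mul
  | match goal with |- poly (fun n => ?r (@?q n)) =>
      is_var r; apply: (@poly_comp r q) end
  | match goal with |- poly ?r => is_var r; assumption end ].

(* Splits off the first item; a malformed input is cut at the first pair that
   is not a doubled bit. *)
Fixpoint tok (s : bits) : bits * bits :=
  match s with
  | b1 :: b2 :: s' =>
      if b1 == b2 then (b1 :: (tok s').1, (tok s').2) else ([::], s')
  | _ => ([::], [::])
  end.

Fixpoint toks_rec (n : nat) (s : bits) : seq bits :=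
  match n, s with
  | n'.+1, _ :: _ => (tok s).1 :: toks_rec n' (tok s).2
  | _, _ => [::]
  end.
Definition toks (s : bits) : seq bits := toks_rec (size s) s.

Lemma bits_ind2 (P : bits -> Prop) :
  P [::] -> (forall b, P [:: b]) -> (forall b b' s, P s -> P [:: b, b' & s]) ->
  forall s, P s.
Proof.
move=> P0 P1 P2 s; suff: P s /\ forall b, P (b :: s) by case.
by elim: s => [|a s [IH1 IH2]]; split=> // b; apply: P2.
Qed.

Lemma tok_size s : size (tok s).1 + size (tok s).2 <= (size s).-1.
Proof.
elim/bits_ind2: s => //= b b' s; case: eqP => /= _; lia.
Qed.

Lemma toks_cons b s : toks (b :: s) = (tok (b :: s)).1 :: toks (tok (b :: s)).2.
Proof.
rewrite /toks [size (_ :: _)]/=.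
have E m n (w : bits) : size w <= m -> size w <= n -> toks_rec m w = toks_rec n w.
  elim: m n w => [|m IH] [|n] [|x w] // h1 h2.
  rewrite /= -/(tok (x :: w)); congr cons.
  have := tok_size (x :: w); rewrite /= -/(tok (x :: w)) /= in h1 h2 * => h.
  by apply: IH; lia.
rewrite -[in LHS]/(_ :: _); congr cons; apply: E => //.
by have := tok_size (b :: s); move: (tok _) => x; rewrite /=; lia.
Qed.

Lemma tok_item x s : tok (item x ++ s) = (x, s).
Proof. by rewrite /item -catA; elim: x => //= b x IH; rewrite eqxx IH. Qed.

Lemma toks_item x s : toks (item x ++ s) = x :: toks s.
Proof.
have : item x ++ s = head false (item x) :: (behead (item x) ++ s).
  by case: x.
by move=> E; rewrite {1}E toks_cons -E tok_item.
Qed.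

Lemma toks_items l : toks (flatten (map item l)) = l.
Proof. by elim: l => //= x l IH; rewrite toks_item IH. Qed.

(** [f] is the loop flag, emptied when the token ends, and [t] collects the token in reverse. Only
    the top symbol can be inspected, so the first bit of a pair is remembered by the branch
    taken. *)
Definition tok_body a f t : sp :=
  IfTop a (pred1 None) (Pop f)
   (IfTop a (pred1 (Some true))
     (Seq (Pop a) (IfTop a (pred1 (Some true)) (Seq (Pop a) (Push t true))
                                               (Seq (Pop a) (Pop f))))
     (Seq (Pop a) (IfTop a (pred1 (Some false)) (Seq (Pop a) (Push t false))
                                                (Seq (Pop a) (Pop f))))).

Definition tokp a q f t : sp :=
  Seq (Push f true) (Seq (While f (tok_body a f t)) (mvr t q)).

Lemma runs_tok_loop a f t s : a <> f -> a <> t -> f <> t -> s f = [:: true] ->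
  runs (While f (tok_body a f t)) s (size (s a) * 10 + 10)
    (upd (upd (upd s f [::]) a (tok (s a)).2) t (rev (tok (s a)).1 ++ s t)).
Proof.
move=> af at' ft; move E: (s a) => l.
have fa : (f == a) = false by apply/eqP => e; apply: af.
have ta : (t == a) = false by apply/eqP => e; apply: at'.
have tf : (t == f) = false by apply/eqP => e; apply: ft.
have at0 : (a == t) = false by rewrite eq_sym.
have ft0 : (f == t) = false by rewrite eq_sym.
have af0 : (a == f) = false by rewrite eq_sym.
elim/bits_ind2: l s E => [|b|b b' l IH] s sa sf.
- have n : s f <> [::] by rewrite sf.
  apply: runs_eq (runs_while n _ (runs_while0 _ _)) _ _.
  + apply: runs_if; rewrite sa /=; exact: runs_pop.
  + by rewrite updE eqxx sf.
  + by [].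
  + by rewrite sf /=; stores.
- have n : s f <> [::] by rewrite sf.
  apply: runs_eq (runs_while n _ (runs_while0 _ _)) _ _.
  + apply: runs_if; rewrite sa /=; apply: runs_if; rewrite sa.
    have -> : (if pred1 (Some true) (ohead [:: b]) then
      Seq (Pop a) (IfTop a (pred1 (Some true)) (Seq (Pop a) (Push t true))
                                               (Seq (Pop a) (Pop f))) else
      Seq (Pop a) (IfTop a (pred1 (Some false)) (Seq (Pop a) (Push t false))
                                                (Seq (Pop a) (Pop f)))) =
      Seq (Pop a) (IfTop a (pred1 (Some b)) (Seq (Pop a) (Push t b))
                                               (Seq (Pop a) (Pop f))).
      by case: (b).
    apply: runs_seq; first exact: runs_pop.
    apply: runs_if; rewrite updE eqxx sa /=.
    apply: runs_seq; exact: runs_pop.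
  + by rewrite !updE eqxx fa sf.
  + by [].
  + by rewrite !updE !eqxx fa sf /=; stores.
- have n : s f <> [::] by rewrite sf.
  have B t1 s1 : runs (IfTop a (pred1 (Some b)) (Seq (Pop a) (Push t b))
      (Seq (Pop a) (Pop f))) (upd s a (b' :: l)) t1 s1 ->
      runs (tok_body a f t) s (1 + t1).+2 s1.
    move=> h; apply: runs_if; rewrite sa /=; apply: runs_if; rewrite sa.
    have := runs_seq (runs_pop a s); rewrite sa /= => /(_ _ _ _ h).
    by case: (b).
  rewrite /=; case: eqP => [eb|nb] /=.
  + have b1 : runs (tok_body a f t) s 6 (upd (upd s a l) t (b :: s t)).
      apply: (B 3); apply: runs_if; rewrite updE eqxx /= eb eqxx.
      apply: runs_eq (runs_seq (runs_pop _ _) (runs_push _ _ _)) _ _ => //.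
      by rewrite !updE !eqxx ta /=; stores.
    apply: runs_eq (runs_while n b1 (IH _ _ _)) _ _.
    * by rewrite !updE at0 eqxx.
    * by rewrite !updE ft0 fa.
    * lia.
    * by rewrite !updE eqxx rev_cons cat_rcons; stores.
  + have b1 : runs (tok_body a f t) s 6 (upd (upd s a l) f [::]).
      apply: (B 3); apply: runs_if; rewrite updE eqxx /=.
      have -> : (Some b' == Some b) = false.
        by apply/eqP => -[e]; apply: nb.
      apply: runs_eq (runs_seq (runs_pop _ _) (runs_pop _ _)) _ _ => //.
      by rewrite !updE !eqxx fa sf /=; stores.
    apply: runs_eq (runs_while n b1 (runs_while0 _ _)) _ _.
    * by rewrite updE eqxx.
    * lia.
    * by stores.
Qed.

Lemma runs_tokp a q f t s : uniq [:: a; q; f; t] ->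
  s f = [::] -> s t = [::] -> s q = [::] ->
  runs (tokp a q f t) s (size (s a) * 16 + 20)
    (upd (upd s a (tok (s a)).2) q (tok (s a)).1).
Proof.
rewrite /= !inE !negb_or => /and4P[/and3P[/eqP aq /eqP af /eqP at'] /andP[/eqP qf /eqP qt] /eqP ft _] sf st sq.
have r1 := runs_push f true s.
have fa : (f == a) = false by apply/eqP => e; apply: af.
have tf : (t == f) = false by apply/eqP => e; apply: ft.
have ta : (t == a) = false by apply/eqP => e; apply: at'.
have r2 := @runs_tok_loop a f t (upd s f (true :: s f)) af at' ft.
rewrite !updE eqxx sf tf st cats0 [a == f]eq_sym fa in r2.
have r3 := @runs_mvr t q (upd (upd (upd (upd s f [:: true]) f [::]) a (tok (s a)).2) t
         (rev (tok (s a)).1)).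
rewrite !updE eqxx size_rev revK in r3.
rewrite sf in r1.
apply: runs_eq (runs_seq r1 (runs_seq (r2 _) (r3 _))) _ _ => //.
- exact: nesym.
- by have := tok_size (s a); lia.
- have -> : (q == t) = false by apply/eqP.
  have -> : (q == a) = false by apply/eqP; exact: nesym.
  have -> : (q == f) = false by apply/eqP.
  by rewrite sq cats0; stores.
Qed.

(** * Loops over lists *)

Section Fold.
Context {G : Type} {g : ctx G}.

(** [d] holds the unread part of the list, [d.+1] the accumulator, [d.+2] the current item and
    [d.+3] the new accumulator, which finally replaces the old one. *)
Definition fold_step (Ph : seq nat -> nat -> sp) loc d : sp :=
  Seq (tokp d d.+2 d.+3 d.+4)
   (Seq (Ph (d.+2 :: d.+1 :: loc) d.+3)
     (Seq (clear d.+2) (Seq (clear d.+1) (mv d.+3 d.+1 d.+4)))).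

Definition foldp (Ps Pi Ph : seq nat -> nat -> sp) loc d : sp :=
  Seq (Ps loc d) (Seq (Pi loc d.+1)
    (Seq (While d (fold_step Ph loc d)) (mv d.+1 d d.+2))).

Lemma clean_upd2 s d e v : clean s d -> e < d -> clean (upd s e v) d.
Proof. by move=> h l r lr; rewrite updE; case: eqP => [?|_]; [lia|apply: h]. Qed.

(** A bound [B] on all partial results has to be assumed: a polynomial-time body that doubles its
    accumulator would make it exponentially long. [S] bounds the unread part of the list. *)
Lemma runs_fold A (a : enc A) U (u : enc U) (h : G * U * A -> U) Ph ph loc d c B S :
  poly ph -> computes Ph ph h ->
  all (fun r => r < d) loc ->
  forall l w x s, size w <= S -> toks w = map code l ->
  (forall i, size (code (foldl (fun y z => h (c, y, z)) x (take i l))) <= B) ->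
  map s loc = env c -> s d = w -> s d.+1 = code x -> clean s d.+2 ->
  runs (While d (fold_step Ph loc d)) s
    (size w * (40 + 21 * S + 17 * B + ph (sz c + B + S)) + 1)
    (upd (upd s d [::]) d.+1 (code (foldl (fun y z => h (c, y, z)) x l))).
Proof.
move=> [mph _] H al; elim=> [|z l IH] w x s wS tw Bd ml sd sd1 cl.
  case: w wS tw sd => [|b w] wS tw sd; last by rewrite toks_cons in tw.
  by rewrite (upd_id sd) (@upd_id s) //; apply: runs_while0.
case: w wS tw sd => [|b w] // wS; rewrite toks_cons => -[tz tl] sd.
have ne : s d <> [::] by rewrite sd.
have ts := tok_size (b :: w).
set w0 := b :: w in wS tz tl sd ts *.
have ws : size w0 = (size w).+1 by [].
have uq : uniq [:: d; d.+2; d.+3; d.+4].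
  by rewrite /= !inE; apply/and4P; split=> //; lia.
have cs r : d.+2 <= r -> s r = [::] by exact: cl.
have r1 := runs_tokp uq (cs d.+3 ltac:(lia)) (cs d.+4 ltac:(lia)) (cs d.+2 ltac:(lia)).
rewrite sd tz in r1; set s1 := upd _ _ _ in r1.
have B0 := Bd 0; rewrite take0 /= in B0.
have B1 := Bd 1; rewrite /= take0 /= in B1.
have zS : size (code z) <= S.
  rewrite -tz; apply: leq_trans wS; apply: leq_trans (leq_pred _).
  by apply: leq_trans ts; exact: leq_addr.
have m1 : map s1 loc = env c.
  rewrite -ml; apply/eq_in_map => r /(allP al) lr.
  by rewrite /s1 !updE; do 2 (case: eqP => [?|_]; first lia).
have e2 : s1 d.+2 = code z by rewrite /s1 !updE eqxx.
have e1 : s1 d.+1 = code x.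
  by rewrite /s1 !updE; do 2 (case: eqP => [?|_]; first lia).
have e0 : s1 d = (tok w0).2.
  by rewrite /s1 !updE; case: eqP => [?|_]; [lia|rewrite eqxx].
have c3 : clean s1 d.+3.
  by apply: clean_upd; apply: clean_upd2 => //.
have r2 : runs (Ph (d.+2 :: d.+1 :: loc) d.+3) s1 (ph (sz c + B + S))
   (upd s1 d.+3 (code (h (c, x, z)))).
  apply: runs_le (H _ _ _ (c, x, z) _ _ c3) _.
  - by rewrite /=; apply/and3P; split; [lia|lia|apply: sub_all al => r; lia].
  - by rewrite /= e2 e1 m1.
  - by apply: mph; rewrite /sz /=; lia.
set s2 := upd s1 _ _ in r2.
have r3 := runs_clear d.+2 s2; set s3 := upd s2 _ _ in r3.
have r4 := runs_clear d.+1 s3; set s4 := upd s3 _ _ in r4.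
have r5 := @runs_mv d.+3 d.+1 d.+4 s4 ltac:(lia) ltac:(lia) ltac:(lia).
have cl4 : s4 d.+4 = [::].
  rewrite /s4 /s3 /s2 !updE; do 3 (case: eqP => [?|_]; first lia).
  by apply: c3; lia.
have s32 : s2 d.+2 = code z by rewrite /s2 updE; case: eqP => [?|_]; first lia.
have s31 : s3 d.+1 = code x.
  by rewrite /s3 /s2 !updE; do 2 (case: eqP => [?|_]; first lia).
have s43 : s4 d.+3 = code (h (c, x, z)).
  rewrite /s4 /s3 /s2 !updE; do 2 (case: eqP => [?|_]; first lia).
  by rewrite eqxx.
have s41 : s4 d.+1 = [::] by rewrite /s4 updE eqxx.
rewrite s43 s41 cats0 in r5; rewrite s32 in r3; rewrite s31 in r4.
set s5 := upd _ _ _ in r5.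
have q5 r : s5 r = if r == d.+1 then code (h (c, x, z)) else
    if r == d then (tok w0).2 else s r.
  rewrite /s5 /s4 /s3 /s2 /s1 !updE.
  do ![case: eqP => ? //=]; try (exfalso; lia); subst;
    by rewrite cs //; lia.
have rb := runs_seq r1 (runs_seq r2 (runs_seq r3 (runs_seq r4 (r5 cl4)))).
have w2 : (size (tok w0).2).+1 <= size w0.
  by rewrite ws ltnS; apply: leq_trans ts; exact: leq_addl.
have step := IH (tok w0).2 (h (c, x, z)) s5 (leq_trans (ltnW w2) wS) tl.
apply: runs_eq (runs_while ne rb (step _ _ _ _ _)) _ _.
- by move=> i; exact: Bd i.+1.
- rewrite -ml; apply/eq_in_map => r /(allP al) lr.
  by rewrite q5; do 2 (case: eqP => [?|_]; first lia).
- by rewrite q5 eqxx; case: eqP => [?|_]; first lia.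
- by rewrite q5 eqxx.
- move=> r lr; rewrite q5; do 2 (case: eqP => [?|_]; first lia).
  exact: cs.
- set X := 40 + _ + _ + _; have : size (tok w0).2 * X + X <= size w0 * X.
    by rewrite -mulSnr leq_mul2r w2 orbT.
  have s42 : size (code z) * 5 <= S * 5 by rewrite leq_mul2r zS orbT.
  have s43' : size (code x) * 5 <= B * 5 by rewrite leq_mul2r B0 orbT.
  have s44 : size (code (h (c, x, z))) * 12 <= B * 12 by rewrite leq_mul2r B1 orbT.
  have : size w0 * 16 <= S * 16 by rewrite leq_mul2r wS orbT.
  by rewrite /X; lia.
- apply: functional_extensionality => r; rewrite !updE q5.
  by do ![case: eqP => ? //=].
Qed.

(* [l c] is the list of items that the loop reads off the code of [s c]. *)
Lemma pt_foldl_gen V (v : enc V) A (a : enc A) U (u : enc U)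
    (s : G -> V) (l : G -> seq A) (x : G -> U) (h : G * U * A -> U) :
  (forall c, toks (code (s c)) = map code (l c)) ->
  PT s -> PT x -> PT h ->
  (exists2 B, poly B & forall c i,
     size (code (foldl (fun y z => h (c, y, z)) (x c) (take i (l c)))) <= B (sz c)) ->
  PT (fun c => foldl (fun y z => h (c, y, z)) (x c) (l c)).
Proof.
move=> tk Hs [Pi [pi [ppi Hi]]] [Ph [ph [pph Hh]]] [B pB Bd].
have [S pS bS] := pt_bound Hs; move: Hs => [Ps [ps [pps Hs]]].
exists (foldp Ps Pi Ph), (fun n => ps n + (pi n +
   ((S n * (40 + 21 * S n + 17 * B n + ph (n + B n + S n)) + 1) + (B n * 12 + 2)))).
split; first by polys.
move=> loc d st c al e cl.
have r1 := Hs _ _ _ _ al e cl; set s1 := upd _ _ _ in r1.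
have c1 : clean s1 d.+1 by exact: clean_upd.
have r2 := Hi loc d.+1 s1 c (all_locS al) _ c1.
rewrite /s1 upd_loc // in r2; have {}r2 := r2 e; rewrite -/s1 in r2.
set s2 := upd s1 _ _ in r2.
have c2 : clean s2 d.+2 by exact: clean_upd.
have r3 := @runs_fold _ _ _ _ h Ph ph loc d c (B (sz c)) (S (sz c)) pph Hh al
  (l c) (code (s c)) (x c) s2 (bS c) (tk c) (Bd c).
have {}r3 := r3 _ _ _ c2.
have m2 : map s2 loc = env c by rewrite /s2 /s1 !upd_loc // all_locS.
have d2 : s2 d = code (s c).
  by rewrite /s2 /s1 !updE eqxx; case: eqP => [?|_]; first lia.
have d21 : s2 d.+1 = code (x c) by rewrite /s2 updE eqxx.
have {}r3 := r3 m2 d2 d21; set s3 := upd _ _ _ in r3.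
have r4 := @runs_mv d.+1 d d.+2 s3 ltac:(lia) ltac:(lia) ltac:(lia).
have q3 r : s3 r = if r == d.+1 then code (foldl (fun y z => h (c, y, z)) (x c) (l c))
   else st r.
  rewrite /s3 /s2 /s1 !updE; do ![case: eqP => ? //=]; subst.
  by rewrite cl.
have t3 : s3 d.+2 = [::] by rewrite q3; case: eqP => [?|_]; [lia|apply: cl; lia].
apply: runs_eq (runs_seq r1 (runs_seq r2 (runs_seq r3 (r4 t3)))) _ _.
- do 2 (rewrite leq_add2l); apply: leq_add.
    by rewrite leq_add2r leq_mul2r bS orbT.
  rewrite leq_add2r leq_mul2r; apply/orP; right.
  by have := Bd c (size (l c)); rewrite take_size q3 eqxx.
- apply: functional_extensionality => r; rewrite !updE !q3 eqxx.
  do ![case: eqP => ? //=]; try (exfalso; lia); subst; by rewrite cl ?cats0.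
Qed.

End Fold.

Ltac reg := rewrite ?updE; repeat (case: eqP => ? //=); try (exfalso; lia).

(** * Primitive operations on encoded data *)

Section Ops.
Context {G : Type} {g : ctx G}.

Lemma pt_post A (a : enc A) U (u : enc U) (F : A -> U) (f : G -> A) Q q :
  poly q ->
  (forall d s x, clean s d.+1 -> s d = code x ->
     runs (Q d) s (q (size (code x))) (upd s d (code (F x)))) ->
  PT f -> PT (fun c => F (f c)).
Proof.
move=> pq HQ Hf; have [b pb bb] := pt_bound Hf; move: Hf => [P [p [pp H]]].
exists (fun loc d => Seq (P loc d) (Q d)), (fun n => p n + q (b n)).
split; first by polys.
move=> loc d s c al e cl; have r1 := H _ _ _ _ al e cl.
have e0 : upd s d (code (f c)) d = code (f c) by rewrite updE eqxx.
have r2 := HQ d _ (f c) (clean_upd _ cl) e0.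
apply: runs_eq (runs_seq r1 r2) _ _; last by stores.
by rewrite leq_add2l; case: pq => mq _; apply: mq.
Qed.

Lemma pt_cat_gen A (a : enc A) B (b : enc B) U (u : enc U) (F : A -> B -> U)
    (x : G -> A) (y : G -> B) :
  (forall x y, code (F x y) = code x ++ code y) ->
  PT x -> PT y -> PT (fun c => F (x c) (y c)).
Proof.
move=> E Hx; have [b1 pb1 bb1] := pt_bound Hx; move: Hx => [P [p [pp HP]]].
move=> [Q [q [pq HQ]]].
exists (fun loc d => Seq (Q loc d) (Seq (P loc d.+1) (mv d.+1 d d.+2))).
exists (fun n => q n + (p n + (b1 n * 12 + 2))); split; first by polys.
move=> loc d s c al e cl.
have r1 := HQ _ _ _ _ al e cl; set s1 := upd _ _ _ in r1.
have c1 : clean s1 d.+1 by exact: clean_upd.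
have r2 := HP loc d.+1 s1 c (all_locS al) _ c1.
rewrite /s1 upd_loc // in r2; have {}r2 := r2 e; rewrite -/s1 in r2.
set s2 := upd s1 _ _ in r2.
have r3 := @runs_mv d.+1 d d.+2 s2 ltac:(lia) ltac:(lia) ltac:(lia).
have t2 : s2 d.+2 = [::] by apply: (clean_upd (d := d.+1)).
have e21 : s2 d.+1 = code (x c) by rewrite /s2 updE eqxx.
have e2 : s2 d = code (y c).
  by rewrite /s2 /s1 !updE eqxx; case: eqP => [?|_]; first lia.
rewrite e21 e2 -E in r3.
apply: runs_eq (runs_seq r1 (runs_seq r2 (r3 t2))) _ _.
- by do 2 rewrite leq_add2l; rewrite leq_add2r leq_mul2r bb1 orbT.
- rewrite /s2 /s1; apply: functional_extensionality => r; rewrite !updE.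
  by do ![case: eqP => ? //=]; try (exfalso; lia); subst; rewrite cl.
Qed.

Lemma pt_if U (u : enc U) (b : G -> bool) (f h : G -> U) :
  PT b -> PT f -> PT h -> PT (fun c => if b c then f c else h c).
Proof.
move=> [P [p [pp HP]]] [Q [q [pq HQ]]] [R [r [pr HR]]].
exists (fun loc d => Seq (P loc d) (IfTop d (pred1 (Some true))
   (Seq (Pop d) (Q loc d)) (Seq (Pop d) (R loc d)))).
exists (fun n => p n + (2 + q n + r n)); split; first by polys.
move=> loc d s c al e cl.
have r1 := HP _ _ _ _ al e cl.
apply: runs_seq r1 _.
have eq1 : upd (upd s d (code (b c))) d (behead (upd s d (code (b c)) d)) = s.
  by rewrite updE eqxx /=; apply: functional_extensionality => k;
    rewrite !updE; case: eqP => // ->; rewrite cl.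
have pop := runs_pop d (upd s d (@code bool enc_bool (b c))); rewrite eq1 in pop.
have e1 := HQ _ _ _ _ al e cl; have e2 := HR _ _ _ _ al e cl.
have -> : 2 + q (sz c) + r (sz c) = (1 + q (sz c) + r (sz c)).+1 by lia.
apply: runs_if; rewrite updE eqxx /=; case: (b c) pop => pop /=.
- by apply: runs_le (runs_seq pop e1) _; lia.
- by apply: runs_le (runs_seq pop e2) _; lia.
Qed.

Lemma pt_isnil A (a : enc A) (N : A -> bool) (f : G -> A) :
  (forall x, N x = nilp (code x)) -> PT f -> PT (fun c => N (f c)).
Proof.
move=> E; apply: (@pt_post _ _ _ _ N f (fun d => IfTop d (pred1 None) (Push d true)
   (Seq (clear d) (Push d false))) (fun n => n * 5 + 4)); first by polys.
move=> d s x cl sd; rewrite /= E.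
have -> : size (code x) * 5 + 4 = (size (code x) * 5 + 3).+1 by lia.
apply: runs_if; rewrite sd; case X: (code x) => [|b l] /=.
  have := runs_push d true s; rewrite sd X => h; exact: runs_le h _.
have r1 := runs_clear d s; have r2 := runs_push d false (upd s d [::]).
apply: runs_eq (runs_seq r1 r2) _ _; first by rewrite sd X /=; lia.
by rewrite updE eqxx; stores.
Qed.

Lemma pt_behead_gen A (a : enc A) (B : A -> A) (f : G -> A) :
  (forall x, code (B x) = (tok (code x)).2) -> PT f -> PT (fun c => B (f c)).
Proof.
move=> E; apply: (@pt_post _ _ _ _ B f (fun d => Seq (tokp d d.+1 d.+2 d.+3) (clear d.+1))
  (fun n => n * 21 + 21)); first by polys.
move=> d s x cl sd.
have uq : uniq [:: d; d.+1; d.+2; d.+3].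
  by rewrite /= !inE; apply/and4P; split=> //; lia.
have r1 := runs_tokp uq (cl d.+2 ltac:(lia)) (cl d.+3 ltac:(lia)) (cl d.+1 ltac:(lia)).
rewrite sd in r1; set s1 := upd _ _ _ in r1.
have r2 := runs_clear d.+1 s1.
apply: runs_eq (runs_seq r1 r2) _ _.
  have h : size (tok (code x)).1 <= size (code x).
    apply: leq_trans (leq_pred _); apply: leq_trans (tok_size _); exact: leq_addr.
  apply: (@leq_trans (size (code x) * 16 + 20 + (size (code x) * 5).+1)); last lia.
  by rewrite /s1 updE eqxx leq_add2l ltnS leq_mul2r h orbT.
rewrite /s1 E; have c1 := cl d.+1 (leqnn _).
by stores.
Qed.

Lemma pt_seq1 A (a : enc A) (f : G -> A) : PT f -> PT (fun c => [:: f c]).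
Proof.
apply: (@pt_post _ _ _ _ (fun x => [:: x]) f (fun d => Seq (mvr d d.+1) (Seq (pushw d [:: false; true])
   (drain d.+1 d (fun b => [:: b; b])))) (fun n => n * 13 + 5)); first by polys.
move=> d s x cl sd; have c1 := cl d.+1 (leqnn _).
have r1 := @runs_mvr d d.+1 s ltac:(lia); rewrite sd c1 cats0 in r1.
set s1 := upd _ _ _ in r1.
have r2 := runs_pushw d [:: false; true] s1; set s2 := upd _ _ _ in r2.
have r3 := @runs_drain d.+1 d (fun b => [:: b; b]) s2 2 ltac:(lia) (fun=> isT).
have e2 : s2 d.+1 = rev (code x).
  by rewrite /s2 /s1; reg.
have e3 : s2 d = [:: false; true].
  by rewrite /s2 /s1; reg.
rewrite e2 e3 revK size_rev in r3.
apply: runs_eq (runs_seq r1 (runs_seq r2 r3)) _ _; first by rewrite /=; lia.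
have -> : code [:: x] = item (code x) by rewrite /= cats0.
by rewrite /item /dbl /s2 /s1; stores.
Qed.

Lemma pt_explode (f : G -> raw) : PT f -> PT (fun c => unraw (f c) : seq bool).
Proof.
apply: (@pt_post _ _ _ _ (fun x => unraw x : seq bool) f (fun d => Seq (mvr d d.+1)
   (drain d.+1 d (fun b => item [:: b]))) (fun n => n * 15 + 2)); first by polys.
move=> d s x cl sd; have c1 := cl d.+1 (leqnn _).
have r1 := @runs_mvr d d.+1 s ltac:(lia); rewrite sd c1 cats0 in r1.
set s1 := upd _ _ _ in r1.
have r2 := @runs_drain d.+1 d (fun b => item [:: b]) s1 4 ltac:(lia) (fun=> isT).
have e2 : s1 d.+1 = rev (code x) by rewrite /s1 !updE eqxx.
have e3 : s1 d = [::].
  by rewrite /s1 !updE !eqxx; case: eqP => [?|_]; first lia.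
rewrite e2 e3 revK size_rev cats0 in r2.
apply: runs_eq (runs_seq r1 r2) _ _; first by rewrite /=; lia.
by rewrite /s1; stores.
Qed.

End Ops.

(** * Arithmetic, Boolean and list functions *)

Section Derived.
Context {G : Type} {g : ctx G}.

Lemma pt_cat A (a : enc A) (x y : G -> seq A) :
  PT x -> PT y -> PT (fun c => x c ++ y c).
Proof. by apply: pt_cat_gen => ? ? /=; rewrite map_cat flatten_cat. Qed.

Lemma pt_cons A (a : enc A) (x : G -> A) (y : G -> seq A) :
  PT x -> PT y -> PT (fun c => x c :: y c).
Proof. by move=> Hx; apply: (@pt_cat _ _ (fun c => [:: x c]) y); exact: pt_seq1. Qed.

Lemma pt_rcons A (a : enc A) (x : G -> seq A) (y : G -> A) :
  PT x -> PT y -> PT (fun c => rcons (x c) (y c)).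
Proof.
move=> Hx Hy; apply: (@pt_ext _ _ _ _ (fun c => x c ++ [:: y c])).
  by apply: pt_cat => //; exact: pt_seq1.
by move=> c; rewrite cats1.
Qed.

Lemma pt_addn (x y : G -> nat) : PT x -> PT y -> PT (fun c => x c + y c).
Proof.
apply: pt_cat_gen => i j /=; rewrite -flatten_cat; congr flatten.
by elim: i => //= i ->.
Qed.

Lemma pt_S (x : G -> nat) : PT x -> PT (fun c => (x c).+1).
Proof. by move=> Hx; apply: (@pt_addn (fun=> 1) x) => //; exact: pt_const. Qed.

Lemma pt_pred (x : G -> nat) : PT x -> PT (fun c => (x c).-1).
Proof. by apply: (pt_behead_gen (B := predn)); case. Qed.

Lemma pt_behead A (a : enc A) (x : G -> seq A) : PT x -> PT (fun c => behead (x c)).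
Proof.
by apply: pt_behead_gen => -[|y s] //=; rewrite tok_item.
Qed.

Lemma pt_eq0 (x : G -> nat) : PT x -> PT (fun c => x c == 0).
Proof. by apply: (pt_isnil (N := fun n => n == 0)); case. Qed.

Lemma pt_nilp A (a : enc A) (x : G -> seq A) : PT x -> PT (fun c => nilp (x c)).
Proof. by apply: (pt_isnil (N := fun s => nilp s)) => -[|y s] //=; case: (code y). Qed.

Lemma pt_rawcons (b : G -> bool) (x : G -> raw) :
  PT b -> PT x -> PT (fun c => Raw (b c :: unraw (x c))).
Proof. by apply: (pt_cat_gen (F := fun b x => Raw (b :: unraw x))) => y [s]. Qed.

Lemma pt_foldl A (a : enc A) U (u : enc U) (l : G -> seq A) (x : G -> U)
    (h : G -> U -> A -> U) :
  PT l -> PT x -> PT (fun c : G * U * A => h c.1.1 c.1.2 c.2) ->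
  (exists2 B, poly B & forall c i,
     size (code (foldl (h c) (x c) (take i (l c)))) <= B (sz c)) ->
  PT (fun c => foldl (h c) (x c) (l c)).
Proof.
move=> Hl Hx Hh Hb.
apply: (@pt_foldl_gen _ _ _ _ _ _ _ _ l l x (fun c : G * U * A => h c.1.1 c.1.2 c.2)) => //.
by move=> c /=; rewrite (map_comp item) toks_items.
Qed.

Lemma code_iter n : flatten (nseq n (item [::])) = flatten (map item (nseq n [::])).
Proof. by elim: n => //= n ->. Qed.

Lemma pt_iter U (u : enc U) (n : G -> nat) (x : G -> U) (h : G -> U -> U) :
  PT n -> PT x -> PT (fun c : G * U => h c.1 c.2) ->
  (exists2 B, poly B & forall c i, i <= n c ->
     size (code (iter i (h c) (x c))) <= B (sz c)) ->
  PT (fun c => iter (n c) (h c) (x c)).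
Proof.
move=> Hn Hx Hh [B pB Hb].
have E (c : G) i y : foldl (fun z (_ : unit) => h c z) y (nseq i tt) = iter i (h c) y.
  by elim: i y => //= i IH y; rewrite IH -iterSr.
apply: (@pt_ext _ _ _ _ (fun c => foldl (fun z (_ : unit) => h c z) (x c) (nseq (n c) tt))).
  apply: (@pt_foldl_gen _ _ _ _ unit _ _ _ n (fun c => nseq (n c) tt) x
    (fun c : G * U * unit => h c.1.1 c.1.2)) => //.
  - by move=> c /=; rewrite code_iter toks_items; elim: (n c) => //= m ->.
  - exact: (pt_weak (f := fun c : G * U => h c.1 c.2)).
  - exists B => // c i; have -> : take i (nseq (n c) tt) = nseq (minn i (n c)) tt.
      by elim: (n c) i => [|m IH] [|i] //=; rewrite IH minnSS.
    by rewrite E; apply: Hb; exact: geq_minr.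
by move=> c; rewrite E.
Qed.

End Derived.

Section Derived2.
Context {G : Type} {g : ctx G}.

(** The loop runs over a string that need not be a well-formed code. A token of size m takes
    [2 * m + 2] symbols in the result and at least [m + 1] symbols of the string, whence the factor
    2 in the bound. *)
Lemma pt_raw_toks (f : G -> raw) : PT f -> PT (fun c => map Raw (toks (unraw (f c)))).
Proof.
move=> Hf.
have E (s : seq raw) l : foldl (fun y z => rcons y z) s l = s ++ l.
  by elim: l s => [|x l IH] s; rewrite ?cats0 //= IH cat_rcons.
apply: (@pt_ext _ _ _ _ (fun c => foldl (fun y z => rcons y z) [::] (map Raw (toks (unraw (f c)))))).
  apply: (@pt_foldl_gen _ _ raw _ raw _ (seq raw) _ f (fun c => map Raw (toks (unraw (f c))))
    (fun=> [::]) (fun c : G * seq raw * raw => rcons c.1.2 c.2)) => //.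
  - by move=> c; rewrite /= -map_comp map_id.
  - exact: pt_const.
  - apply: pt_rcons; last exact: pt_var.
    by apply: (pt_weak (f := fun c : G * seq raw => c.2)); exact: pt_var.
  - have [b pb bb] := pt_bound Hf.
    exists (fun n => 2 * b n); first by polys.
    move=> c i; rewrite E cat0s.
    apply: leq_trans (_ : 2 * size (unraw (f c)) <= _); last by rewrite leq_mul2l bb orbT.
    move: (unraw (f c)) => w; rewrite /toks; move: {1}(size w) => m.
    elim: m w i => [|m IH] w i; first by case: i.
    case: w => [|y w]; first by case: i.
    case: i => [|i] //.
    have -> : toks_rec m.+1 (y :: w) =
      (tok (y :: w)).1 :: toks_rec m (tok (y :: w)).2 by [].
    have := tok_size (y :: w); move: (tok (y :: w)) => t ts.
    have := IH t.2 i; rewrite /= size_cat /item size_cat.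
    have -> : size (dbl t.1) = 2 * size t.1 by elim: (t.1) => //= ? ? ->; lia.
    rewrite /= in ts *; move: (size _) => k1; lia.
by move=> c; rewrite E.
Qed.

End Derived2.

Lemma size_item x : size (item x) = 2 * size x + 2.
Proof. by rewrite /item size_cat; congr (_ + _); elim: x => //= b x ->; lia. Qed.

Lemma code_nat n : size (code n) = 2 * n.
Proof. by rewrite /=; elim: n => //= n ->; lia. Qed.

Lemma code_cons A (a : enc A) (x : A) s :
  size (code (x :: s)) = 2 * size (code x) + 2 + size (code s).
Proof. by rewrite /= size_cat size_item. Qed.

Lemma code_cat A (a : enc A) (s t : seq A) :
  size (code (s ++ t)) = size (code s) + size (code t).
Proof. by rewrite /= map_cat flatten_cat size_cat. Qed.

Lemma code_take A (a : enc A) (s : seq A) i : size (code (take i s)) <= size (code s).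
Proof. by rewrite -{2}(cat_take_drop i s) code_cat leq_addr. Qed.

Lemma size_code A (a : enc A) (s : seq A) : size s <= size (code s).
Proof. by elim: s => // x s IH; rewrite code_cons [size (_ :: _)]/=; lia. Qed.

Lemma code_catrev A (a : enc A) (s t : seq A) :
  size (code (catrev s t)) = size (code s) + size (code t).
Proof. by elim: s t => // x s IH t; rewrite [catrev _ _]/= IH !code_cons; lia. Qed.

Lemma sz_pair G (g : ctx G) A (a : enc A) (c : G) (x : A) :
  sz (c, x) = size (code x) + sz c.
Proof. by []. Qed.

Section List.
Context {G : Type} {g : ctx G}.

Lemma pt_last A (a : enc A) (x : G -> A) (s : G -> seq A) :
  PT x -> PT s -> PT (fun c => last (x c) (s c)).
Proof.
move=> Hx Hs.
have E (y : A) l : foldl (fun _ z => z) y l = last y l by elim: l y => //=.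
apply: (@pt_ext _ _ _ _ (fun c => foldl (fun _ z => z) (x c) (s c))); last by move=> c; rewrite E.
have [p pp bp] := pt_bound Hx; have [q pq bq] := pt_bound Hs.
apply: (pt_foldl (h := fun _ _ z => z)) => //; first exact: pt_var.
exists (fun n => p n + q n); first by polys.
move=> c i; rewrite E; apply: leq_trans (leq_add (bp c) (bq c)).
apply: leq_trans (leq_add (leqnn _) (code_take _ (s c) i)).
move: (take _ _) => l; elim: l (x c) => [|z l IH] y; first exact: leq_addr.
by apply: leq_trans (IH z) _; rewrite code_cons; lia.
Qed.

Lemma pt_rev A (a : enc A) (s : G -> seq A) : PT s -> PT (fun c => rev (s c)).
Proof.
move=> Hs; have [q pq bq] := pt_bound Hs.
have E (t l : seq A) : foldl (fun t z => z :: t) t l = catrev l t by elim: l t => //=.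
apply: (@pt_ext _ _ _ _ (fun c => foldl (fun t z => z :: t) [::] (s c))); last by move=> c; rewrite E.
apply: (pt_foldl (h := fun _ t z => z :: t)) => //; first exact: pt_const.
  by apply: pt_cons; [exact: pt_var|apply: (pt_weak (f := fun c => c.2)); exact: pt_var].
exists q => // c i; rewrite E code_catrev addn0.
exact: leq_trans (code_take _ _ _) (bq c).
Qed.

Lemma pt_size A (a : enc A) (s : G -> seq A) : PT s -> PT (fun c => size (s c)).
Proof.
move=> Hs; have [q pq bq] := pt_bound Hs.
have E n (l : seq A) : foldl (fun n _ => n.+1) n l = n + size l.
  by elim: l n => [|x l IH] n; rewrite ?addn0 //= IH addnS.
apply: (@pt_ext _ _ _ _ (fun c => foldl (fun n _ => n.+1) 0 (s c))); last by move=> c; rewrite E.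
apply: (pt_foldl (h := fun _ n z => n.+1)) => //; first exact: pt_const.
  by apply: pt_S; apply: (pt_weak (f := fun c => c.2)); exact: pt_var.
exists (fun n => 2 * q n); first by polys.
move=> c i; rewrite E code_nat leq_mul2l add0n /=.
exact: leq_trans (size_code _ _) (leq_trans (code_take _ _ _) (bq c)).
Qed.

Lemma pt_flatmap A (a : enc A) B (b : enc B) (s : G -> seq A) (h : G -> A -> seq B) :
  PT s -> PT (fun c : G * A => h c.1 c.2) ->
  PT (fun c => flatten [seq h c x | x <- s c]).
Proof.
move=> Hs Hh; have [q pq bq] := pt_bound Hs; have [p pp bp] := pt_bound Hh.
have E c (t : seq B) l :
    foldl (fun t z => t ++ h c z) t l = t ++ flatten [seq h c x | x <- l].
  by elim: l t => [|x l IH] t; rewrite ?cats0 //= IH catA.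
apply: (@pt_ext _ _ _ _ (fun c => foldl (fun t z => t ++ h c z) [::] (s c))); last by move=> c; rewrite E.
apply: (pt_foldl (h := fun c t z => t ++ h c z)) => //; first exact: pt_const.
  apply: pt_cat; first by apply: (pt_weak (f := fun c => c.2)); exact: pt_var.
  (* The program of [h] expects the item right above the context, so the register of the
     accumulator, which lies between them, is dropped from [loc]. *)
  move: Hh => [P [r [pr HP]]]; exists (fun loc => P (head 0 loc :: behead (behead loc))), r.
  split=> // -[|r1 [|r2 loc]] d st c //= /and3P[l1 l2 l3] [e1 e2 e3] cl.
  apply: runs_le (HP _ _ _ (c.1.1, c.2) _ _ cl) _.
  - by rewrite /= l1.
  - by rewrite /= e1 e3.
  - by case: pr => mr _; apply: mr; rewrite /sz /=; lia.
exists (fun n => q n * p (n + q n)); first by polys.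
move=> c i; rewrite E cat0s.
apply: leq_trans (_ : size (take i (s c)) * p (sz c + q (sz c)) <= _); last first.
  rewrite leq_mul2r; apply/orP; right.
  exact: leq_trans (size_code _ _) (leq_trans (code_take _ _ _) (bq c)).
have := leq_trans (code_take _ (s c) i) (bq c).
elim: (take i (s c)) => // x l IH; rewrite code_cons => hq.
rewrite [flatten _]/= code_cat [size (_ :: _)]/= mulSn leq_add //; last by apply: IH; lia.
apply: leq_trans (bp (c, x)) _; case: pp => mp _; apply: mp; rewrite sz_pair; lia.
Qed.

Lemma pt_map A (a : enc A) B (b : enc B) (s : G -> seq A) (h : G -> A -> B) :
  PT s -> PT (fun c : G * A => h c.1 c.2) -> PT (fun c => [seq h c x | x <- s c]).
Proof.
move=> Hs Hh; apply: (@pt_ext _ _ _ _ (fun c => flatten [seq [:: h c x] | x <- s c])).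
  by apply: (pt_flatmap (h := fun c x => [:: h c x])) => //; exact: pt_seq1.
by move=> c; elim: (s c) => //= x l ->.
Qed.

Lemma pt_filter A (a : enc A) (s : G -> seq A) (h : G -> A -> bool) :
  PT s -> PT (fun c : G * A => h c.1 c.2) -> PT (fun c => [seq x <- s c | h c x]).
Proof.
move=> Hs Hh; apply: (@pt_ext _ _ _ _ (fun c => flatten [seq (if h c x then [:: x] else [::]) | x <- s c])).
  apply: (pt_flatmap (h := fun c x => if h c x then [:: x] else [::])) => //.
  by apply: pt_if => //; [apply: pt_seq1; exact: pt_var|exact: pt_const].
by move=> c; elim: (s c) => //= x l ->; case: (h c x).
Qed.

Lemma pt_negb (b : G -> bool) : PT b -> PT (fun c => ~~ b c).
Proof.
move=> Hb; apply: (@pt_ext _ _ _ _ (fun c => if b c then false else true)).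
  by apply: pt_if => //; exact: pt_const.
by move=> c; case: (b c).
Qed.

Lemma pt_andb (b d : G -> bool) : PT b -> PT d -> PT (fun c => b c && d c).
Proof.
move=> Hb Hd; apply: (@pt_ext _ _ _ _ (fun c => if b c then d c else false)) => //.
by apply: pt_if => //; exact: pt_const.
Qed.

Lemma pt_orb (b d : G -> bool) : PT b -> PT d -> PT (fun c => b c || d c).
Proof.
move=> Hb Hd; apply: (@pt_ext _ _ _ _ (fun c => if b c then true else d c)) => //.
by apply: pt_if => //; exact: pt_const.
Qed.

Lemma pt_eqb (b d : G -> bool) : PT b -> PT d -> PT (fun c => b c == d c).
Proof.
move=> Hb Hd; apply: (@pt_ext _ _ _ _ (fun c => if b c then d c else ~~ d c)).
  by apply: pt_if => //; exact: pt_negb.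
by move=> c; case: (b c); case: (d c).
Qed.

Lemma pt_subn (x y : G -> nat) : PT x -> PT y -> PT (fun c => x c - y c).
Proof.
move=> Hx Hy; have [q pq bq] := pt_bound Hx.
have E i j : iter i predn j = j - i by elim: i => /= [|i ->]; lia.
apply: (@pt_ext _ _ _ _ (fun c => iter (y c) predn (x c))); last by move=> c; rewrite E.
apply: (pt_iter (h := fun _ => predn)) => //.
  by apply: pt_pred; exact: pt_var.
exists q => // c i _; rewrite E; apply: leq_trans (bq c); rewrite !code_nat; lia.
Qed.

Lemma pt_leq (x y : G -> nat) : PT x -> PT y -> PT (fun c => x c <= y c).
Proof. by move=> Hx Hy; apply: pt_eq0; exact: pt_subn. Qed.

Lemma pt_ltn (x y : G -> nat) : PT x -> PT y -> PT (fun c => x c < y c).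
Proof. by move=> Hx Hy; apply: pt_leq => //; exact: pt_S. Qed.

Lemma pt_eqn (x y : G -> nat) : PT x -> PT y -> PT (fun c => x c == y c).
Proof.
move=> Hx Hy; apply: (@pt_ext _ _ _ _ (fun c => (x c <= y c) && (y c <= x c))).
  by apply: pt_andb; exact: pt_leq.
by move=> c; rewrite eqn_leq.
Qed.

Lemma pt_minn (x y : G -> nat) : PT x -> PT y -> PT (fun c => minn (x c) (y c)).
Proof. by move=> Hx Hy; apply: pt_if => //; exact: pt_ltn. Qed.

Lemma pt_muln (x y : G -> nat) : PT x -> PT y -> PT (fun c => x c * y c).
Proof.
move=> Hx Hy; have [p pp bp] := pt_bound Hx; have [q pq bq] := pt_bound Hy.
have E i j : iter i (addn j) 0 = j * i by elim: i => /= [|i ->]; lia.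
apply: (@pt_ext _ _ _ _ (fun c => iter (y c) (addn (x c)) 0)); last by move=> c; rewrite E.
apply: (pt_iter (h := fun c => addn (x c))) => //; first exact: pt_const.
  by apply: pt_addn; [exact: (pt_weak (f := x))|exact: pt_var].
exists (fun n => p n * q n); first by polys.
move=> c i li; rewrite E; apply: leq_trans (leq_mul (bp c) (bq c)); rewrite !code_nat.
by rewrite mulnA leq_mul //; lia.
Qed.

End List.

Section List2.
Context {G : Type} {g : ctx G}.

Lemma code_iota n : size (code (iota 0 n)) <= n * (4 * n + 2).
Proof.
have H m k : m + k <= n -> size (code (iota m k)) <= k * (4 * n + 2).
  elim: k m => // k IH m h; rewrite [iota _ _]/= code_cons code_nat mulSn.
  by apply: leq_add; [lia|apply: IH; lia].
exact: H.
Qed.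

Lemma pt_iota (n : G -> nat) : PT n -> PT (fun c => iota 0 (n c)).
Proof.
move=> Hn; have [q pq bq] := pt_bound Hn.
have E i : iter i (fun l => rcons l (size l)) [::] = iota 0 i.
  by elim: i => //= i ->; rewrite -cats1 size_iota -[[:: i]]/(iota (0 + i) 1) -iotaD addn1.
apply: (@pt_ext _ _ _ _ (fun c => iter (n c) (fun l => rcons l (size l)) [::])); last by move=> c; rewrite E.
apply: (pt_iter (h := fun _ l => rcons l (size l))) => //; first exact: pt_const.
  by apply: pt_rcons; [exact: pt_var|apply: pt_size; exact: pt_var].
exists (fun n => q n * (4 * q n + 2)); first by polys.
move=> c i li; rewrite E; apply: leq_trans (code_iota _) _.
have := bq c; rewrite code_nat => h; rewrite leq_mul //; lia.
Qed.

Lemma pt_drop A (a : enc A) (s : G -> seq A) (i : G -> nat) :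
  PT s -> PT i -> PT (fun c => drop (i c) (s c)).
Proof.
move=> Hs Hi; have [q pq bq] := pt_bound Hs.
have E j (t : seq A) : iter j behead t = drop j t.
  elim: j t => [|j IH] t; first by rewrite drop0.
  by rewrite iterS IH -[behead _]drop1 drop_drop.
apply: (@pt_ext _ _ _ _ (fun c => iter (i c) behead (s c))); last by move=> c; rewrite E.
apply: (pt_iter (h := fun _ => behead)) => //.
  by apply: pt_behead; exact: pt_var.
exists q => // c j _; rewrite E; apply: leq_trans (bq c).
by rewrite -{2}(cat_take_drop j (s c)) code_cat leq_addl.
Qed.

Lemma pt_nth A (a : enc A) (x : A) (s : G -> seq A) (i : G -> nat) :
  PT s -> PT i -> PT (fun c => nth x (s c) (i c)).
Proof.
move=> Hs Hi; apply: (@pt_ext _ _ _ _ (fun c => last x (rev (drop (i c) (s c))))).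
  by apply: pt_last; [exact: pt_const|apply: pt_rev; exact: pt_drop].
move=> c; rewrite -(addn0 (i c)) -nth_drop addn0.
by case: (drop _ _) => //= y t; rewrite rev_cons last_rcons.
Qed.

Lemma pt_odd (n : G -> nat) : PT n -> PT (fun c => odd (n c)).
Proof.
move=> Hn; have E i : iter i negb false = odd i by elim: i => //= i ->.
apply: (@pt_ext _ _ _ _ (fun c => iter (n c) negb false)); last by move=> c; rewrite E.
apply: (pt_iter (h := fun _ => negb)) => //; first exact: pt_const.
  by apply: pt_negb; exact: pt_var.
by exists (fun=> 1) => //; exact: poly_const.
Qed.

End List2.

Section List3.
Context {G : Type} {g : ctx G}.

Lemma pt_half (n : G -> nat) : PT n -> PT (fun c => (n c)./2).
Proof.
move=> Hn; apply: (@pt_ext _ _ _ _ (fun c => size [seq i <- iota 0 (n c) | odd i])).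
  apply: pt_size; apply: (pt_filter (h := fun _ => odd)); first exact: pt_iota.
  by apply: pt_odd; exact: pt_var.
move=> c; elim: (n c) => // m IH.
have -> : m.+1./2 = odd m + m./2 by rewrite -uphalf_half.
by rewrite -addn1 iotaD filter_cat size_cat IH /= add0n addnC; case: (odd m).
Qed.

Lemma pt_implode (s : G -> seq bool) : PT s -> PT (fun c => Raw (s c)).
Proof.
move=> Hs; have [q pq bq] := pt_bound Hs.
have E t l : foldl (fun t z => Raw (z :: unraw t)) (Raw t) l = Raw (catrev l t).
  by elim: l t => //=.
apply: (@pt_ext _ _ _ _ (fun c => foldl (fun t z => Raw (z :: unraw t)) (Raw [::]) (rev (s c)))).
  apply: (pt_foldl (h := fun _ t z => Raw (z :: unraw t))) => //.
  - exact: pt_rev.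
  - exact: pt_const.
  - apply: pt_rawcons; first exact: pt_var.
    by apply: (pt_weak (f := fun c => c.2)); exact: pt_var.
  - exists q => // c i; rewrite E [code _]/= catrevE cats0 size_rev.
    apply: leq_trans (bq c); apply: leq_trans (size_code _ _).
    by rewrite size_take size_rev; case: ltnP => // /ltnW.
by move=> c; rewrite E catrevE cats0 revK.
Qed.

End List3.

(** * From computable functions to Turing machines *)

Lemma addr_io K j : addr K 0 j.+1 = (2 + Z.of_nat j)%Z.
Proof.
rewrite /addr; have -> : dir 0 = true by []; have -> : off 0 = 1 by [].
by have -> : stride K 0 = 1 by []; rewrite /dz; lia.
Qed.

(** The input has its first symbol nearest to the origin, that is at the bottom of register 0.
    Transfer to register 1 turns it round, and transfer of the result from 2 to 0 turns that round
    for output. The two moves by 2 lead from the first content cell to the origin and back. *)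
Theorem PT_poly_time U (u : enc U) (F : raw -> U) :
  PT (fun c : unit * raw => F c.2) -> poly_time (fun x => code (F (Raw x))).
Proof.
move=> HF; have [b pb bb] := pt_bound HF; move: HF => [P [p [pp HP]]].
pose prog := Seq (mvr 0 1) (Seq (P [:: 1] 2) (mvr 2 0)).
pose K := maxn (regs prog) 1.
have [M HM] := tprog_tm (TSeq (mvn false 2) (TSeq (spcomp K prog) (mvn true 2))).
pose T n := n * 6 + 1 + (p n + (b n * 6 + 1)).
have pT : poly T by rewrite /T; polys.
have [_ [a [k bnd]]] : poly (fun n => 2 + (9 * (K + 2) * T n * (n + T n + 1) + 2)).
  by polys.
exists M, a, k => x.
pose s0 : store := fun r => if r == 0 then rev x else [::].
have r1 := @runs_mvr 0 1 s0 ltac:(lia).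
rewrite /= revK cats0 size_rev in r1; set s1 := upd _ _ _ in r1.
have c1 : clean s1 2 by move=> [|[|r]].
have r2 := HP [:: 1] 2 s1 (tt, Raw x) isT erefl c1; set s2 := upd _ _ _ in r2.
have r3 := @runs_mvr 2 0 s2 ltac:(lia); set s3 := upd _ _ _ in r3.
have szx : sz (tt, Raw x) = size x by rewrite sz_pair addn0.
have [t tl e] := runs_seq r1 (runs_seq r2 r3).
have {}tl : t <= T (size x).
  apply: leq_trans tl _; rewrite /T szx addn1 leq_add2l leq_add2l addn1 ltnS leq_mul2r.
  by apply/orP; right; have := bb (tt, Raw x); rewrite szx.
have s30 : s3 0 = rev (code (F (Raw x))) by rewrite /s3 /s2 /= !updE /= cats0.
have neg y : (y < 2)%Z -> tape_of x 2 y = None.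
  by move=> h; rewrite /tape_of; have -> : (y <? 2)%Z = true by lia.
have adj r j : (addr K r.+1 j < 2)%Z.
  by rewrite /addr; have -> : dir r.+1 = false by []; rewrite /dz; lia.
have rep0 : rep K s0 (tape_of x 2).
  move=> [|r] rK; split; try by rewrite neg.
  - move=> j; rewrite addr_io /tape_of.
    have -> : (2 + Z.of_nat j <? 2)%Z = false by lia.
    have -> : Z.to_nat (2 + Z.of_nat j - 2) = j by lia.
    by rewrite /s0 /= revK.
  - by move=> j; rewrite neg // /s0 /= nth_nil.
have K0 : 0 < K by rewrite /K; lia.
have [|r rK|t' [T' [run rep1 bt]]] := spcomp_correct e _ (M := size x) rep0 _.
- exact: leq_maxl.
- by rewrite /s0; case: eqP; rewrite ?size_rev.
exists (2 + (t' + 2)); split.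
  apply: leq_trans (bnd (size x)); rewrite leq_add2l leq_add2r.
  apply: leq_trans bt _; rewrite leq_mul //; last by rewrite addn1; lia.
  by rewrite leq_mul2l tl orbT.
apply: (HM x _ _ 2%Z 2%Z T').
  apply: RSeq; first by apply: (@run_mvn' _ _ _ _ 0%Z).
  by apply: RSeq; first exact: run; exact: run_mvn'.
move=> j; have [_ H] := rep1 0 K0.
by rewrite -(addr_io K) H s30 revK.
Qed.

(** * Halving subcubes *)

(* A level works in the subcube of the points that agree with [v], the image of
   the last element, on the coordinates in [F]; [z] is the only earlier point that
   may lie in it.  [sel] singles out the coordinate that the predicate reads. *)
Section Levels.
Variable n : nat.
Implicit Types (F z v w u : nat -> bool).

Definition differs F z v (b : nat) : bool := ~~ F b && (v b != z b).
Definition cand F z v b : bool :=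
  ~~ F b && ((v b != z b) || ~~ has (differs F z v) (iota 0 n)).
Definition sel F z v b : bool := cand F z v b && ~~ has (cand F z v) (iota 0 b).
(** The form in which the circuit computes it, as a disjunction of selected bits; by [selP] it is a
    single coordinate of [w]. *)
Definition side F z v w : bool := has (fun b => sel F z v b && w b) (iota 0 n).

Definition fixed' F z v b : bool := F b || sel F z v b.
Definition point' F z v (s : bool) b : bool := if s == side F z v v then v b else z b.

Fixpoint state (v : nat -> nat -> bool) (l : nat) : (nat -> bool) * (nat -> bool) :=
  if l is l'.+1 then
    let: (F, z) := state v l' in
    (fixed' F z (v l'), point' F z (v l') (side F z (v l') (v l)))
  else (fun=> false, fun=> true).

Lemma state_ext (v v' : nat -> nat -> bool) l : (forall j, j <= l -> v j = v' j) -> state v l = state v' l.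
Proof.
elim: l => //= l IH h; rewrite IH ?h //.
by move=> j jl; apply: h; lia.
Qed.

Definition level_side (v : nat -> nat -> bool) l w : bool := side (state v l).1 (state v l).2 (v l) w.

Lemma selP F z v : has (fun b => ~~ F b) (iota 0 n) -> exists i,
  [/\ i < n, ~~ F i, forall b, b < n -> sel F z v b = (b == i),
      forall w, side F z v w = w i
    & forall b, b < n -> ~~ F b -> v b != z b -> v i != z i].
Proof.
move=> hF.
have : exists b, (b < n) && cand F z v b.
  case: (boolP (has (differs F z v) (iota 0 n))) => [|h].
    move=> /hasP[b]; rewrite mem_iota /= add0n => bn /andP[h1 h2].
    by exists b; rewrite bn /cand h1 h2.
  move: hF => /hasP[b]; rewrite mem_iota /= add0n => bn h1.
  by exists b; rewrite bn /cand h1 h orbT.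
case/ex_minnP => i /andP[il ci] mi.
have S b : b < n -> sel F z v b = (b == i).
  move=> bn; rewrite /sel; case: ltngtP => h.
  - apply/negbTE; apply/negP => /andP[cb _].
    by have := mi b; rewrite bn cb => /(_ isT); lia.
  - apply/negbTE; rewrite negb_and negbK; apply/orP; right.
    by apply/hasP; exists i; rewrite ?mem_iota.
  - rewrite h ci /=; apply/hasP => -[j]; rewrite mem_iota add0n => ji cj.
    by have := mi j; rewrite cj andbT => /(_ ltac:(lia)); lia.
exists i; split=> //.
- by case/andP: ci.
- move=> w; apply/hasP/idP => [[b]|wi].
    by rewrite mem_iota add0n => bn; rewrite S // => /andP[/eqP ->].
  by exists i; rewrite ?mem_iota // S // eqxx.
- move=> b bn Fb vb; case/andP: ci => _ /orP[//|/hasP[]].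
  by exists b; [rewrite mem_iota|rewrite /differs Fb].
Qed.

Definition agrees F u w : Prop := forall b, b < n -> F b -> u b = w b.
Definition same u w : Prop := forall b, b < n -> u b = w b.

(** The invariant of the construction. The point [z] need not lie in the subcube itself; then no
    point of [B] does. *)
Definition isolated (B : (nat -> bool) -> Prop) F z v : Prop :=
  forall u, B u -> agrees F u v -> same u z.

(** The critical case is an old point [u] in the half of [v]. There [u], which equals [z], agrees
    with [v] at the selected coordinate, hence by the choice of that coordinate on all free ones,
    and replacing [z] by [v] loses nothing. *)
Lemma isolated_step (B : (nat -> bool) -> Prop) F z v w :
  has (fun b => ~~ F b) (iota 0 n) ->
  isolated B F z v -> agrees F w v ->
  isolated (fun u => B u \/ u = v) (fixed' F z v) (point' F z v (side F z v w)) w.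
Proof.
move=> hF inv ag u Bu au.
have [i [il Fi S pk D]] := selP z v hF.
have ui : u i = w i by apply: au => //; rewrite /fixed' S // eqxx orbT.
have av : agrees F u v.
  by move=> b bn Fb; rewrite au ?ag // /fixed' Fb.
rewrite /point' !pk; case: Bu => [Bu|uv]; last first.
  by rewrite -uv -ui eqxx.
have uz := inv u Bu av.
case: eqP => // wv b bn.
case: (boolP (F b)) => [Fb|nFb]; first exact: av.
rewrite uz //; apply/eqP; rewrite eq_sym; apply: contraTT isT => vz.
have := D b bn nFb vz; rewrite -uz // ui wv eqxx //.
Qed.

Lemma count_step F z v : has (fun b => ~~ F b) (iota 0 n) ->
  count (fixed' F z v) (iota 0 n) = (count F (iota 0 n)).+1.
Proof.
move=> hF; have [i [il Fi S _ _]] := selP z v hF.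
rewrite (@eq_in_count _ (fixed' F z v) (predU F (pred1 i))); last first.
  by move=> b; rewrite mem_iota add0n => bn; rewrite /fixed' S.
have := count_predUI F (pred1 i) (iota 0 n).
have -> : count (predI F (pred1 i)) (iota 0 n) = 0.
  rewrite (@eq_count _ _ pred0) ?count_pred0 // => b /=.
  by case: eqP => [->|]; rewrite ?andbF ?(negbTE Fi).
by rewrite addn0 => ->; rewrite count_uniq_mem ?iota_uniq // mem_iota il addn1.
Qed.

Lemma has_free F : count F (iota 0 n) < n -> has (fun b => ~~ F b) (iota 0 n).
Proof.
move=> h; rewrite has_count.
have := count_predC F (iota 0 n); rewrite size_iota => e.
have : count (predC F) (iota 0 n) = count (fun b => ~~ F b) (iota 0 n) by [].
lia.
Qed.

Section Play.
Variables (v : nat -> nat -> bool) (k : nat).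
Hypothesis kn : k.+2 <= n.
Hypothesis cons : forall i j, i < j -> j <= k ->
  level_side v i (v j) = level_side v i (v i.+1).

Local Notation F l := (state v l).1.
Local Notation z l := (state v l).2.

Lemma stateS l : state v l.+1 =
  (fixed' (F l) (z l) (v l), point' (F l) (z l) (v l) (level_side v l (v l.+1))).
Proof. by rewrite /= /level_side; case: (state v l). Qed.

Lemma count_state l : l <= n -> count (F l) (iota 0 n) = l.
Proof.
elim: l => [|l IH] ln; first by rewrite /= count_pred0.
by rewrite stateS count_step ?IH //; [lia|apply: has_free; rewrite IH; lia].
Qed.

Lemma free_state l : l < n -> has (fun b => ~~ F l b) (iota 0 n).
Proof. by move=> ln; apply: has_free; rewrite count_state //; lia. Qed.

Lemma play_agrees l j : l <= j -> j <= k -> agrees (F l) (v j) (v l).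
Proof.
elim: l j => [|l IH] j lj jk b bn; first by [].
rewrite stateS /fixed' /=; have [|i [il Fi S pk _]] := @selP (F l) (z l) (v l) _.
  by apply: free_state; lia.
case/orP => [Fb|].
  by rewrite !(IH _ _ _ b bn Fb) //; lia.
rewrite S // => /eqP ->; have := cons (i := l) (j := j) lj jk.
by rewrite /level_side !pk.
Qed.

Definition pivots l u : Prop := u = (fun=> true) \/ exists2 j, j < l & u = v j.

Lemma play_isolated l : l <= k -> isolated (pivots l) (F l) (z l) (v l).
Proof.
elim: l => [|l IH] lk u Bu au.
  by case: Bu => [-> b //|[j]]; lia.
rewrite stateS in au *.
apply: (@isolated_step (pivots l) _ _ _ (v l.+1)) => //.
- by apply: free_state; lia.
- by apply: IH; lia.
- by apply: play_agrees.
- case: Bu => [->|[j jl ->]]; first by left; left.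
  by case: (ltngtP j l) => h; [left; right; exists j|lia|right; rewrite h].
Qed.

Variable c : bool.

(* Opposite, on all free coordinates, to the only removed point of the half in
   which the selected coordinate is [c]. *)
Definition hole b : bool :=
  if F k b then v k b
  else if sel (F k) (z k) (v k) b then c
  else ~~ point' (F k) (z k) (v k) c b.

Lemma hole_side : level_side v k hole = c.
Proof.
have [|i [il Fi S pk _]] := @selP (F k) (z k) (v k) _; first by apply: free_state; lia.
by rewrite /level_side pk /hole (negbTE Fi) S // eqxx.
Qed.

Lemma fixed_mono i l b : i <= l -> F i b -> F l b.
Proof.
move=> il; rewrite -(subnK il); elim: (l - i) => // m IH h.
by rewrite addSn stateS /= /fixed' IH.
Qed.

(** The coordinate selected at level [i] is fixed from level [i.+1] on, and on coordinates fixed at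
    level [k] the hole copies [v k]. *)
Lemma hole_agrees i : i < k -> level_side v i hole = level_side v i (v i.+1).
Proof.
move=> ik; have [|p [pl Fp S pk _]] := @selP (F i) (z i) (v i) _.
  by apply: free_state; lia.
have Fkp : F k p.
  by apply: (@fixed_mono i.+1) => //; rewrite stateS /= /fixed' S // eqxx orbT.
rewrite -(cons ik (leqnn k)) /level_side !pk /hole Fkp //.
Qed.

(** By [isolated_step], with the hole in the role of the next image, a removed point equal to the
    hole would be [point']. After [k.+1] levels some coordinate is still free, and there the hole
    negates [point']. *)
Lemma hole_pivots u : pivots k.+1 u -> ~ same u hole.
Proof.
move=> Bu us.
have hF : has (fun b => ~~ F k b) (iota 0 n) by apply: free_state; lia.
have ag : agrees (F k) hole (v k) by move=> b bn; rewrite /hole => ->.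
have iso := isolated_step hF (play_isolated (leqnn k)) ag.
have := free_state kn; rewrite stateS /= => /hasP[b].
rewrite mem_iota add0n /= /fixed' negb_or => bn /andP[f1 f2].
have := iso u _ _ b bn; rewrite -/(level_side v k hole) hole_side us //.
rewrite /hole (negbTE f1) (negbTE f2) => h.
have : ~~ point' (F k) (z k) (v k) c b = point' (F k) (z k) (v k) c b.
  apply: h; last by move=> b' b'n _; exact: us.
  case: Bu => [->|[j jl ->]]; first by left; left.
  by case: (ltngtP j k) => hj; [left; right; exists j|lia|right; rewrite hj].
by case: (point' _ _ _ _ _).
Qed.

End Play.
End Levels.

(** * The circuits of the predicates *)

(** Gates are kept as triples in the form of [gate_code], so that building and running a circuit are
    functions on lists of numbers, to which [PT] applies. *)
Definition gate_of (t : seq nat) : gate :=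
  match nth 0 t 0 with
  | 0 => GAnd (nth 0 t 1) (nth 0 t 2)
  | 1 => GOr (nth 0 t 1) (nth 0 t 2)
  | _ => GNot (nth 0 t 1)
  end.

Definition run_gates (gs : seq (seq nat)) (w : bits) : bits :=
  foldl (fun w t => rcons w (gate_val w (gate_of t))) w gs.

(** [p] is the wire that gate [t] drives. One traversal scheme serves for well-formedness,
    evaluation and coding of the gates. *)
Fixpoint allp (Q : nat -> seq nat -> Prop) p (l : seq (seq nat)) : Prop :=
  if l is t :: l' then Q p t /\ allp Q p.+1 l' else True.

Lemma allp_cat Q p l1 l2 : allp Q p (l1 ++ l2) <-> allp Q p l1 /\ allp Q (p + size l1) l2.
Proof.
elim: l1 p => [|t l IH] p /=; first by rewrite addn0; tauto.
by rewrite IH addnS; tauto.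
Qed.

Lemma allp_map Q p (t : nat -> seq nat) m :
  allp Q p [seq t b | b <- iota 0 m] <-> forall b, b < m -> Q (p + b) (t b).
Proof.
have H i : allp Q (p + i) [seq t b | b <- iota i m] <->
    forall b, b < m -> Q (p + (i + b)) (t (i + b)).
  elim: m i => [|m IH] i /=; first by split.
  rewrite -addnS IH; split=> [[h0 h] [|b] bm|h].
  - by rewrite addn0.
  - by rewrite -addSnnS; apply: h.
  - split; first by have := h 0 isT; rewrite addn0.
    by move=> b bm; rewrite addSnnS; apply: h.
by have := H 0; rewrite addn0.
Qed.

Lemma size_rows (T : Type) (r : nat -> seq T) m I : (forall j, size (r j) = m) ->
  size (flatten [seq r j | j <- iota 0 I]) = I * m.
Proof.
by move=> h; move: {1}0 => i; elim: I i => //= I IH i; rewrite size_cat h IH mulSn.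
Qed.

Lemma allp_rows Q p (r : nat -> seq (seq nat)) m I : (forall j, size (r j) = m) ->
  allp Q p (flatten [seq r j | j <- iota 0 I]) <->
  forall j, j < I -> allp Q (p + j * m) (r j).
Proof.
move=> hs; elim: I => [|I IH]; first by split.
rewrite -addn1 iotaD map_cat flatten_cat allp_cat IH (size_rows I hs) /= cats0 add0n addn1.
split=> [[h1 h2] j|h].
  by rewrite ltnS leq_eqVlt => /orP[/eqP ->|/h1].
by split=> [j jI|]; apply: h; lia.
Qed.

Lemma gate_val_eq p g (w w' : bits) : gate_wf p g ->
  (forall q, q < p -> nth false w q = nth false w' q) -> gate_val w g = gate_val w' g.
Proof.
case: g => [a b|a b|a] /= h e; last by rewrite e.
- by case/andP: h => h1 h2; rewrite !e.
- by case/andP: h => h1 h2; rewrite !e.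
Qed.

Definition wf_at p t : Prop := gate_wf p (gate_of t).
Definition holds_at (w : bits) p t : Prop := nth false w p = gate_val w (gate_of t).

(** Wires are only appended and a well-formed gate reads earlier ones, so its equation remains true
    in the final list of wires. *)
Lemma run_gatesP gs w : allp wf_at (size w) gs ->
  allp (holds_at (run_gates gs w)) (size w) gs /\
  forall p, p < size w -> nth false (run_gates gs w) p = nth false w p.
Proof.
elim: gs w => //= t gs IH w [wt wgs].
have := IH (rcons w (gate_val w (gate_of t))).
rewrite size_rcons => /(_ wgs) [h1 h2]; split; last first.
  by move=> p pw; rewrite h2 ?nth_rcons ?pw //; lia.
split=> //; rewrite /holds_at h2 // nth_rcons ltnn eqxx.
apply: gate_val_eq wt _ => q qw.
by rewrite h2 ?nth_rcons ?qw //; lia.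
Qed.

Section Build.
Variable T : seq nat.

(** [T] stands for the tokens [n :: circ_code C]: the gate count is at position 2, the triples start
    at 3, and the outputs start at [4 + 3 * G], behind their count. *)
Definition tk j := nth 0 T j.
Arguments tk : simpl never.
Local Notation n := (tk 0).
Local Notation G := (tk 2).

Definition src_gate h : seq nat := [:: tk (3 + 3 * h); tk (4 + 3 * h); tk (5 + 3 * h)].
Definition src_out b := tk (4 + 3 * G + b).

Section Blocks.
Variable I : nat.

(** The source circuit is copied once for each of the [I] arguments; this is the place of its wire
    [w] in copy [j]. All [I * n] inputs precede the copied gates. *)
Definition reloc j w := if w < n then j * n + w else I * n + j * G + (w - n).
(** A negation gets third entry 0, as in [gate_code]; [pcode_circuit] needs the triples to be
    literal codes. *)
Definition copy_gate j h : seq nat :=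
  [:: tk (3 + 3 * h); reloc j (tk (4 + 3 * h));
      if tk (3 + 3 * h) == 2 then 0 else reloc j (tk (5 + 3 * h))].

Definition base := I * n + I * G.
(** The disjunction of a wire with itself copies the scattered output wires into contiguous
    blocks. *)
Definition image_gate j b : seq nat := [:: 1; reloc j (src_out b); reloc j (src_out b)].
(** There are no constant gates. With x the input wire 0, the three blocks hold not x, then (not x)
    or x, then (not x) and x; the last two are the initial point 1...1 and the initial empty
    mask. *)
Definition const_gate q b : seq nat :=
  if q == 0 then [:: 2; 0; 0]
  else if q == 1 then [:: 1; base + I * n + b; 0]
  else [:: 0; base + I * n + b; 0].

(* A row [:: k; m1; r1; m2; r2] is a block of [n] gates of kind [k]; [m] tells
   which wire of the block [r] is the operand of gate [b]: wire [b] if [m = 0],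
   the last wire if [m = 1], and wire [b - 1] if [m = 2] (replaced by the first
   operand for [b = 0]).  Blocks 0 and 1 are the current point and mask, 29 and
   30 the images of the current and of the next element; blocks 27 and 28, the
   results of the last two rows, are blocks 0 and 1 of the next level. *)
Definition program : seq (seq nat) :=
  [:: [:: 2; 0; 29; 0; 0]; [:: 2; 0; 0; 0; 0]; [:: 0; 0; 29; 0; 3];
      [:: 0; 0; 0; 0; 2]; [:: 1; 0; 4; 0; 5]; [:: 2; 0; 1; 0; 0];
      [:: 0; 0; 6; 0; 7]; [:: 1; 0; 8; 2; 9]; [:: 2; 1; 9; 0; 0];
      [:: 1; 0; 6; 0; 10]; [:: 0; 0; 11; 0; 7]; [:: 1; 0; 12; 2; 13];
      [:: 2; 0; 13; 0; 0]; [:: 0; 0; 12; 2; 14]; [:: 0; 0; 15; 0; 30];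
      [:: 1; 0; 16; 2; 17]; [:: 0; 0; 15; 0; 29]; [:: 1; 0; 18; 2; 19];
      [:: 0; 1; 17; 1; 19]; [:: 1; 1; 17; 1; 19]; [:: 2; 0; 21; 0; 0];
      [:: 1; 0; 20; 0; 22]; [:: 2; 0; 23; 0; 0]; [:: 0; 0; 23; 0; 29];
      [:: 0; 0; 24; 0; 0]; [:: 1; 0; 25; 0; 26]; [:: 1; 0; 1; 0; 15]].

(** Blocks below [I] are images, [I] is the auxiliary not x, and levels begin at [I + 1]. Row [q] of
    [program] fills block [q + 2]: 8 is [differs], 12 [cand], 15 [sel]; 17 and 19 end in the sides
    of the next and the current image, 23 compares these, 27 is [point'] and 28 [fixed']. *)
Definition block l r :=
  base + n * (if r == 29 then l else if r == 30 then l.+1 else I + 1 + 27 * l + r).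

Definition operand l m r b r1 :=
  if m == 0 then block l r + b
  else if m == 1 then block l r + n.-1
  else if b == 0 then block l r1 else block l r + b.-1.

Definition level_gate l q b : seq nat :=
  let o := nth [::] program q in
  [:: nth 0 o 0; operand l (nth 0 o 1) (nth 0 o 2) b 0;
      if nth 0 o 0 == 2 then 0
      else operand l (nth 0 o 3) (nth 0 o 4) b (nth 0 o 2)].

Definition gates : seq (seq nat) :=
  flatten [seq [seq copy_gate j h | h <- iota 0 G] | j <- iota 0 I] ++
  flatten [seq [seq image_gate j b | b <- iota 0 n] | j <- iota 0 I] ++
  flatten [seq [seq const_gate q b | b <- iota 0 n] | q <- iota 0 3] ++
  flatten [seq flatten [seq [seq level_gate l q b | b <- iota 0 n] | q <- iota 0 27]
          | l <- iota 0 I.-1].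

(** [P_i] has [I = i + 2] arguments and is decided at level [I - 2], where the next image is that of
    the last argument. *)
Definition answer := block (I - 2) 17 + n.-1.

Definition pred_circuit : circuit :=
  Circuit (I * n) (map gate_of gates) [:: answer].

Lemma allp_gates Q : allp Q (I * n) gates <->
  [/\ forall j h, j < I -> h < G -> Q (I * n + j * G + h) (copy_gate j h),
      forall j b, j < I -> b < n -> Q (base + n * j + b) (image_gate j b),
      forall q b, q < 3 -> b < n -> Q (base + n * (I + q) + b) (const_gate q b)
    & forall l q b, l < I.-1 -> q < 27 -> b < n ->
        Q (block l (q + 2) + b) (level_gate l q b)].
Proof.
have sm (t : nat -> seq nat) m : size [seq t b | b <- iota 0 m] = m.
  by rewrite size_map size_iota.
have sl l : size (flatten [seq [seq level_gate l q b | b <- iota 0 n] | q <- iota 0 27])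
   = 27 * n by rewrite (size_rows (m := n)).
have s1 : size (flatten [seq [seq copy_gate j h | h <- iota 0 G] | j <- iota 0 I]) = I * G.
  by rewrite (size_rows (m := G)).
have s2 : size (flatten [seq [seq image_gate j b | b <- iota 0 n] | j <- iota 0 I]) = I * n.
  by rewrite (size_rows (m := n)).
have s3 : size (flatten [seq [seq const_gate q b | b <- iota 0 n] | q <- iota 0 3]) = 3 * n.
  by rewrite (size_rows (m := n)).
rewrite /gates allp_cat s1 -/base allp_cat s2 allp_cat s3.
have e q l : q < 27 -> base + I * n + 3 * n + l * (27 * n) + q * n = block l (q + 2).
  move=> lq; rewrite /block; do 2 (case: eqP => [?|_]; first lia).
  by rewrite mulnC [n * _]mulnC; nia.
have R1 := @allp_rows Q (I * n) (fun j => [seq copy_gate j h | h <- iota 0 G]) G I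
  (fun j => sm _ _).
have R2 := @allp_rows Q base (fun j => [seq image_gate j b | b <- iota 0 n]) n I
  (fun j => sm _ _).
have R3 := @allp_rows Q (base + I * n) (fun q => [seq const_gate q b | b <- iota 0 n]) n 3
  (fun j => sm _ _).
have R4 := @allp_rows Q (base + I * n + 3 * n) (fun l => flatten [seq [seq level_gate l q b
  | b <- iota 0 n] | q <- iota 0 27]) (27 * n) I.-1 sl.
have R5 p l := @allp_rows Q p (fun q => [seq level_gate l q b | b <- iota 0 n]) n 27
  (fun j => sm _ _).
split=> [[H1 [H2 [H3 H4]]]|[H1 H2 H3 H4]].
  split=> [j h jI hG|j b jI bn|q b q3 bn|l q b lI q27 bn].
  - by move/R1/(_ j jI)/allp_map: H1; apply.
  - by move/R2/(_ j jI)/allp_map/(_ b bn): H2; rewrite mulnC.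
  - have /allp_map/(_ b bn) := proj1 R3 H3 q q3.
    by rewrite mulnDr ![n * _]mulnC !addnA.
  - by move/R4/(_ l lI)/R5/(_ q q27)/allp_map/(_ b bn): H4; rewrite e.
split; last split; last split.
- apply/R1 => j jI; apply/allp_map => h hG; exact: H1.
- apply/R2 => j jI; apply/allp_map => b bn; rewrite mulnC; exact: H2.
- apply/R3 => q q3; apply/allp_map => b bn; have := H3 q b q3 bn.
  by rewrite mulnDr ![n * _]mulnC !addnA.
- apply/R4 => l lI; apply/R5 => q q27.
  by apply/allp_map => b bn; rewrite e //; exact: H4.
Qed.

End Blocks.
End Build.
Arguments tk : simpl never.

Arguments block : simpl never.

(** * Correctness of the predicate circuits *)

Section Correct.
Variable T : seq nat.
Local Notation n := (tk T 0).
Local Notation G := (tk T 2).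
Local Notation sgate := (src_gate T).
Local Notation sout := (src_out T).

Definition src_circuit : circuit :=
  Circuit n [seq gate_of (sgate h) | h <- iota 0 G] [seq sout b | b <- iota 0 n].

Hypothesis n1 : 1 < n.
Hypothesis wf_gate : forall h, h < G -> gate_wf (n + h) (gate_of (sgate h)).
Hypothesis wf_out : forall b, b < n -> sout b < n + G.

Variable I : nat.
Hypothesis I1 : 1 < I.

Local Notation blockI := (block T I).
Local Notation relocI := (reloc T I).
Local Notation baseI := (base T I).

Lemma reloc_lt j w h : j < I -> w < n + h -> relocI j w < I * n + j * G + h.
Proof.
rewrite /reloc => jI wh; case: (ltnP w n) => wn; last lia.
have : j.+1 * n <= I * n by rewrite leq_mul2r jI orbT.
by rewrite mulSn; lia.
Qed.

Lemma reloc_base j w : j < I -> w < n + G -> relocI j w < baseI.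
Proof.
move=> jI wG; apply: leq_trans (reloc_lt jI wG) _; rewrite /base -addnA leq_add2l.
by rewrite addnC -mulSn leq_mul2r jI orbT.
Qed.

Definition block_id l r :=
  if r == 29 then l else if r == 30 then l.+1 else I + 1 + 27 * l + r.

Lemma block_lt l r q b b' : block_id l r < block_id l q -> b < n -> b' < n ->
  blockI l r + b < blockI l q + b'.
Proof.
rewrite /blockI -/(block_id l r) -/(block_id l q) => h bn bn'.
have : n * (block_id l r).+1 <= n * block_id l q by rewrite leq_mul2l h orbT.
by rewrite mulnS; lia.
Qed.

Definition ref_ok q r := [|| r == 29, r == 30 | r < q + 2].
(** A row may read images, earlier blocks and, in mode 2, its own block one wire back. Checking the
    27 rows by evaluation settles all levels at once. *)
Definition row_ok q : bool :=
  let o := nth [::] program q in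
  [&& nth 0 o 1 <= 1, ref_ok q (nth 0 o 2) &
      (ref_ok q (nth 0 o 4)) || (nth 0 o 3 == 2) && (nth 0 o 4 == q + 2)].

Lemma program_ok q : q < 27 -> row_ok q.
Proof.
have : all row_ok (iota 0 27) by [].
by move/allP => h q27; apply: h; rewrite mem_iota.
Qed.

Lemma ref_ok_lt l q r : l < I.-1 -> q < 27 -> ref_ok q r ->
  block_id l r < block_id l (q + 2).
Proof.
move=> lI q27; rewrite /ref_ok /block_id => h.
have -> : (q + 2 == 29) = false by lia.
have -> : (q + 2 == 30) = false by lia.
move: h; case: eqP => [_ _|_]; first by lia.
by case: eqP => [_ _|_ /= h]; lia.
Qed.

Lemma operand_lt l q m r b r1 : l < I.-1 -> q < 27 -> b < n -> ref_ok q r1 ->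
  ref_ok q r || (m == 2) && (r == q + 2) ->
  operand T I l m r b r1 < blockI l (q + 2) + b.
Proof.
move=> lI q27 bn h1 h2.
have B r' b' : ref_ok q r' -> b' < n -> blockI l r' + b' < blockI l (q + 2) + b.
  by move=> ok b'n; apply: block_lt => //; exact: ref_ok_lt.
rewrite /operand; case/orP: h2 => [ok|/andP[/eqP -> /eqP ->]].
  case: eqP => _; first exact: B.
  case: eqP => _; first by apply: B => //; lia.
  by case: eqP => _; [have := B _ 0 h1; rewrite addn0; apply; lia|apply: B => //; lia].
rewrite /=; case: eqP => b0; last lia.
by have := B _ 0 h1; rewrite addn0; apply; lia.
Qed.

Lemma gates_wf : allp wf_at (I * n) (gates T I).
Proof.
apply/allp_gates; split=> [j h jI hG|j b jI bn|q b q3 bn|l q b lI q27 bn].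
- have := wf_gate hG; rewrite /wf_at /gate_of /src_gate /=.
  case: (tk T (3 + 3 * h)) => [|[|k]] /=.
  + by case/andP => h1 h2; rewrite !reloc_lt.
  + by case/andP => h1 h2; rewrite !reloc_lt.
  + by move=> h1; rewrite !reloc_lt.
- rewrite /wf_at /gate_of /= andbb.
  by apply: leq_trans (reloc_base jI (wf_out bn)) _; rewrite -addnA leq_addr.
- rewrite /wf_at /gate_of /const_gate; case: q q3 => [|[|[|//]]] _ /=.
  + have : 0 < n * (I + 0) by rewrite muln_gt0; lia.
    lia.
  + have -> : n * (I + 1) = I * n + n by nia.
    by lia.
  + have -> : n * (I + 2) = I * n + n + n by nia.
    by lia.
- have := program_ok q27; rewrite /row_ok /wf_at /level_gate /gate_of.
  set o := nth [::] program q => /and3P[m1 ok1 ok2] /=.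
  have A : operand T I l (nth 0 o 1) (nth 0 o 2) b 0 < blockI l (q + 2) + b.
    by apply: operand_lt => //; rewrite ?ok1 //; rewrite /ref_ok; lia.
  case E: (nth 0 o 0) => [|[|k]] //=.
  + by rewrite A /= operand_lt.
  + by rewrite A /= operand_lt.
Qed.

Lemma size_gates : size (gates T I) = I * G + (I * n + (3 * n + I.-1 * (27 * n))).
Proof.
have sm (t : nat -> seq nat) m : size [seq t b | b <- iota 0 m] = m.
  by rewrite size_map size_iota.
rewrite /gates !size_cat; congr addn; last congr addn; last congr addn.
- by rewrite (size_rows (m := G)).
- by rewrite (size_rows (m := n)).
- by rewrite !sm /=; lia.
- by rewrite (size_rows (m := 27 * n)) // => l; rewrite (size_rows (m := n)).
Qed.

Lemma answer_lt : answer T I < I * n + size (gates T I).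
Proof.
rewrite size_gates /answer /block /base /=.
have -> : I + 1 + 27 * (I - 2) + 17 = I + 3 + 27 * I.-1 - 12 by lia.
have : n * (I + 3 + 27 * I.-1 - 12).+1 <= n * (I + 3 + 27 * I.-1).
  by rewrite leq_mul2l; lia.
have -> : n * (I + 3 + 27 * I.-1) = I * n + (3 * n + I.-1 * (27 * n)).
  by move: I.-1 => p; lia.
by rewrite mulnS; lia.
Qed.

Lemma pred_circuit_type : circ_type (I * n) 1 (pred_circuit T I).
Proof.
rewrite /circ_type /circ_wf /= eqxx !andbT size_map answer_lt andbT.
have := gates_wf; move: (I * n) (gates T I) => p l h; apply/allP => j.
rewrite mem_iota add0n => jl; rewrite (nth_map [::]) //.
elim: l p j h jl => //= t l IH p [|j] [h0 h1] jl; first by rewrite addn0.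
by rewrite addnS -addSn; apply: IH.
Qed.

Variable A : seq nat.
Hypothesis sA : size A = I.

Definition pred_input : bits := flatten (map (nbits n) A).
Definition pred_wires : bits := run_gates (gates T I) pred_input.
Definition images j : nat -> bool :=
  fun b => nth false (circ_eval src_circuit (nbits n (nth 0 A j))) b.
Local Notation wire p := (nth false pred_wires p).

Lemma size_pred_input : size pred_input = I * n.
Proof.
rewrite /pred_input -sA; elim: A => //= a l IH.
by rewrite size_cat IH size_mkseq mulSn.
Qed.

Lemma nth_pred_input j w : j < I -> w < n ->
  nth false pred_input (j * n + w) = nth false (nbits n (nth 0 A j)) w.
Proof.
rewrite /pred_input -sA => jI wn; elim: A j jI => // a l IH [|j] jI /=.
  by rewrite nth_cat size_mkseq wn.
rewrite nth_cat size_mkseq mulSn ltnNge -addnA leq_addr /= addKn.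
exact: IH.
Qed.

Lemma wires_hold : allp (holds_at pred_wires) (I * n) (gates T I).
Proof.
by have [] := @run_gatesP (gates T I) pred_input; rewrite size_pred_input //; exact: gates_wf.
Qed.

Lemma wires_input p : p < I * n -> wire p = nth false pred_input p.
Proof.
by have [] := @run_gatesP (gates T I) pred_input; rewrite size_pred_input //; [exact: gates_wf|move=> _; apply].
Qed.

Definition src_wires j := run_gates [seq sgate h | h <- iota 0 G] (nbits n (nth 0 A j)).

Lemma src_wires_hold j h : h < G ->
  nth false (src_wires j) (n + h) = gate_val (src_wires j) (gate_of (sgate h)).
Proof.
have [] := @run_gatesP [seq sgate h | h <- iota 0 G] (nbits n (nth 0 A j)).
  by rewrite size_mkseq; apply/allp_map.
by rewrite size_mkseq => /allp_map H _ hG; exact: H.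
Qed.

Lemma src_wires_input j w : w < n ->
  nth false (src_wires j) w = nth false (nbits n (nth 0 A j)) w.
Proof.
have [] := @run_gatesP [seq sgate h | h <- iota 0 G] (nbits n (nth 0 A j)).
  by rewrite size_mkseq; apply/allp_map.
by rewrite size_mkseq => _; apply.
Qed.

Lemma wires_copy j w : j < I -> w < n + G -> wire (relocI j w) = nth false (src_wires j) w.
Proof.
move=> jI; elim/ltn_ind: w => w IH wG.
case: (ltnP w n) => wn.
  rewrite src_wires_input // /reloc wn wires_input ?nth_pred_input //.
  have : j.+1 * n <= I * n by rewrite leq_mul2r jI orbT.
  by rewrite mulSn; lia.
have hG : w - n < G by lia.
have ew : w = n + (w - n) by lia.
have [H _ _ _] := proj1 (allp_gates T I _) wires_hold.
have {}H := H j (w - n) jI hG.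
have -> : relocI j w = I * n + j * G + (w - n) by rewrite /reloc ltnNge wn.
rewrite H [in RHS]ew src_wires_hold //.
have := wf_gate hG; rewrite -ew /gate_of /src_gate /=.
case: (tk T (3 + 3 * _)) => [|[|k]] /=.
- by case/andP => h1 h2; rewrite !IH //; lia.
- by case/andP => h1 h2; rewrite !IH //; lia.
- by move=> h1; rewrite !IH //; lia.
Qed.

Lemma wires_image j b : j < I -> b < n -> wire (baseI + n * j + b) = images j b.
Proof.
move=> jI bn; have [_ H _ _] := proj1 (allp_gates T I _) wires_hold.
rewrite (H j b jI bn) /gate_of /= orbb wires_copy ?wf_out //.
rewrite /images /circ_eval /= (nth_map 0) ?size_map ?size_iota //.
rewrite (nth_map 0) ?size_iota // nth_iota // add0n.
congr nth; rewrite /src_wires /run_gates.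
elim: (iota 0 G) (nbits _ _) => //= h l IHl w; by rewrite IHl.
Qed.

Definition block_wire l r b := wire (blockI l r + b).

Lemma block_wire_current l b : l < I -> b < n -> block_wire l 29 b = images l b.
Proof. by move=> lI bn; rewrite /block_wire /block /= wires_image. Qed.

Lemma block_wire_next l b : l.+1 < I -> b < n -> block_wire l 30 b = images l.+1 b.
Proof. by move=> lI bn; rewrite /block_wire /block /= wires_image. Qed.

Lemma block_wire_gate l q b : l < I.-1 -> q < 27 -> b < n ->
  block_wire l (q + 2) b = gate_val pred_wires (gate_of (level_gate T I l q b)).
Proof.
move=> lI q27 bn; have [_ _ _ H] := proj1 (allp_gates T I _) wires_hold.
exact: H.
Qed.

Lemma block_wire_initial b : b < n -> block_wire 0 0 b = true /\ block_wire 0 1 b = false.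
Proof.
move=> bn; have [_ _ H _] := proj1 (allp_gates T I _) wires_hold.
have h0 := H 0 b isT bn; have h1 := H 1 b isT bn; have h2 := H 2 b isT bn.
rewrite /holds_at /gate_of /= addn0 in h0; rewrite /holds_at /gate_of /= in h1.
rewrite /holds_at /gate_of /= in h2.
rewrite [n * I]mulnC in h0; rewrite h0 in h1 h2.
rewrite /block_wire /block /= muln0 !addn0 h1; split; first by case: (wire 0).
have -> : I + 1 + 1 = I + 2 by lia.
by rewrite h2; case: (wire 0).
Qed.

Local Notation S l := (state n images l).

(** The recurrence of the rows that form prefix disjunctions: at wire 0 the missing predecessor is
    replaced by [d 0], so that [x 0 = d 0]. *)
Lemma chain (x d : nat -> bool) :
  (forall b, b < n -> x b = d b || (if b == 0 then d 0 else x b.-1)) ->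
  forall b, b < n -> x b = has d (iota 0 b.+1).
Proof.
move=> h; elim=> [|b IH] bn; first by rewrite h //= orbb orbF.
rewrite h // IH; last by lia.
have -> : iota 0 b.+2 = iota 0 b.+1 ++ [:: b.+1] by rewrite -[b.+2]addn1 iotaD.
by rewrite has_cat has_seq1 orbC.
Qed.

Lemma block_wire_op l q k m1 r1 m2 r2 b : l < I.-1 -> q < 27 -> b < n ->
  nth [::] program q = [:: k; m1; r1; m2; r2] ->
  let x := wire (operand T I l m1 r1 b 0) in
  let y := wire (operand T I l m2 r2 b r1) in
  block_wire l (q + 2) b = match k with 0 => x && y | 1 => x || y | _ => ~~ x end.
Proof.
move=> lI q27 bn e; rewrite (block_wire_gate lI q27 bn) /level_gate /gate_of e /=.
by case: k {e} => [|[|k]].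
Qed.

Lemma eq_has_iota (d d' : nat -> bool) m : (forall b, b < m -> d b = d' b) ->
  has d (iota 0 m) = has d' (iota 0 m).
Proof. by move=> h; apply: eq_in_has => b; rewrite mem_iota add0n => /h. Qed.

Lemma level_wires l F z : l < I.-1 ->
  (forall b, b < n -> block_wire l 0 b = z b) -> (forall b, b < n -> block_wire l 1 b = F b) ->
  [/\ forall b, b < n -> block_wire l 15 b = sel n F z (images l) b,
      block_wire l 17 n.-1 = side n F z (images l) (images l.+1),
      block_wire l 19 n.-1 = side n F z (images l) (images l),
      forall b, b < n -> block_wire l 27 b =
        point' n F z (images l) (side n F z (images l) (images l.+1)) b
    & forall b, b < n -> block_wire l 28 b = fixed' n F z (images l) b].
Proof.
move=> lI hz hF.
have nl : n.-1 < n by lia.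
have nS : n.-1.+1 = n by lia.
have x29 b : b < n -> block_wire l 29 b = images l b by apply: block_wire_current; lia.
have x30 b : b < n -> block_wire l 30 b = images l.+1 b by apply: block_wire_next; lia.
set v := images l; set w := images l.+1; rewrite -/v -/w in x29 x30.
have op q k m1 r1 m2 r2 b := @block_wire_op l q k m1 r1 m2 r2 b lI.
have x2 b : b < n -> block_wire l 2 b = ~~ v b.
  by move=> bn; rewrite (op 0 _ _ _ _ _ b isT bn erefl) -x29.
have x3 b : b < n -> block_wire l 3 b = ~~ z b.
  by move=> bn; rewrite (op 1 _ _ _ _ _ b isT bn erefl) -hz.
have x4 b : b < n -> block_wire l 4 b = v b && ~~ z b.
  by move=> bn; rewrite (op 2 _ _ _ _ _ b isT bn erefl) -x29 // -x3.
have x5 b : b < n -> block_wire l 5 b = z b && ~~ v b.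
  by move=> bn; rewrite (op 3 _ _ _ _ _ b isT bn erefl) -hz // -x2.
have x6 b : b < n -> block_wire l 6 b = (v b != z b).
  move=> bn; rewrite (op 4 _ _ _ _ _ b isT bn erefl) /= -/(block_wire l 4 b) -/(block_wire l 5 b).
  by rewrite x4 // x5 //; case: (v b); case: (z b).
have x7 b : b < n -> block_wire l 7 b = ~~ F b.
  by move=> bn; rewrite (op 5 _ _ _ _ _ b isT bn erefl) -hF.
have x8 b : b < n -> block_wire l 8 b = differs F z v b.
  move=> bn; rewrite (op 6 _ _ _ _ _ b isT bn erefl) /= -/(block_wire l 6 b) -/(block_wire l 7 b).
  by rewrite x6 // x7 // andbC.
have ch r q : q < 27 -> nth [::] program q = [:: 1; 0; r; 2; q + 2] ->
    forall b, b < n -> block_wire l (q + 2) b = has (block_wire l r) (iota 0 b.+1).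
  move=> q27 e b bn; apply: (@chain (block_wire l (q + 2)) (block_wire l r) _ b bn) => c cn.
  rewrite (op q _ _ _ _ _ c q27 cn e) /operand /=.
  by case: c cn => [|c] cn; rewrite /block_wire ?addn0.
have x9 : block_wire l 9 n.-1 = has (differs F z v) (iota 0 n).
  by rewrite (ch 8 7) // nS; apply: eq_has_iota.
have x10 b : b < n -> block_wire l 10 b = ~~ has (differs F z v) (iota 0 n).
  by move=> bn; rewrite (op 8 _ _ _ _ _ b isT bn erefl) -x9.
have x11 b : b < n -> block_wire l 11 b = (v b != z b) || ~~ has (differs F z v) (iota 0 n).
  move=> bn; rewrite (op 9 _ _ _ _ _ b isT bn erefl) /= -/(block_wire l 6 b) -/(block_wire l 10 b).
  by rewrite x6 // x10.
have x12 b : b < n -> block_wire l 12 b = cand n F z v b.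
  move=> bn; rewrite (op 10 _ _ _ _ _ b isT bn erefl) /= -/(block_wire l 11 b) -/(block_wire l 7 b).
  by rewrite x11 // x7 // andbC.
have x14 b : b < n -> block_wire l 14 b = ~~ has (cand n F z v) (iota 0 b.+1).
  move=> bn; rewrite (op 12 _ _ _ _ _ b isT bn erefl) /= -/(block_wire l 13 b) (ch 12 11) //.
  by congr (~~ _); apply: eq_has_iota => c cb; apply: x12; lia.
have x15 b : b < n -> block_wire l 15 b = sel n F z v b.
  move=> bn; rewrite (op 13 _ _ _ _ _ b isT bn erefl) /sel /operand /= -/(block_wire l 12 b) x12 //.
  (* At wire 0 the shifted operand is replaced by the first one, which is right because no candidate
     precedes coordinate 0. *)
  case: b bn => [|b] bn /=; first by rewrite -[blockI l 12]addn0 -/(block_wire l 12 0) x12 // andbb andbT.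
  by rewrite -/(block_wire l 14 b) x14 //; lia.
have x16 b : b < n -> block_wire l 16 b = sel n F z v b && w b.
  by move=> bn; rewrite (op 14 _ _ _ _ _ b isT bn erefl) -x15 // -x30.
have x17 : block_wire l 17 n.-1 = side n F z v w.
  by rewrite (ch 16 15) // nS; apply: eq_has_iota.
have x18 b : b < n -> block_wire l 18 b = sel n F z v b && v b.
  by move=> bn; rewrite (op 16 _ _ _ _ _ b isT bn erefl) -x15 // -x29.
have x19 : block_wire l 19 n.-1 = side n F z v v.
  by rewrite (ch 18 17) // nS; apply: eq_has_iota.
have x20 b : b < n -> block_wire l 20 b = side n F z v w && side n F z v v.
  by move=> bn; rewrite (op 18 _ _ _ _ _ b isT bn erefl) -x17 -x19.
have x21 b : b < n -> block_wire l 21 b = side n F z v w || side n F z v v.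
  by move=> bn; rewrite (op 19 _ _ _ _ _ b isT bn erefl) -x17 -x19.
have x22 b : b < n -> block_wire l 22 b = ~~ (side n F z v w || side n F z v v).
  by move=> bn; rewrite (op 20 _ _ _ _ _ b isT bn erefl) -(x21 b).
have x23 b : b < n -> block_wire l 23 b = (side n F z v w == side n F z v v).
  move=> bn; rewrite (op 21 _ _ _ _ _ b isT bn erefl) /= -/(block_wire l 20 b) -/(block_wire l 22 b).
  by rewrite x20 // x22 //; case: (side _ _ _ _ w); case: (side _ _ _ _ v).
have x24 b : b < n -> block_wire l 24 b = (side n F z v w != side n F z v v).
  by move=> bn; rewrite (op 22 _ _ _ _ _ b isT bn erefl) -(x23 b).
split=> // b bn.
- have x25 : block_wire l 25 b = (side n F z v w == side n F z v v) && v b.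
    by rewrite (op 23 _ _ _ _ _ b isT bn erefl) -(x23 b) // -x29.
  have x26 : block_wire l 26 b = (side n F z v w != side n F z v v) && z b.
    by rewrite (op 24 _ _ _ _ _ b isT bn erefl) -(x24 b) // -hz.
  rewrite (op 25 _ _ _ _ _ b isT bn erefl) /= -/(block_wire l 25 b) -/(block_wire l 26 b) x25 x26.
  by rewrite /point'; case: eqP => _ //=; rewrite orbF.
- rewrite (op 26 _ _ _ _ _ b isT bn erefl) /= -/(block_wire l 1 b) -/(block_wire l 15 b).
  by rewrite hF // x15.
Qed.

Lemma state_wires l : l < I.-1 -> forall b, b < n ->
  block_wire l 0 b = (S l).2 b /\ block_wire l 1 b = (S l).1 b.
Proof.
elim: l => [|l IH] lI b bn; first exact: block_wire_initial.
have lI' : l < I.-1 by lia.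
have [_ _ _ hz hF] := @level_wires l (S l).1 (S l).2 lI'
  (fun b bn => (IH lI' b bn).1) (fun b bn => (IH lI' b bn).2).
have e r : r < 2 -> blockI l.+1 r = blockI l (27 + r).
  case: r => [|[|//]] _; rewrite /block; congr (_ + _ * _) => /=; lia.
by rewrite stateS /block_wire !e //= -/(block_wire l 27 b) -/(block_wire l 28 b) hz // hF.
Qed.

Lemma final_wires l : l < I.-1 ->
  [/\ forall b, b < n -> block_wire l 0 b = (S l).2 b,
      forall b, b < n -> block_wire l 1 b = (S l).1 b,
      forall b, b < n -> block_wire l 15 b = sel n (S l).1 (S l).2 (images l) b,
      block_wire l 17 n.-1 = level_side n images l (images l.+1)
    & block_wire l 19 n.-1 = level_side n images l (images l)].
Proof.
move=> lI; have h b (bn : b < n) := state_wires lI bn.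
have [h1 h2 h3 _ _] := @level_wires l (S l).1 (S l).2 lI
  (fun b bn => (h b bn).1) (fun b bn => (h b bn).2).
by split=> // b bn; [exact: (h b bn).1|exact: (h b bn).2].
Qed.

Lemma pred_circuit_eval :
  circ_eval (pred_circuit T I) pred_input = [:: level_side n images (I - 2) (images (I - 1))].
Proof.
have [_ _ _ h _] := @final_wires (I - 2) ltac:(lia).
have e : (I - 2).+1 = I - 1 by lia.
rewrite e in h; rewrite -h /circ_eval /=; congr [:: _].
rewrite /block_wire /pred_wires -/(answer T I); congr nth; rewrite /run_gates.
by elim: (gates T I) pred_input => //= t l IH u; rewrite IH.
Qed.

End Correct.

(** * The two maps of the reduction *)

Definition bin (m : nat) : bits := binr m m.

Lemma binr_fuel f m : m <= f -> binr f m = bin m.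
Proof.
have H f1 f2 q : q <= f1 -> q <= f2 -> binr f1 q = binr f2 q.
  elim: f1 f2 q => [|f1 IH] [|f2] [|q] //= h1 h2; congr cons; apply: IH; lia.
by move=> mf; apply: H.
Qed.

Lemma bin_pos m : 0 < m -> bin m = odd m :: bin m./2.
Proof.
by case: m => // m _; rewrite {1}/bin [binr _ _]/= binr_fuel //; lia.
Qed.

Definition bval (s : bits) : nat := foldr (fun (b : bool) v => b + v.*2) 0 s.

Lemma binK m : bval (bin m) = m.
Proof.
elim/ltn_ind: m => m IH; case: (posnP m) => [->|m0] //.
by rewrite bin_pos //= IH ?odd_double_half //; lia.
Qed.

Lemma nth_bin m j : nth false (bin m) j = odd (m %/ 2 ^ j).
Proof.
elim: j m => [|j IH] m; case: (posnP m) => [->|m0]; rewrite ?div0n ?nth_nil //.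
- by rewrite bin_pos // divn1.
- by rewrite bin_pos //= IH -divn2 -divnMA expnS.
Qed.

(** The cut-off acts at every step because the intermediate unary values must stay below [B] as
    well. A value that has reached [B] cannot drop below it under doubling, so the result is a
    single final cut-off. *)
Definition cval B (s : bits) : nat := foldr (fun (b : bool) v => minn B (b + v.*2)) 0 s.

Lemma cvalE B s : cval B s = minn B (bval s).
Proof. by elim: s => [|b s IH] /=; [lia|rewrite IH; lia]. Qed.

Lemma toks_enc_nats s : toks (enc_nats s) = map bin s.
Proof. by rewrite -[RHS]toks_items -map_comp. Qed.

Lemma enc_nats_inj : injective enc_nats.
Proof.
move=> s t e; have := toks_enc_nats s; rewrite e toks_enc_nats => h.
have /(congr1 (map bval)) := h; rewrite -!map_comp !(@eq_map _ _ _ id) ?map_id //;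
  exact: binK.
Qed.

Lemma toks_enc_pair x s : toks (enc_pair x s) = x :: toks s.
Proof. by rewrite -toks_item /item -catA. Qed.

(* The numbers in the code of a valid instance never exceed their quantity, so the
   cut-off is harmless there; it keeps unary numbers short on other inputs. *)
Definition nums (x : bits) : seq nat := map (cval (size (toks x))) (toks x).

Lemma nums_enc s : all (fun m => m <= size s) s -> nums (enc_nats s) = s.
Proof.
move=> /allP h; rewrite /nums toks_enc_nats size_map -map_comp.
rewrite -[RHS]map_id; apply/eq_in_map => m /h ms /=.
by rewrite cvalE binK; lia.
Qed.

Lemma gate_code_inj g g' s s' : gate_code g ++ s = gate_code g' ++ s' -> g = g' /\ s = s'.
Proof. by case: g => [a b|a b|a]; case: g' => [a' b'|a' b'|a'] //= [] *; subst. Qed.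

Lemma circ_code_inj C C' s s' : circ_code C ++ s = circ_code C' ++ s' -> C = C' /\ s = s'.
Proof.
case: C => i gs o; case: C' => i' gs' o'; rewrite /circ_code /= -!catA /=.
move=> [-> sg eg].
have [-> {}eg] : gs = gs' /\ size o :: o ++ s = size o' :: o' ++ s'.
  elim: gs gs' sg eg => [|g gs IH] [|g' gs'] //= [sg].
  rewrite -!catA => /gate_code_inj[-> /(IH _ sg)[-> ->]] //.
case: eg => so /eqP; rewrite eqseq_cat // => /andP[/eqP -> /eqP ->] //.
Qed.

(** A solution of Short Choice brings its own [n] and predicates; injectivity of the code identifies
    them with the constructed ones. *)
Lemma circ_codes_inj P P' :
  flatten (map circ_code P) = flatten (map circ_code P') -> P = P'.
Proof.
elim: P P' => [|C P IH] [|C' P'] //.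
by move=> /circ_code_inj[-> /IH ->].
Qed.

Lemma val_rcons s b : val_of_bits (rcons s b) = (val_of_bits s).*2 + b.
Proof. by rewrite /val_of_bits foldl_rcons. Qed.

Lemma val_inj s t : size s = size t -> val_of_bits s = val_of_bits t -> s = t.
Proof.
elim/last_ind: s t => [|s b IH] t; elim/last_ind: t => [|t b' _] //; rewrite ?size_rcons //.
move=> [st]; rewrite !val_rcons => e.
have [eb ev] : b = b' /\ val_of_bits s = val_of_bits t.
  by case: b e; case: b' => /= e; split=> //; lia.
by rewrite eb (IH t).
Qed.

Lemma val_ones m : val_of_bits (nseq m true) = 2 ^ m - 1.
Proof.
have e k : nseq k.+1 true = rcons (nseq k true) true by elim: k => //= k <-.
elim: m => // m IH; rewrite e val_rcons IH expnS.
have : 0 < 2 ^ m by rewrite expn_gt0.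
lia.
Qed.

Lemma val_lt s : val_of_bits s < 2 ^ size s.
Proof.
elim/last_ind: s => // s b IH; rewrite val_rcons size_rcons expnS.
by case: b; lia.
Qed.

(** Turns a string with the most significant bit first into [bin] of its value without forming that
    value, which in unary would be exponentially long. *)
Definition strip (s : bits) : bits :=
  foldl (fun t b => if nilp t && ~~ b then [::] else b :: t) [::] s.

Lemma bin_double m (b : bool) :
  bin (m.*2 + b) = if nilp (bin m) && ~~ b then [::] else b :: bin m.
Proof.
case: (posnP m) => [->|m0]; first by case: b.
rewrite bin_pos; last lia.
have -> : nilp (bin m) = false by rewrite bin_pos.
by rewrite /= addnC half_bit_double oddD odd_double addbF oddb.
Qed.

Lemma strip_bin s : strip s = bin (val_of_bits s).
Proof.
elim/last_ind: s => // s b IH.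
by rewrite /strip foldl_rcons -/(strip s) IH val_rcons bin_double.
Qed.

Definition pcode T I : seq nat :=
  [:: I * tk T 0, size (gates T I) & flatten (gates T I)] ++ [:: 1; answer T I].

(* For n = 1 the reduction outputs the instance of size 2 with the predicate that
   returns its first input bit. *)
Definition ftokens (x : bits) : seq nat :=
  let T := nums x in
  if tk T 0 <= 1 then [:: 2; 4; 0; 1; 0]
  else tk T 0 :: flatten [seq pcode T i.+2 | i <- iota 0 (tk T 0).-1].

(** [bin] lists the least significant bit first and [nbits] the most significant one. *)
Definition unpack n (t : bits) : bits := [seq nth false t (n - 1 - i) | i <- iota 0 n].

(* [hole] read off the wires of the circuit for P_k.  No wire that depends on the
   last element is used, so the inputs for that element are set to 0 in [ginput]. *)
Definition ghole T k (c : bool) (w : bits) (b : nat) : bool :=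
  if nth false w (block T k.+2 k 1 + b) then nth false w (block T k.+2 k 29 + b)
  else if nth false w (block T k.+2 k 15 + b) then c
  else ~~ (if c == nth false w (block T k.+2 k 19 + (tk T 0).-1)
           then nth false w (block T k.+2 k 29 + b)
           else nth false w (block T k.+2 k 0 + b)).

Definition ginput n k (l : seq bits) : bits :=
  flatten [seq unpack n (nth [::] l (3 + j)) | j <- iota 0 k.+1] ++ nseq n false.

(** Token 0 is the instance, 1 is k, 2 is c and [3 + j] is a_j. As [bin 0] is empty, c is read as
    nonemptiness. The elements a_j are only unpacked bitwise, being exponentially large as
    numbers. *)
Definition gbits (z : bits) : bits :=
  let l := toks z in
  let x := nth [::] l 0 in
  let T := nums x in
  if tk T 0 <= 1 then [::] else
  let k := cval (size (toks x)) (nth [::] l 1) in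
  let w := run_gates (gates T k.+2) (ginput (tk T 0) k l) in
  strip [seq ghole T k (~~ nilp (nth [::] l 2)) w b | b <- iota 0 (tk T 0)].

Definition fbits (x : bits) : bits := enc_nats (ftokens x).
Definition gres (z : bits) : bits := item (gbits z).

(** * Reading an instance of Empty from its tokens *)

Section Instance.
Variables (n : nat) (C : circuit).
Hypothesis valid : empty_valid n C.

Local Notation T := (n :: circ_code C).
Local Notation G := (size (c_gates C)).

Lemma valid_parts : [/\ c_in C = n, size (c_out C) = n,
   forall h, h < G -> gate_wf (n + h) (nth (GNot 0) (c_gates C) h)
   & forall b, b < n -> nth 0 (c_out C) b < n + G].
Proof.
case: valid => _ /and3P[/andP[h1 h2] /eqP i /eqP o]; split=> //.
- by move=> h hG; rewrite -i; apply: (allP h1); rewrite mem_iota.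
- by move=> b bn; rewrite -i; apply: (allP h2); rewrite mem_nth // o.
Qed.

Lemma size_codes gs : size (flatten (map gate_code gs)) = 3 * size gs.
Proof. by elim: gs => //= g gs IH; rewrite size_cat IH; case: g => *; rewrite /=; lia. Qed.

Lemma nth_codes gs h r : h < size gs -> r < 3 ->
  nth 0 (flatten (map gate_code gs)) (3 * h + r) = nth 0 (gate_code (nth (GNot 0) gs h)) r.
Proof.
have s3 g : size (gate_code g) = 3 by case: g.
elim: gs h => // g gs IH [|h] hG r3; rewrite /= nth_cat s3.
  by rewrite muln0 add0n r3.
have -> : (3 * h.+1 + r < 3) = false by lia.
have -> : 3 * h.+1 + r - 3 = 3 * h + r by lia.
exact: IH.
Qed.

(** Entries are gate kinds, counts, or wire indices below [n + G], while the list has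
    [3 * G + n + 4] entries; the cut-off changes nothing. *)
Lemma nums_instance : nums (enc_nats T) = T.
Proof.
have [ci so wg wo] := valid_parts.
apply: nums_enc; set N := size T.
have eN : N = 3 * G + n + 4.
  by rewrite /N /circ_code /= !size_cat size_codes /= so; lia.
rewrite /circ_code /= ci all_cat /= so.
have cs : all (fun m => m <= N) (flatten [seq gate_code i | i <- c_gates C]).
  apply/(all_nthP 0) => i; rewrite size_codes => iG.
  have -> : i = 3 * (i %/ 3) + i %% 3 by rewrite mulnC -divn_eq.
  have h3 : i %/ 3 < G by lia.
  rewrite nth_codes //; last by rewrite ltn_mod.
  have := wg _ h3; have : i %% 3 < 3 by rewrite ltn_mod.
  by case: (nth _ _ _) => [p q|p q|p] /=; case: (i %% 3) => [|[|[|r]]] //=; lia.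
have os : all (fun m => m <= N) (c_out C).
  by apply/(all_nthP 0) => b; rewrite so => bn; have := wo b bn; lia.
by rewrite cs os; lia.
Qed.

Lemma tk_instance : [/\ tk T 0 = n, tk T 2 = G,
   forall h r, h < G -> r < 3 ->
     tk T (3 + 3 * h + r) = nth 0 (gate_code (nth (GNot 0) (c_gates C) h)) r
   & forall b, src_out T b = nth 0 (c_out C) b].
Proof.
split=> // [h r hG r3|b].
  rewrite /tk /circ_code -addnA /= nth_cat size_codes.
  have -> : 3 * h + r < 3 * G by lia.
  exact: nth_codes.
rewrite /src_out /tk.
have -> : nth 0 T 2 = G by [].
have -> : 4 + 3 * G + b = (3 * G + b.+1).+3 by lia.
rewrite /circ_code /= nth_cat size_codes.
by rewrite ltnNge leq_addr /= addKn.
Qed.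

Lemma gate_instance h : h < G -> gate_of (src_gate T h) = nth (GNot 0) (c_gates C) h.
Proof.
move=> hG; have [_ _ tg _] := tk_instance.
have t0 := tg h 0 hG isT; have t1 := tg h 1 hG isT; have t2 := tg h 2 hG isT.
rewrite /gate_of /src_gate /=; rewrite addn0 in t0.
have -> : 4 + 3 * h = 3 + 3 * h + 1 by lia.
have -> : 5 + 3 * h = 3 + 3 * h + 2 by lia.
by rewrite t0 t1 t2; case: (nth (GNot 0) _ _).
Qed.

Lemma src_instance : src_circuit T = C.
Proof.
have [ci so wg wo] := valid_parts; have [t0 t2 tg tO] := tk_instance.
rewrite /src_circuit t0 t2; case: C ci so tO gate_instance => i gs o /= -> so tO gi.
congr Circuit.
- apply: (@eq_from_nth _ (GNot 0)); rewrite ?size_map ?size_iota // => h hG.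
  by rewrite (nth_map 0) ?size_iota // nth_iota // add0n gi.
- apply: (@eq_from_nth _ 0); rewrite ?size_map ?size_iota // => h hG.
  by rewrite (nth_map 0) ?size_iota // nth_iota // add0n tO.
Qed.

Lemma wf_gate_instance h : h < tk T 2 -> gate_wf (tk T 0 + h) (gate_of (src_gate T h)).
Proof.
have [_ _ wg _] := valid_parts; have [-> -> _ _] := tk_instance => hG.
by rewrite gate_instance //; exact: wg.
Qed.

Lemma wf_out_instance b : b < tk T 0 -> src_out T b < tk T 0 + tk T 2.
Proof.
have [_ _ _ wo] := valid_parts; have [-> -> _ ->] := tk_instance; exact: wo.
Qed.

Lemma pcode_circuit I : pcode T I = circ_code (pred_circuit T I).
Proof.
rewrite /pcode /circ_code /= size_map; congr [:: _, _ & _ ++ _].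
have : allp (fun _ t => gate_code (gate_of t) = t) (I * tk T 0) (gates T I).
  apply/allp_gates; split=> [j h jI hG|j b jI bn|q b q3 bn|l q b lI q27 bn] //.
  - have [_ _ tg _] := tk_instance; have := tg h 0 hG isT.
    rewrite addn0 /copy_gate /gate_of /= => ->.
    by case: (nth (GNot 0) _ _).
  - by case: q q3 => [|[|[|]]].
  - rewrite /level_gate /gate_of.
    have : all (fun q => nth 0 (nth [::] program q) 0 <= 2) (iota 0 27) by [].
    move=> /allP /(_ q); rewrite mem_iota q27 => /(_ isT).
    by case: (nth 0 _ 0) => [|[|[|]]].
move: (I * _) (gates _ _) => p l; elim: l p => //= t l IH p [-> /IH] {1}-> //.
Qed.

End Instance.

(** * From solutions of Short Choice to empty points *)

Section Main.
Variables (n : nat) (C : circuit).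
Hypothesis valid : empty_valid n C.
Hypothesis n1 : 1 < n.
Local Notation T := (n :: circ_code C).

Definition preds : seq circuit := [seq pred_circuit T i.+2 | i <- iota 0 n.-1].

Lemma fbits_instance : fbits (enc_nats T) = enc_nats (n :: flatten (map circ_code preds)).
Proof.
rewrite /fbits /ftokens nums_instance //.
have -> : tk T 0 = n by [].
rewrite leqNgt n1 /=; congr enc_nats; congr (_ :: flatten _).
by rewrite -map_comp; apply: eq_map => i /=; exact: pcode_circuit.
Qed.

Lemma nth_preds i : i < n.-1 -> nth (Circuit 0 [::] [::]) preds i = pred_circuit T i.+2.
Proof. by move=> h; rewrite (nth_map 0) ?size_iota // nth_iota. Qed.

Lemma preds_valid : sc_valid n preds.
Proof.
split=> //; split=> [|i ni]; first by rewrite size_map size_iota.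
rewrite nth_preds //; apply: (@pred_circuit_type T) => //.
- exact: wf_gate_instance.
- exact: wf_out_instance.
Qed.

Definition image y : nat -> bool := fun b => nth false (circ_eval C (nbits n y)) b.
Definition vec (a : seq nat) j := image (nth 0 a j).

Lemma images_vec a j : images T a j = vec a j.
Proof. by rewrite /images src_instance. Qed.

Lemma sc_predE i a y : i < n.-1 -> i < size a ->
  sc_pred n preds i a y = level_side n (vec a) i (image y).
Proof.
move=> ni ia; rewrite /sc_pred nth_preds //.
set A := rcons (take i.+1 a) y.
have sA : size A = i.+2 by rewrite size_rcons size_take; case: ltnP => //; lia.
have := @pred_circuit_eval T n1 (wf_gate_instance valid) (wf_out_instance valid) i.+2 isT A sA.
rewrite /pred_input => ->; rewrite [head _ _]/=.
have [-> ->] : i.+2 - 2 = i /\ i.+2 - 1 = i.+1 by lia.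
have e j : j <= i -> images T A j = vec a j.
  move=> ji; rewrite images_vec /vec nth_rcons size_take.
  case: (ltnP i.+1 (size a)) => h.
    by rewrite ltnS ji nth_take.
  have -> : j < size a by lia.
  by rewrite nth_take.
rewrite /level_side (@state_ext _ _ (vec a)) // e //.
by rewrite images_vec /vec nth_rcons size_takel // ltnn eqxx.
Qed.

Lemma side_ext F z v w w' : same n w w' -> side n F z v w = side n F z v w'.
Proof.
move=> h; apply: eq_in_has => b; rewrite mem_iota add0n => bn; by rewrite h.
Qed.

Lemma image_eq x e : size e = n -> val_of_bits (circ_eval C (nbits n x)) = val_of_bits e ->
  same n (image x) (nth false e).
Proof.
move=> se h b bn; rewrite /image (val_inj _ h) // se.
by have [_ so _ _] := valid_parts valid; rewrite /circ_eval size_map.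
Qed.

(** The hole is not 1...1, so its value is in range. If [C] mapped some x of the universe to it, x
    would be new, since the hole is no image of an a_j, and would extend the subcertificate with
    answer [c]. *)
Lemma hole_empty k a c e : sc_sol n preds k a c -> size e = n ->
  (forall b, b < n -> nth false e b = hole n (vec a) k c b) ->
  empty_sol n C (val_of_bits e).
Proof.
move=> [kn [sa [[_ [aU [ua sub]]] no]]] se he.
have kn2 : k.+2 <= n by lia.
have cons i j : i < j -> j <= k ->
    level_side n (vec a) i (vec a j) = level_side n (vec a) i (vec a i.+1).
  move=> ij jk; have := sub i j ij; rewrite sa => /(_ jk).
  by rewrite !sc_predE; [apply|lia|lia|lia|lia]; lia.
have pv u : pivots (vec a) k.+1 u -> ~ same n u (nth false e).
  move=> pu h; apply: (hole_pivots kn2 cons pu (c := c)).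
  by move=> b bn; rewrite h // he.
split.
  have := val_lt e; rewrite se => lt.
  suff : val_of_bits e <> 2 ^ n - 1 by lia.
  rewrite -val_ones => h; apply: (pv (fun=> true)); first by left.
  move=> b bn; rewrite (val_inj _ h) ?nth_nseq ?bn //.
  by rewrite size_nseq.
move=> x xU ex; have sx := image_eq se ex.
apply: no; exists x.
have sxh : same n (image x) (hole n (vec a) k c).
  by move=> b bn; rewrite sx // he.
have xa : x \notin a.
  apply/negP => /(nthP 0)[j jk xj]; apply: (pv (vec a j)).
    by right; exists j; rewrite // -sa.
  by rewrite /vec xj.
have side_x i : level_side n (vec a) i (image x)
    = level_side n (vec a) i (hole n (vec a) k c) by exact: side_ext.
have inU : in_U n x by [].
split; last by rewrite sc_predE ?sa ?side_x ?hole_side //; lia.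
split=> //; split=> //; split; first by rewrite size_rcons.
split; first by rewrite all_rcons inU.
split; first by rewrite rcons_uniq xa.
move=> i j ij; rewrite size_rcons sa => jk ik.
have tk0 y : sc_pred n preds i (rcons a x) y = sc_pred n preds i a y.
  rewrite /sc_pred; congr (head _ (circ_eval _ (flatten (map _ (rcons _ _))))).
  by rewrite -cats1 takel_cat //; lia.
rewrite !tk0 !nth_rcons sa.
have kk : k < size a by rewrite sa.
(* The case [j = k.+1] is the new element: trivial for [i = k], and [hole_agrees] for [i < k]. *)
move: jk; rewrite ltnS leq_eqVlt => /orP[/eqP ->|jk].
  rewrite ltnn eqxx; move: ik; rewrite /= ltnS leq_eqVlt => /orP[/eqP ->|ik].
    by rewrite ltnn eqxx.
  rewrite ltnS ik !sc_predE ?sa; try lia.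
  by rewrite side_x hole_agrees.
have -> : i.+1 < k.+1 by lia.
by rewrite jk; apply: sub; rewrite ?sa //; lia.
Qed.

End Main.

(** * Running time of the two maps *)

Section Vars.
Context {G : Type} {g : ctx G} {A B C D : Type}
  {a : enc A} {b : enc B} {c : enc C} {d : enc D}.
Lemma pt_var1 : PT (fun c : G * A * B => c.1.2).
Proof. exact: pt_weak (pt_var (G := G)). Qed.
Lemma pt_var2 : PT (fun c : G * A * B * C => c.1.1.2).
Proof. exact: pt_weak pt_var1. Qed.
Lemma pt_var3 : PT (fun c : G * A * B * C * D => c.1.1.1.2).
Proof. exact: pt_weak pt_var2. Qed.
End Vars.

Lemma pt_nat_of_bool (G : Type) (g : ctx G) (b : G -> bool) :
  PT b -> PT (fun c => nat_of_bool (b c)).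
Proof.
move=> Hb; apply: (@pt_ext _ _ _ _ (fun c => if b c then 1 else 0)).
  by apply: pt_if => //; exact: pt_const.
by move=> c; case: (b c).
Qed.

Lemma pt_double (G : Type) (g : ctx G) (x : G -> nat) : PT x -> PT (fun c => (x c).*2).
Proof.
move=> Hx; apply: (@pt_ext _ _ _ _ (fun c => x c + x c)); first exact: pt_addn.
by move=> c; rewrite addnn.
Qed.

Ltac pt_hyp :=
  match goal with
  | H : PT _ |- _ =>
      first [ exact H | exact (pt_weak H) | exact (pt_weak (pt_weak H))
            | exact (pt_weak (pt_weak (pt_weak H)))
            | exact (pt_weak (pt_weak (pt_weak (pt_weak H)))) ]
  end.

(** Proof search directed by the syntax of the function body. Since [<] unfolds to [leq (S _) _], it
    is matched before [leq]. *)
Ltac pt_step :=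
  first
  [ lazymatch goal with |- PT (fun _ => ?x) => exact (pt_const _ x) end
  | pt_hyp | exact pt_var | exact pt_var1 | exact pt_var2 | exact pt_var3
  | lazymatch goal with
    | |- PT (fun c => addn (@?x c) (@?y c)) => apply: pt_addn
    | |- PT (fun c => muln (@?x c) (@?y c)) => apply: pt_muln
    | |- PT (fun c => subn (@?x c) (@?y c)) => apply: pt_subn
    | |- PT (fun c => minn (@?x c) (@?y c)) => apply: pt_minn
    | |- PT (fun c => leq (S (@?x c)) (@?y c)) => apply: pt_ltn
    | |- PT (fun c => leq (@?x c) (@?y c)) => apply: pt_leq
    | |- PT (fun c => S (@?x c)) => apply: pt_S
    | |- PT (fun c => predn (@?x c)) => apply: pt_pred
    | |- PT (fun c => double (@?x c)) => apply: pt_double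
    | |- PT (fun c => half (@?x c)) => apply: pt_half
    | |- PT (fun c => odd (@?x c)) => apply: pt_odd
    | |- PT (fun c => nat_of_bool (@?x c)) => apply: pt_nat_of_bool
    | |- PT (fun c => @eq_op _ (@?x c) (@?y c)) => first [apply: pt_eqn | apply: pt_eqb]
    | |- PT (fun c => ~~ (@?x c)) => apply: pt_negb
    | |- PT (fun c => (@?x c) && (@?y c)) => apply: pt_andb
    | |- PT (fun c => (@?x c) || (@?y c)) => apply: pt_orb
    | |- PT (fun c => nilp (@?x c)) => apply: pt_nilp
    | |- PT (fun c => size (@?x c)) => apply: pt_size
    | |- PT (fun c => rev (@?x c)) => apply: pt_rev
    | |- PT (fun c => iota 0 (@?x c)) => apply: pt_iota
    | |- PT (fun c => nth ?d (@?x c) (@?y c)) => apply: pt_nth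
    | |- PT (fun c => cat (@?x c) (@?y c)) => apply: pt_cat
    | |- PT (fun c => rcons (@?x c) (@?y c)) => apply: pt_rcons
    | |- PT (fun c => cons (@?x c) (@?y c)) => apply: pt_cons
    | |- PT (fun c => flatten (map (@?h c) (@?s c))) =>
        apply: (@pt_flatmap _ _ _ _ _ _ s h)
    | |- PT (fun c => filter (@?h c) (@?s c)) => apply: (@pt_filter _ _ _ _ s h)
    | |- PT (fun c => map (@?h c) (@?s c)) => apply: (@pt_map _ _ _ _ _ _ s h)
    | |- PT (fun c => Raw (@?x c)) => apply: pt_implode
    | |- PT (fun c => unraw (@?x c)) => apply: pt_explode
    end
  | eapply pt_if ].

Ltac pt := repeat pt_step.

Section Gates.
Context {G : Type} {g : ctx G}.
Variables (T : G -> seq nat) (I : G -> nat).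
Hypotheses (HT : PT T) (HI : PT I).

Lemma pt_gates : PT (fun c => gates (T c) (I c)).
Proof.
rewrite /gates /copy_gate /image_gate /const_gate /level_gate /operand /block /base
  /src_out /reloc /tk.
pt.
Qed.

End Gates.

Lemma code_bools (s : seq bool) : size (code s) = 4 * size s.
Proof. by elim: s => // b s IH; rewrite code_cons IH /=; lia. Qed.

(** Replaces the recursion of [binr] by a loop over list positions: bit [j] exists as long as [m]
    halved [j] times is not 0. *)
Lemma bin_iter m : bin m =
  [seq odd (iter j half m) | j <- [seq j <- iota 0 m | iter j half m != 0]].
Proof.
suff H f : forall p, p <= f -> bin p =
    [seq odd (iter j half p) | j <- [seq j <- iota 0 f | iter j half p != 0]].
  exact: H.
elim: f => [|f IH] [|p] pf //.
  rewrite (_ : [seq j <- _ | _] = [::]) //.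
  apply/eqP; rewrite -(negbK (_ == _)) -has_filter; apply/hasPn => j _.
  by rewrite negbK; elim: j => //= j /eqP ->.
rewrite bin_pos // (IH p.+1./2); last lia.
have -> : iota 0 f.+1 = 0 :: map S (iota 0 f) by rewrite -(iotaDl 1 0 f).
have e : preim S (fun j => iter j half p.+1 != 0) =1 fun j => iter j half p.+1./2 != 0.
  by move=> j; rewrite /= -[_./2]/(iter j.+1 half p.+1) iterSr.
rewrite /= filter_map (eq_filter e) -map_comp; congr (_ :: _).
by apply: eq_map => j; rewrite [in RHS]/= -iterS iterSr.
Qed.

Section Numbers.
Context {G : Type} {g : ctx G}.

Lemma pt_iter_half (m j : G -> nat) : PT m -> PT j -> PT (fun c => iter (j c) half (m c)).
Proof.
move=> Hm Hj; have [q pq bq] := pt_bound Hm.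
apply: (pt_iter (h := fun _ => half)) => //; first pt.
exists q => // c i _; apply: leq_trans (bq c).
rewrite !code_nat leq_mul2l /=; elim: i => //= i IH; lia.
Qed.

Lemma pt_cval (B : G -> nat) (s : G -> seq bool) : PT B -> PT s ->
  PT (fun c => cval (B c) (s c)).
Proof.
move=> HB Hs; have [q pq bq] := pt_bound HB.
pose h B v (b : bool) := minn B (b + v.*2).
apply: (@pt_ext _ _ _ _ (fun c => foldl (h (B c)) 0 (rev (s c)))).
  apply: (pt_foldl (h := fun c => h (B c))); rewrite /h; try by pt.
  exists q => // c i; apply: leq_trans (bq c); rewrite !code_nat leq_mul2l /=.
  elim/last_ind: (take i _) => // l b _; rewrite foldl_rcons; exact: geq_minl.
by move=> c; rewrite foldl_rev.
Qed.

End Numbers.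

Lemma pt_flatten (G : Type) (g : ctx G) A (a : enc A) (s : G -> seq (seq A)) :
  PT s -> PT (fun c => flatten (s c)).
Proof.
move=> Hs; apply: (@pt_ext _ _ _ _ (fun c => flatten [seq x | x <- s c])); first pt.
by move=> c; rewrite map_id.
Qed.

Section Tokens.
Context {G : Type} {g : ctx G}.

Lemma pt_bin (m : G -> nat) : PT m -> PT (fun c => bin (m c) : seq bool).
Proof.
move=> Hm; apply: (@pt_ext _ _ _ _ (fun c => [seq odd (iter j half (m c))
  | j <- [seq j <- iota 0 (m c) | iter j half (m c) != 0]])).
  by pt; apply: pt_iter_half; pt.
by move=> c; rewrite -bin_iter.
Qed.

Lemma pt_nums (x : G -> raw) : PT x -> PT (fun c => nums (unraw (x c))).
Proof.
move=> Hx; have Ht := pt_raw_toks Hx.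
apply: (@pt_ext _ _ _ _ (fun c => [seq cval (size (map Raw (toks (unraw (x c))))) (unraw t)
   | t <- map Raw (toks (unraw (x c)))])).
  by pt; apply: pt_cval; pt.
by move=> c; rewrite /nums -map_comp size_map.
Qed.

Lemma pt_ftokens (x : G -> raw) : PT x -> PT (fun c => ftokens (unraw (x c))).
Proof.
move=> Hx; have HT := pt_nums Hx.
rewrite /ftokens /pcode /answer /block /base /tk /=.
have Hg : PT (fun c : G * nat => gates (nums (unraw (x c.1))) (c.2).+2).
  by apply: pt_gates; pt.
pt; apply: pt_flatten; pt.
Qed.

Lemma pt_run_gates (gs : G -> seq (seq nat)) (w : G -> seq bool) :
  PT gs -> PT w -> PT (fun c => run_gates (gs c) (w c) : seq bool).
Proof.
move=> Hg Hw; have [p pp bp] := pt_bound Hg; have [q pq bq] := pt_bound Hw.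
pose val (w : seq bool) (t : seq nat) :=
  if nth 0 t 0 == 0 then nth false w (nth 0 t 1) && nth false w (nth 0 t 2)
  else if nth 0 t 0 == 1 then nth false w (nth 0 t 1) || nth false w (nth 0 t 2)
  else ~~ nth false w (nth 0 t 1).
have E v t : val v t = gate_val v (gate_of t).
  by rewrite /val /gate_of; case: (nth 0 t 0) => [|[|]].
apply: (@pt_ext _ _ _ _ (fun c => foldl (fun v t => rcons v (val v t)) (w c) (gs c))).
  apply: (pt_foldl (h := fun _ v t => rcons v (val v t))) => //.
    by rewrite /val; pt.
  exists (fun n => 4 * (q n + p n)); first by polys.
  move=> c i; have S l (v : seq bool) :
      size (foldl (fun v t => rcons v (val v t)) v l) = size v + size l.
    by elim: l v => [|t l IH] v; rewrite ?addn0 //= IH size_rcons addSnnS.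
  rewrite code_bools S leq_mul2l /=; apply: leq_add.
    exact: leq_trans (size_code _ _) (bq c).
  exact: leq_trans (size_code _ _) (leq_trans (code_take _ _ _) (bp c)).
move=> c; rewrite /run_gates; elim: (gs c) (w c) => //= t l IH v.
by rewrite E IH.
Qed.

Lemma pt_strip (s : G -> seq bool) : PT s -> PT (fun c => strip (s c) : seq bool).
Proof.
move=> Hs; have [q pq bq] := pt_bound Hs.
apply: (pt_foldl (h := fun _ t b => if nilp t && ~~ b then [::] else b :: t)) => //; try by pt.
exists (fun n => 4 * q n); first by polys.
move=> c i; rewrite code_bools leq_mul2l /=.
apply: leq_trans (leq_trans (size_code _ _) (leq_trans (code_take _ _ i) (bq c))).
elim/last_ind: (take i _) => // l b IH; rewrite foldl_rcons size_rcons.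
by case: ifP => _ //=.
Qed.

Lemma pt_gbits (z : G -> raw) : PT z -> PT (fun c => gbits (unraw (z c)) : seq bool).
Proof.
move=> Hz; have Hl := pt_raw_toks Hz.
pose l c := map Raw (toks (unraw (z c))).
have nl c j : nth [::] (toks (unraw (z c))) j = unraw (nth (Raw [::]) (l c) j).
  rewrite /l; case: (ltnP j (size (toks (unraw (z c))))) => h.
    by rewrite (nth_map [::]).
  by rewrite !nth_default ?size_map.
pose x c := nth (Raw [::]) (l c) 0.
have Hx : PT x by rewrite /x; pt.
have HT := pt_nums Hx; pose T c := nums (unraw (x c)); rewrite -/(T) in HT.
have Ht := pt_raw_toks Hx.
pose k c := cval (size (map Raw (toks (unraw (x c))))) (unraw (nth (Raw [::]) (l c) 1)).
have Hk : PT k by apply: pt_cval; pt.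
pose b c := ~~ nilp (unraw (nth (Raw [::]) (l c) 2) : seq bool).
have Hb : PT b by rewrite /b; pt.
pose i c := flatten [seq [seq nth false (unraw (nth (Raw [::]) (l c) (3 + j)) : seq bool)
    (tk (T c) 0 - 1 - i) | i <- iota 0 (tk (T c) 0)] | j <- iota 0 (k c).+1] ++
  [seq false | _ <- iota 0 (tk (T c) 0)].
have Hi : PT i by rewrite /i /tk; pt.
pose w c := run_gates (gates (T c) (k c).+2) (i c).
have Hw : PT (fun c => w c : seq bool).
  by apply: pt_run_gates => //; apply: pt_gates; pt.
apply: (@pt_ext _ _ _ _ (fun c => if tk (T c) 0 <= 1 then [::] else
   strip [seq ghole (T c) (k c) (b c) (w c) y | y <- iota 0 (tk (T c) 0)])).
  eapply pt_if; [by rewrite /tk; pt|by pt|apply: pt_strip].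
  by rewrite /ghole /block /base /tk; pt.
move=> c; rewrite /gbits !nl -/(x c) -/(T c) /w /i /k /b /ginput /unpack !size_map.
case: ifP => // _; congr strip.
have -> : nseq (tk (T c) 0) false = [seq false | _ <- iota 0 (tk (T c) 0)].
  by elim: (tk (T c) 0) {2}0 => //= m IH j; rewrite -IH.
have -> : [seq [seq nth false (nth [::] (toks (unraw (z c))) (3 + j)) (tk (T c) 0 - 1 - i0)
    | i0 <- iota 0 (tk (T c) 0)] | j <- iota 0 (cval (size (toks (unraw (x c))))
         (unraw (nth (Raw [::]) (l c) 1))).+1] =
  [seq [seq nth false (unraw (nth (Raw [::]) (l c) (3 + j)) : seq bool)
    (tk (T c) 0 - 1 - i) | i <- iota 0 (tk (T c) 0)] | j <- iota 0
     (cval (size (toks (unraw (x c)))) (unraw (nth (Raw [::]) (l c) 1))).+1].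
  by apply: eq_map => j; apply: eq_map => y; rewrite nl.
by [].
Qed.

End Tokens.

Lemma poly_time_ext (f h : bits -> bits) : f =1 h -> poly_time f -> poly_time h.
Proof.
move=> e [M [c [k H]]]; exists M, c, k => x.
by have [t [tl run]] := H x; exists t; rewrite -e.
Qed.

Lemma poly_time_fbits : poly_time fbits.
Proof.
have H : PT (fun c : unit * raw => [seq Raw (bin m) | m <- ftokens (unraw c.2)]).
  have Ht : PT (fun c : unit * raw => ftokens (unraw c.2)).
    by apply: pt_ftokens; exact: pt_var.
  by pt; apply: pt_bin; pt.
apply: poly_time_ext (PT_poly_time (F := fun x => [seq Raw (bin m) | m <- ftokens (unraw x)]) H).
by move=> x; rewrite /= -map_comp.
Qed.

Lemma poly_time_gres : poly_time gres.
Proof.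
have H : PT (fun c : unit * raw => [:: Raw (gbits (unraw c.2))]).
  have Hg : PT (fun c : unit * raw => gbits (unraw c.2) : seq bool).
    by apply: pt_gbits; exact: pt_var.
  by apply: pt_seq1; pt.
apply: poly_time_ext (PT_poly_time (F := fun x => [:: Raw (gbits (unraw x))]) H).
by move=> x; rewrite /= cats0.
Qed.

Lemma unpack_bin n m : unpack n (bin m) = nbits n m.
Proof. by apply: eq_map => i; rewrite nth_bin. Qed.

Lemma nbits0 n : nbits n 0 = nseq n false.
Proof.
apply: (@eq_from_nth _ false); rewrite ?size_mkseq ?size_nseq // => i ni.
by rewrite nth_mkseq // nth_nseq ni div0n.
Qed.

Section Answer.
Variables (n : nat) (C : circuit).
Hypothesis valid : empty_valid n C.
Local Notation T := (n :: circ_code C).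

Lemma gres_small s : n <= 1 -> gres (enc_pair (enc_nats T) s) = enc_nats [:: 0].
Proof.
move=> n1; rewrite /gres /gbits toks_enc_pair /= nums_instance //.
by have -> : tk T 0 <= 1 by [].
Qed.

Lemma gres_large k (c : bool) a : 1 < n -> k <= n - 2 -> size a = k.+1 ->
  exists e, [/\ gres (enc_pair (enc_nats T) (enc_nats [:: k, nat_of_bool c & a])) =
      enc_nats [:: val_of_bits e], size e = n &
    forall b, b < n -> nth false e b = hole n (vec n C a) k c b].
Proof.
move=> n1 kn sa.
rewrite /gres /gbits toks_enc_pair toks_enc_nats /= nums_instance //.
have -> : tk T 0 = n by [].
rewrite leqNgt n1 /=.
have -> : cval (size (toks (enc_nats T))) (bin k) = k.
  rewrite cvalE binK; apply/minn_idPr; rewrite toks_enc_nats size_map /= /circ_code /=.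
  have [_ so _ _] := valid_parts valid.
  by rewrite size_cat /= so; lia.
have -> : ~~ nilp (bin c) = c by case: c.
have -> : ginput n k [:: enc_nats T, bin k, bin c & [seq bin i | i <- a]]
    = pred_input T (rcons a 0).
  rewrite /pred_input map_rcons flatten_rcons nbits0 /ginput; congr (flatten _ ++ _).
  have -> : [seq nbits n i | i <- a] = [seq nbits n (nth 0 a j) | j <- iota 0 k.+1].
    by rewrite -sa (map_comp (nbits n) (nth 0 a)) map_nth_iota0 // take_size.
  apply/eq_in_map => j; rewrite mem_iota add0n => /= jk.
  by rewrite -unpack_bin (nth_map 0) // sa.
set w := run_gates _ _.
exists [seq ghole T k c w b | b <- iota 0 n].
have sr : size (rcons a 0) = k.+2 by rewrite size_rcons sa.
split; first by rewrite strip_bin /enc_nats /= cats0.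
  by rewrite size_map size_iota.
move=> b bn; rewrite (nth_map 0) ?size_iota // nth_iota // add0n.
have [h0 h1 h15 _ h19] := @final_wires T n1 (wf_gate_instance valid)
  (wf_out_instance valid) k.+2 isT (rcons a 0) sr k (ltnSn k).
have h29 := @block_wire_current T n1 (wf_gate_instance valid)
  (wf_out_instance valid) k.+2 isT (rcons a 0) sr k b (leqnSn _) bn.
have ev j : j <= k -> images T (rcons a 0) j = vec n C a j.
  by move=> jk; rewrite images_vec // /vec nth_rcons sa ltnS jk.
have es : state n (images T (rcons a 0)) k = state n (vec n C a) k by exact: state_ext.
rewrite es in h0 h1 h15; rewrite /level_side es !ev // in h19; rewrite ev // in h29.
have {}h15 := h15 b bn; rewrite ev // in h15.
rewrite /ghole -/(block_wire T k.+2 (rcons a 0) k 1 b) /hole /point'.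
rewrite -/(block_wire T k.+2 (rcons a 0) k 29 b) -/(block_wire T k.+2 (rcons a 0) k 15 b).
rewrite -/(block_wire T k.+2 (rcons a 0) k 0 b).
rewrite -/(block_wire T k.+2 (rcons a 0) k 19 (tk T 0).-1).
by rewrite h1 // h29 h15 h19 h0.
Qed.

End Answer.

Lemma reduction_correct x : sp_inst Empty x ->
  sp_inst ShortChoice (fbits x) /\
  forall s, sp_sol ShortChoice (fbits x) s -> sp_sol Empty x (gres (enc_pair x s)).
Proof.
case=> n [C [valid ->]]; case: (leqP n 1) => n1.
  split.
    exists 2, [:: Circuit 4 [::] [:: 0]]; split.
      by split=> //; split=> // -[|[|i]].
    rewrite /fbits /ftokens nums_instance //.
    by have -> : tk (n :: circ_code C) 0 <= 1 by [].
  move=> s _; exists n, C, 0; split=> //; split=> //; split; first exact: gres_small.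
  (* Here [n = 1]: the domain has [2 ^ 1 - 2 = 0] elements and 0 is below [2 ^ 1 - 1], so 0 is a
     solution whatever [s] is. *)
  by case: n valid n1 => [|[|n]] [] // _ _ _; split.
have pv := preds_valid valid n1.
rewrite fbits_instance //; split; first by exists n, (preds n C).
move=> s [n' [P' [k [a [c [v' [e' [-> sol]]]]]]]].
have := enc_nats_inj e' => -[en /circ_codes_inj eP].
rewrite -en -eP in sol.
have [kn [sa _]] := sol.
have [e [ge se he]] := gres_large valid c n1 kn sa.
exists n, C, (val_of_bits e); split=> //; split=> //; split; first exact: ge.
exact: hole_empty sol se he.
Qed.

Theorem theorem7 : poly_reduces Empty ShortChoice.
Proof.
exists fbits, gres; split; first exact: poly_time_fbits.
split; first exact: poly_time_gres.
exact: reduction_correct.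
Qed.
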